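(* Let $\alpha\in(1,2)$, $H>0$, $\kappa=H-\frac1\alpha$. Suppose that $X_\alpha$ and $\widetilde X_\alpha$ are two ($H$-self-similar) PFSMs or CFSMs having the representations $$X_\alpha(t)\stackrel d=\int_Z\int_{[0,q(z))}\int_{\mathbb R}\big(G(z,v,t+u)-G(z,v,u)\big)M_\alpha(dz,dv,du),$$ $$\widetilde X_\alpha(t)\stackrel d=\int_{\widetilde Z}\int_{[0,\widetilde q(z))}\int_{\mathbb R}\big(\widetilde G(z,v,t+u)-\widetilde G(z,v,u)\big)\widetilde M_\alpha(dz,dv,du),$$ where $(Z,\mathcal Z,\sigma)$, $(\widetilde Z,\widetilde{\mathcal Z},\widetilde\sigma)$ are standard Lebesgue spaces, $M_\alpha,\widetilde M_\alpha$ are symmetric $\alpha$-stable random measures with control measures $\sigma(dz)dvdu$, $\widetilde\sigma(dz)dvdu$, $$G(z,v,u)=b_1(z)^{[v+s(z)\ln|u|]_{q(z)}}\Big(F_1(z,\{v+s(z)\ln|u|\}_{q(z)})u_+^\kappa+F_2(z,\{v+s(z)\ln|u|\}_{q(z)})u_-^\kappa\Big)+1_{\{b_1(z)=1\}}1_{\{\kappa=0\}}F_3(z)\ln|u|$$ with measurable $b_1(z)\in\{-1,1\}$, $s(z)\ne0$, $q(z)>0$ a.e. $\sigma(dz)$, $F_1,F_2:Z\times[0,q(\cdot))\to\mathbb R$, $F_3:Z\to\mathbb R$, and $\widetilde G$ is defined in the same way through functions $\widetilde b_1,\widetilde s,\widetilde q,\widetilde F_1,\widetilde F_2,\widetilde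 F_3$ on $\widetilde Z$ (resp. $\widetilde Z\times[0,\widetilde q(\cdot))$) with the analogous properties. If $X_\alpha$ and $\widetilde X_\alpha$ are essentially identical, then there are maps $h:Z\to\mathbb R\setminus\{0\}$, $\psi:Z\to\widetilde Z$, $k:Z\to(0,\infty)$, $g,j:Z\to\mathbb R$ such that $$G(z,0,u)=h(z)\,\widetilde G(\psi(z),0,k(z)u+g(z))+j(z)\quad\text{a.e. }\sigma(dz)du.$$
   Context: $\stackrel d=$ means equality of finite-dimensional distributions of processes indexed by $t\in\mathbb R$. Two processes $X(t)$ and $Y(t)$ are essentially identical if $X(t)$ and $cY(t)$ have the same finite-dimensional distributions for some constant $c$. A standard Lebesgue space is a standard Borel space with a $\sigma$-finite measure. A symmetric $\alpha$-stable ($S\alpha S$) random measure $M_\alpha$ on $S$ with control measure $m$ satisfies $E\exp\{i\theta\int_S f\,dM_\alpha\}=\exp\{-|\theta|^\alpha\int_S|f|^\alpha dm\}$ for $f\in L^\alpha(S,m)$, $\theta\in\mathbb R$. All integral representations are understood to be well defined, i.e. the integrand is in $L^\alpha$ of the control measure for each $t\in\mathbb R$. A process is $H$-self-similar if for every $a>0$ the processes $\{X(at)\}_t$ and $\{a^HX(t)\}_t$ have the same finite-dimensional distributions. A $S\alpha S$ mixed moving average is a process having the same finite-dimensional distributions as $\int_X\int_{\mathbb R}(G(x,t+u)-G(x,u))M_\alpha(dx,du)$, $t\in\mathbb R$, where $(X,\mathcal X,\mu)$ is a standard Lebesgue space, $M_\alpha$ has control measure $\mu(dx)du$ and $G_t(x,u)=G(x,t+u)-G(x,u)$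 belongs to $L^\alpha(X\times\mathbb R,\mu(dx)du)$ for each $t$. For such a representation put $$C_P=\{x\in X:\exists\,c=c(x)\neq1\ (c>0):\ G(x,cu)=b\,G(x,u+a)+d\ \text{a.e. }du\ \text{for some }a,\,b\ne0,\,d\in\mathbb R\},$$ $$C_F=\{x\in X:\exists\,c_n=c_n(x)\to1\ (c_n\neq1):\ G(x,c_nu)=b_n\,G(x,u+a_n)+d_n\ \text{a.e. }du\ \text{for some }a_n,\,b_n\ne0,\,d_n\in\mathbb R\},$$ $C_L=C_P\setminus C_F$. A $S\alpha S$, $\alpha\in(1,2)$, self-similar mixed moving average having such a representation is called a periodic fractional stable motion (PFSM) if $X=C_P$ $\mu$-a.e., and a cyclic fractional stable motion (CFSM) if $X=C_L$ $\mu$-a.e. Notation: $[x]_a=\max\{n\in\mathbb Z:na\le x\}$, $\{x\}_a=x-a[x]_a$ for $x\in\mathbb R$, $a>0$. $Z\times[0,q(\cdot))=\{(z,v):z\in Z,\,0\le v<q(z)\}$. For $\kappa\neq0$, $u_+^\kappa=|u|^\kappa1_{\{u>0\}}$, $u_-^\kappa=|u|^\kappa1_{\{u<0\}}$; for $\kappa=0$, $u_+^\kappa=1_{(0,\infty)}(u)$, $u_-^\kappa=1_{(-\infty,0]}(u)$.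
   Formalization: It is additionally assumed that the kernels G(z,v,t+u)-G(z,v,u), t real, of the first representation have full support in Z×[0,q)×R; otherwise a set of z with zero kernel, which does not affect the process, makes the claim false. *)

(* Defs.v *)
From HB Require Import structures.
From mathcomp Require Import all_boot all_order all_algebra.
From mathcomp Require Import all_classical all_reals all_analysis.
Set Implicit Arguments.
Unset Strict Implicit.
Unset Printing Implicit Defensive.
Import Order.TTheory GRing.Theory Num.Theory.
Import numFieldNormedType.Exports.
Local Open Scope classical_set_scope.
Local Open Scope ring_scope.

(** * Standard Borel spaces

    A standard Borel space is a measurable space that is isomorphic, as a
    measurable space, to a Borel subset of a complete separable metric space.
    A standard Lebesgue space is a standard Borel space carrying a
    [{sigma_finite_measure set S -> \bar R}]. *)

Definition standard_borel (R : realType) d (S : measurableType d) : Prop :=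
  exists (M : completePseudoMetricType R) (phi : S -> M),
    [/\ hausdorff_space M,
        exists2 D : set M, countable D & dense D,
        injective phi,
        (forall B, <<s @open M >> B -> measurable (phi @^-1` B)) &
        (forall A, measurable A -> <<s @open M >> (phi @` A))].

(** * Finite-dimensional distributions *)

Section processes.
Context {R : realType}.

(* [X] and [Y] may live on different probability spaces. *)
Definition eq_fdd d (Om : measurableType d) (P : probability Om R)
    d' (Om' : measurableType d') (P' : probability Om' R)
    (X : R -> Om -> R) (Y : R -> Om' -> R) : Prop :=
  forall (n : nat) (t : n.-tuple R) (B : set (n.-tuple (measurableTypeR R))),
    measurable B ->
    P [set w | B [tuple X (tnth t i) w | i < n]] =
    P' [set w | B [tuple Y (tnth t i) w | i < n]].

Definition self_similar d (Om : measurableType d) (P : probability Om R)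
    (H : R) (X : R -> Om -> R) : Prop :=
  forall a : R, 0 < a ->
    eq_fdd P P (fun t => X (a * t)) (fun t w => a `^ H * X t w).

Definition essentially_identical
    d (Om : measurableType d) (P : probability Om R)
    d' (Om' : measurableType d') (P' : probability Om' R)
    (X : R -> Om -> R) (Y : R -> Om' -> R) : Prop :=
  exists c : R, eq_fdd P P' X (fun t w => c * Y t w).

(** * Stable random measures and integral representations

    A symmetric [alpha]-stable random measure on [S] with control measure [m]
    is given by its stochastic integral [M f], [f] in [L^alpha(S, m)]; the
    random variable attached to a set [A] of finite [m]-measure is [M \1_A].
    The integral is linear almost surely, and the last two clauses are the
    real and imaginary parts of
    [E exp(i theta (M f)) = exp (- |theta|^alpha * \int |f|^alpha dm)]. *)

Definition stable_random_measure (alpha : R)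
    dS (S : measurableType dS) (m : {measure set S -> \bar R})
    d (Om : measurableType d) (P : probability Om R)
    (M : (S -> R) -> {RV P >-> R}) : Prop :=
  (forall (a b : R) (f g : S -> R),
     f \in Lfun m alpha%:E -> g \in Lfun m alpha%:E ->
     {ae P, forall w, M (fun x => a * f x + b * g x) w = a * M f w + b * M g w})
  /\
  (forall (f : S -> R) (theta : R), f \in Lfun m alpha%:E ->
     ('E_P[fun w => cos (theta * M f w)] =
        (expR (- (`|theta| `^ alpha * \int[m]_x (`|f x| `^ alpha))))%:E)%E
     /\ ('E_P[fun w => sin (theta * M f w)] = 0)%E).

(* [X] has the representation [X(t) = \int_D f t dM] in the sense of
   finite-dimensional distributions, where [M] has control measure [m] and
   [\int_D f dM] is the integral of [f] extended by 0 outside [D]. *)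
Definition stable_representation (alpha : R)
    d (Om : measurableType d) (P : probability Om R) (X : R -> Om -> R)
    dS (S : measurableType dS) (m : {measure set S -> \bar R})
    (D : set S) (f : R -> S -> R) : Prop :=
  (forall t, f t \_ D \in Lfun m alpha%:E) /\
  exists (d' : measure_display) (Om' : measurableType d')
      (P' : probability Om' R) (M : (S -> R) -> {RV P' >-> R}),
    stable_random_measure alpha m M /\
    eq_fdd P P' X (fun t => M (f t \_ D)).

(* The family [f] has full support in [D]: no non-null measurable part of [D]
   is charged by none of the functions [f t].  This is the usual normalization
   [supp {f t, t \in R} = D] of an integral representation.  Without it the
   kernel could vanish on a non-null set on which the law of the process
   imposes no condition, so that the representation could not be determined
   by the law even up to a change of variables. *)
Definition full_support dS (S : measurableType dS)
    (m : {measure set S -> \bar R}) (D : set S) (f : R -> S -> R) : Prop :=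
  forall A : set S, measurable A -> A `<=` D ->
    (forall t, {ae m, forall x, A x -> f t x = 0}) -> m A = 0%E.

(** * Mixed moving averages, PFSMs and CFSMs *)

Definition increment (T : Type) (G : T -> R -> R) (t : R) (p : T * R) : R :=
  G p.1 (t + p.2) - G p.1 p.2.

Definition mixed_moving_average (alpha : R)
    d (Om : measurableType d) (P : probability Om R) (X : R -> Om -> R)
    dS (S : measurableType dS) (mu : {sigma_finite_measure set S -> \bar R})
    (G : S -> R -> R) : Prop :=
  [/\ standard_borel R S,
      measurable_fun [set: S * measurableTypeR R] (fun p => G p.1 p.2) &
      stable_representation alpha P X (mu \x @lebesgue_measure R)%E
        setT (increment G)].

Definition C_P (T : Type) (G : T -> R -> R) : set T :=
  [set x | exists c : R, [/\ 0 < c, c != 1 &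
     exists a b d : R, b != 0 /\
       {ae @lebesgue_measure R, forall u, G x (c * u) = b * G x (u + a) + d}]].

Definition C_F (T : Type) (G : T -> R -> R) : set T :=
  [set x | exists c : nat -> R,
     [/\ c n @[n --> \oo] --> (1 : R), (forall n, c n != 1) &
      forall n, exists a b d : R, b != 0 /\
       {ae @lebesgue_measure R,
          forall u, G x (c n * u) = b * G x (u + a) + d}]].

Definition C_L (T : Type) (G : T -> R -> R) : set T := C_P G `\` C_F G.

Definition PFSM (alpha H : R)
    d (Om : measurableType d) (P : probability Om R) (X : R -> Om -> R) : Prop :=
  self_similar P H X /\
  exists (dS : measure_display) (S : measurableType dS)
      (mu : {sigma_finite_measure set S -> \bar R}) (G : S -> R -> R),
    mixed_moving_average alpha P X mu G /\ {ae mu, forall x, C_P G x}.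

Definition CFSM (alpha H : R)
    d (Om : measurableType d) (P : probability Om R) (X : R -> Om -> R) : Prop :=
  self_similar P H X /\
  exists (dS : measure_display) (S : measurableType dS)
      (mu : {sigma_finite_measure set S -> \bar R}) (G : S -> R -> R),
    mixed_moving_average alpha P X mu G /\ {ae mu, forall x, C_L G x}.

(** * The canonical kernel *)

(* [x]_a and {x}_a, meaningful for [0 < a]. *)
Definition ipart (a x : R) : int := Num.floor (x / a).
Definition fpart (a x : R) : R := x - a * (ipart a x)%:~R.

Lemma ipart_max (a x : R) (n : int) :
  0 < a -> (n%:~R * a <= x) = (n <= ipart a x).
Proof. by move=> a0; rewrite /ipart floor_ge_int -ler_pdivlMr. Qed.

Definition pospow (kappa u : R) : R :=
  if kappa == 0 then (0 < u)%R%:R else `|u| `^ kappa * (0 < u)%R%:R.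

Definition negpow (kappa u : R) : R :=
  if kappa == 0 then (u <= 0)%R%:R else `|u| `^ kappa * (u < 0)%R%:R.

(* The value at [u = 0], where [ln 0] is the library's default, is immaterial:
   kernels only matter up to a null set of [u]. *)
Definition canonical_kernel (T : Type) (kappa : R) (b1 s q : T -> R)
    (F1 F2 : T -> R -> R) (F3 : T -> R) (z : T) (v u : R) : R :=
  let y := v + s z * ln `|u| in
  b1 z ^ ipart (q z) y *
    (F1 z (fpart (q z) y) * pospow kappa u + F2 z (fpart (q z) y) * negpow kappa u)
  + (b1 z == 1)%:R * (kappa == 0)%:R * (F3 z * ln `|u|).

(* The set of [(z, v)] with [0 <= v < q z]. *)
Definition under_graph (T : Type) (q : T -> R) : set (T * R) :=
  [set p | 0 <= p.2 < q p.1].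

(* [F1] and [F2] are total functions, of which only the values on
   [under_graph q] matter. *)
Definition canonical_data d (Z : measurableType d)
    (sigma : {measure set Z -> \bar R})
    (b1 s q : Z -> R) (F1 F2 : Z -> R -> R) (F3 : Z -> R) : Prop :=
  [/\ [/\ measurable_fun setT b1, measurable_fun setT s & measurable_fun setT q],
      [/\ measurable_fun (under_graph q : set (Z * measurableTypeR R))
            (fun p => F1 p.1 p.2),
          measurable_fun (under_graph q : set (Z * measurableTypeR R))
            (fun p => F2 p.1 p.2) &
          measurable_fun setT F3] &
      {ae sigma, forall z, [/\ b1 z = 1 \/ b1 z = -1, s z != 0 & 0 < q z]}].

(* The integrand is [G(z, v, t + u) - G(z, v, u)] as a function of
   [((z, v), u)], integrated over [Z x [0, q) x R] against a stable random
   measure with control measure [sigma(dz) dv du]. *)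
Definition canonical_integrand (T : Type) (G : T -> R -> R -> R) (t : R)
    (p : (T * R) * R) : R :=
  increment (fun zv : T * R => G zv.1 zv.2) t p.

Definition canonical_control d (Z : measurableType d)
    (sigma : {sigma_finite_measure set Z -> \bar R}) :
    {measure set ((Z * measurableTypeR R) * measurableTypeR R) -> \bar R} :=
  ((sigma \x @lebesgue_measure R) \x @lebesgue_measure R)%E.

Definition canonical_domain (T : Type) (q : T -> R) : set ((T * R) * R) :=
  [set p | under_graph q p.1].

End processes.

(* Main.v *)
(* Comparing characteristic functions, the integrands [f_t] and [c f'_t] of the two
   representations satisfy [\int |\sum a_i f_{t_i}|^alpha = \int |\sum a_i c f'_{t_i}|^alpha]
   for all real [a_i].  Averaging over Gaussian coefficients, the integrals of
   [Q^(alpha/2)] agree for every sum of squares [Q] of linear forms in the [f_t];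
   differentiating in added squares, so do those of [Q^(alpha/2 - n)] times a product of
   [n] pairs of linear forms.  By polynomial approximation of sign indicators, the ratios
   [f_{t_j} / f_{t_k}] have the same joint law under the weights [|f_{t_k}|^alpha].  On
   standard Borel spaces this gives, on countably many pieces exhausting [{f_{t_k} <> 0}],
   measurable maps [Phi] with [f_t(p) = h(p) f'_t(Phi(p))] for all [t] in a countable set.
   By self-similarity and stationarity of increments,
   [\int |f_t - f_r|^alpha = C |t - r|^(alpha H)], so that [f_t(p)] is, for almost every [p]
   and [t], a limit of its values on a countable grid, and the relation extends to almost
   every [t]; by full support, almost every [p] in the domain is matched.  Finally, up to
   an additive constant, [G(z, v, u)] is a multiple of [G(z, 0, e^(v/s(z)) u)], so matching
   [p = (z, v, u0)] with [Phi(p) = (z', v', u')] for one suitable [u0] and small values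
   of [v] gives the asserted relation between [G(z, 0, .)] and [G'(z', 0, .)]. *)
Require Import Defs.
From HB Require Import structures.
From mathcomp Require Import all_boot all_order all_algebra.
From mathcomp Require Import all_classical all_reals all_analysis.
From mathcomp Require Import measurable_realfun ring lra.
Set Implicit Arguments.
Unset Strict Implicit.
Unset Printing Implicit Defensive.
Import Order.TTheory GRing.Theory Num.Theory.
Import numFieldNormedType.Exports.
Local Open Scope classical_set_scope.
Local Open Scope ring_scope.

(** * Gaussian averages of linear forms *)

(** The hypotheses compare laws only, while the conclusion asks for a partner of almost every point.
    Three obstacles shape the proof. Since [alpha / 2] is not an integer, no iterated derivative of
    the power loses its leading constant, so all integrals of polynomials in the bounded ratios
    [lform * lform / Q] are determined. The form [Q] must control all other forms for these ratios
    to be bounded, which one coordinate alone does not do; a small ridge is therefore added to its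
    square and removed in the limit. Next, two equally distributed codes do not yet give a map: a
    point with the given code has to exist and to be selected measurably. Existence comes from
    compactness on a set of almost full measure, and measurability from the least code, each bit of
    which is a countable intersection of conditions on finitely many bits of the given code. Last,
    the assertion concerns the slice [v = 0], which is null for the control measure, so
    almost-everywhere statements say nothing there; the dilation relation between the slices carries
    the information from positive heights [v] down to it. *)

Section affine_substitution.
Context {R : realType}.
Local Notation mu := (@lebesgue_measure R).

Lemma measurable_affine (a b : R) :
  measurable_fun [set: measurableTypeR R] 
    ((fun x => a * x + b) : measurableTypeR R -> measurableTypeR R).
Proof. by apply: measurable_funD => //; exact: measurable_funM. Qed.

(** The pushforward of Lebesgue measure under the affine map, multiplied by [a], gives half-open
    intervals their length, so it is Lebesgue measure by uniqueness. *)
Lemma lebesgue_measure_affine_pos (a b : R) (A : set (measurableTypeR R)) :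
  0 < a -> measurable A ->
  mu ((fun x => a * x + b) @^-1` A) = (a^-1%:E * mu A)%E.
Proof.
move=> a0 mA; have a00 : 0 <= a by exact: ltW.
pose nu := mscale (NngNum a00)
  (pushforward mu ((fun x => a * x + b) : measurableTypeR R -> measurableTypeR R)).
have E : forall B : set (measurableTypeR R), measurable B ->
    mu B = nu (measurable_affine a b) B.
  apply: lebesgue_measure_unique => _ [[c e]] _ <- /=.
  rewrite /nu /mscale /= /pushforward.
  have -> : (fun x => a * x + b) @^-1` `]c, e] = `](c - b) / a, (e - b) / a]%classic.
    by apply/seteqP; split => x /=; rewrite !in_itv/= ltr_pdivrMr// ler_pdivlMr//;
      rewrite (mulrC x) ltrBlDr lerBrDr.
  rewrite !lebesgue_measure_itv/= !lte_fin ltr_pM2r ?invr_gt0// ltrD2r.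
  case: ifP => ce; rewrite ?mule0// -EFinB -EFinM; congr (_%:E).
  by field; rewrite gt_eqF.
rewrite (E A mA) /nu /mscale /= /pushforward muleA -EFinM mulVf ?gt_eqF// mul1e.
by [].
Qed.

Lemma lebesgue_measure_affine (a b : R) (A : set (measurableTypeR R)) :
  a != 0 -> measurable A ->
  mu ((fun x => a * x + b) @^-1` A) = (`|a|^-1%:E * mu A)%E.
Proof.
move=> a0 mA; have [{}a0|{}a0|/eqP] := ltgtP a 0; last by rewrite (negbTE a0).
  have -> : (fun x => a * x + b) @^-1` A =
      (-%R : _ -> measurableTypeR R) @^-1` ((fun x => - a * x + b) @^-1` A).
    by apply/seteqP; split => x /=; rewrite mulrNN.
  rewrite -/(pushforward mu _ _) lebesgue_measureN.
    by rewrite lebesgue_measure_affine_pos ?oppr_gt0// ltr0_norm.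
  rewrite -[X in measurable X]setTI; exact: measurable_affine.
by rewrite lebesgue_measure_affine_pos// gtr0_norm.
Qed.

Lemma ge0_integral_affine (a b : R) (f : measurableTypeR R -> \bar R) :
  a != 0 -> measurable_fun setT f -> (forall x, (0 <= f x)%E) ->
  (\int[mu]_x f (a * x + b)%R = `|a|^-1%:E * \int[mu]_x f x)%E.
Proof.
move=> a0 mf f0.
have aa : 0 <= `|a|^-1 by rewrite invr_ge0.
have := @ge0_integral_pushforward _ _ _ _ _ _ (measurable_affine a b) mu setT f
  measurableT mf (fun x _ => f0 x).
rewrite preimage_setT => <-.
rewrite -(ge0_integral_mscale _ measurableT (NngNum aa))//.
apply: eq_measure_integral; first exact: measurable_affine.
by move=> ? A mA _; exact: lebesgue_measure_affine.
Qed.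

Lemma negligible_affine (a b : R) (A : set R) :
  a != 0 -> mu.-negligible A -> mu.-negligible ((fun x => a * x + b) @^-1` A).
Proof.
move=> a0 [B [mB B0 AB]]; exists ((fun x => a * x + b) @^-1` B); split.
- rewrite -[X in measurable X]setTI; exact: measurable_affine.
- by rewrite lebesgue_measure_affine// B0 mule0.
- by move=> x /= /AB.
Qed.

End affine_substitution.

Section gaussian_averages.
Context {R : realType}.
Local Notation mu := (@lebesgue_measure R).

Lemma measurable_gauss_comp d (T : measurableType d) (f : T -> R) :
  measurable_fun setT f -> measurable_fun setT (fun x => gauss_fun (f x)).
Proof. by move=> mf; apply: measurableT_comp => //; exact: measurable_gauss_fun. Qed.

(** Independent Gaussian variables add up to a Gaussian one with the variances added. The
    substitution [w = b * x + sg * y] and Tonelli reduce this to an integral over [x] for fixed [w].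
    The weight [gauss_fun] is not normalized; its mass [sqrt pi] stays as a factor. *)
Lemma gauss_stable (phi : measurableTypeR R -> \bar R) (b sg : R) :
  sg != 0 -> measurable_fun setT phi -> (forall x, (0 <= phi x)%E) ->
  (\int[mu]_x ((\int[mu]_y (phi (b * x + sg * y)%R * (gauss_fun y)%:E)) *
     (gauss_fun x)%:E) =
   (Num.sqrt pi)%:E *
   \int[mu]_y (phi (Num.sqrt (sg ^+ 2 + b ^+ 2) * y)%R * (gauss_fun y)%:E))%E.
Proof.
move=> sg0 mphi phi0.
set tau := Num.sqrt (sg ^+ 2 + b ^+ 2).
have tau2 : tau ^+ 2 = sg ^+ 2 + b ^+ 2 by rewrite sqr_sqrtr// addr_ge0// sqr_ge0.
have tau0 : 0 < tau by rewrite sqrtr_gt0 ltr_pwDl ?sqr_ge0// exprn_even_gt0.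
have taun0 : tau != 0 by rewrite gt_eqF.
have isg : (0 <= `|sg|^-1%:E :> \bar R)%E by rewrite lee_fin invr_ge0.
have mkx x : measurable_fun setT (fun w => phi w * (gauss_fun ((w - b * x) / sg))%:E)%E.
  apply: emeasurable_funM => //; apply/measurable_EFinP/measurable_gauss_comp.
  by apply: measurable_funM => //; exact: measurable_funB.
have kx0 x w : (0 <= phi w * (gauss_fun ((w - b * x) / sg))%:E)%E.
  by rewrite mule_ge0// lee_fin gauss_fun_ge0.
have inner x : (\int[mu]_y (phi (b * x + sg * y)%R * (gauss_fun y)%:E) =
   `|sg|^-1%:E * \int[mu]_w (phi w * (gauss_fun ((w - b * x) / sg))%:E))%E.
  rewrite -(ge0_integral_affine (b * x) sg0 (mkx x) (kx0 x)).
  apply: eq_integral => y _; rewrite (addrC (b * x)); congr (_ * (gauss_fun _)%:E)%E.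
  by field.
under eq_integral do rewrite inner -muleA.
have mk : measurable_fun setT (fun z : measurableTypeR R * measurableTypeR R =>
    phi z.2 * (gauss_fun ((z.2 - b * z.1) / sg) * gauss_fun z.1)%:E)%E.
  apply: emeasurable_funM; first exact: measurableT_comp.
  apply/measurable_EFinP/measurable_funM; apply: measurable_gauss_comp => //.
  apply: measurable_funM => //; apply: measurable_funB => //.
  by apply: measurable_funM.
have k0 z : (0 <= phi z.2 * (gauss_fun ((z.2 - b * z.1) / sg) * gauss_fun z.1)%:E)%E.
  by rewrite mule_ge0// lee_fin mulr_ge0// gauss_fun_ge0.
transitivity (`|sg|^-1%:E * \int[mu]_x \int[mu]_w
   (phi w * (gauss_fun ((w - b * x) / sg) * gauss_fun x)%:E))%E.
  rewrite -ge0_integralZl//; first last.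
  - by move=> x _; apply: integral_ge0 => w _; exact: (k0 (x, w)).
  - exact: (measurable_fun_fubini_tonelli_F _ mk k0).
  apply: eq_integral => x _; congr (_ * _)%E.
  rewrite -ge0_integralZr//.
  - by apply: eq_integral => w _; rewrite EFinM muleA.
  - by rewrite lee_fin gauss_fun_ge0.
rewrite (fubini_tonelli _ mk k0)/=.
transitivity (`|sg|^-1%:E * \int[mu]_w
   (((`|tau / sg|^-1) * Num.sqrt pi)%:E * (phi w * (gauss_fun (w / tau))%:E)))%E.
  congr (_ * _)%E; apply: eq_integral => w _.
  rewrite ge0_integralZl//; last 2 first.
  - apply/measurable_EFinP/measurable_funM; apply: measurable_gauss_comp => //.
    apply: measurable_funM => //; apply: measurable_funB => //.
  - by move=> x _; rewrite lee_fin mulr_ge0// gauss_fun_ge0.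
  rewrite muleCA; congr (_ * _)%E.
  (* Completing the square: [((w - b * x) / sg) ^+ 2 + x ^+ 2] is [(w / tau) ^+ 2] plus the square
     of an affine function of [x] with slope [tau / sg]. *)
  transitivity (\int[mu]_x ((gauss_fun (w / tau))%:E *
     (gauss_fun (tau / sg * x + - (b * w / (tau * sg))))%:E))%E.
    apply: eq_integral => x _; rewrite -EFinM /gauss_fun -!expRD; congr (expR _)%:E.
    have -> : ((w - b * x) / sg) ^+ 2 = (w - b * x) ^+ 2 / sg ^+ 2 by rewrite exprMn exprVn.
    have -> : (tau / sg * x + - (b * w / (tau * sg))) ^+ 2 =
      (tau ^+ 2 * x - b * w) ^+ 2 / (tau ^+ 2 * sg ^+ 2).
      by field; rewrite taun0 sg0.
    rewrite expr_div_n tau2; field.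
    by rewrite sg0 -tau2 expf_neq0.
  rewrite ge0_integralZl//; last 3 first.
  - by apply/measurable_EFinP/measurable_gauss_comp; exact: measurable_affine.
  - by move=> x _; rewrite lee_fin gauss_fun_ge0.
  - by rewrite lee_fin gauss_fun_ge0.
  rewrite muleC; congr (_ * _)%E.
  have ts0 : tau / sg != 0 by rewrite mulf_neq0// invr_eq0.
  have mg : measurable_fun setT (fun x : measurableTypeR R => (gauss_fun x)%:E).
    by apply/measurable_EFinP; exact: measurable_gauss_fun.
  have g0 (x : measurableTypeR R) : (0 <= (gauss_fun x)%:E)%E by rewrite lee_fin gauss_fun_ge0.
  by rewrite (ge0_integral_affine _ ts0 mg g0) integralT_gauss.
have mt : measurable_fun setT (fun w => phi w * (gauss_fun (w / tau))%:E)%E.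
  apply: emeasurable_funM => //; apply/measurable_EFinP/measurable_gauss_comp.
  exact: measurable_funM.
have pt0 w : (0 <= phi w * (gauss_fun (w / tau))%:E)%E.
  by rewrite mule_ge0// lee_fin gauss_fun_ge0.
rewrite ge0_integralZl//.
rewrite muleA -EFinM.
have := ge0_integral_affine 0 taun0 mt pt0; rewrite (gtr0_norm tau0) => H.
transitivity ((Num.sqrt pi)%:E * (tau^-1%:E * \int[mu]_x (phi x * (gauss_fun (x / tau))%:E)))%E.
  rewrite muleA -EFinM; congr (_%:E * _)%E.
  rewrite normrM normfV (gtr0_norm tau0).
  by field; rewrite normr_eq0 sg0 taun0.
congr (_ * _)%E; apply: etrans (esym H) _.
by apply: eq_integral => x _; rewrite addr0 mulrAC mulfV// mul1r.
Qed.

(** This is [sqrt pi] times the mean of [|y + sqrt q g|^alpha] for a centred Gaussian [g] of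
    variance 1/2. Later [y] is a linear form and [q] a sum of squares of forms, to which each
    averaging adds one more square. *)
Definition gauss_avg (alpha y q : R) : \bar R :=
  (\int[mu]_g (`|y + Num.sqrt q * g| `^ alpha * gauss_fun g)%:E)%E.

Lemma gauss_avg0 alpha y : gauss_avg alpha y 0 = (`|y| `^ alpha * Num.sqrt pi)%:E.
Proof.
rewrite /gauss_avg sqrtr0.
under eq_integral do rewrite mul0r addr0 EFinM.
rewrite ge0_integralZl//; last 2 first.
- by apply/measurable_EFinP; exact: measurable_gauss_fun.
- by move=> x _; rewrite lee_fin gauss_fun_ge0.
by rewrite integralT_gauss -EFinM.
Qed.

Lemma measurable_abs_powR d (T : measurableType d) (alpha : R) (f : T -> R) :
  measurable_fun setT f -> measurable_fun setT (fun x => `|f x| `^ alpha).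
Proof.
move=> mf; apply: (measurableT_comp (measurable_powR alpha)).
exact: measurableT_comp.
Qed.

Lemma gauss_avg_stable (alpha y b q : R) : 0 <= q ->
  (\int[mu]_x (gauss_avg alpha (y + b * x) q * (gauss_fun x)%:E) =
   (Num.sqrt pi)%:E * gauss_avg alpha y (q + b ^+ 2))%E.
Proof.
(* [gauss_stable] requires a nonzero coefficient of the inner variable, so [q = 0] is treated
   directly; a negative [b] is then removed by the symmetry of the Gaussian weight. *)
rewrite le_eqVlt => /predU1P[<-|q0].
  transitivity ((Num.sqrt pi)%:E * \int[mu]_x (`|y + b * x| `^ alpha * gauss_fun x)%:E)%E.
    rewrite -ge0_integralZl//; last 2 first.
    - apply/measurable_EFinP/measurable_funM; last exact: measurable_gauss_fun.
      apply: measurable_abs_powR; under eq_fun do rewrite addrC.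
      exact: measurable_affine.
    - by move=> x _; rewrite lee_fin mulr_ge0// ?powR_ge0// gauss_fun_ge0.
    apply: eq_integral => x _; rewrite gauss_avg0.
    by rewrite -!EFinM -mulrA mulrCA.
  apply: (congr1 (mule _)); rewrite /gauss_avg add0r sqrtr_sqr.
  have [b0|b0] := ger0P b; first by [].
  have n1 : (-1 : R) != 0 by rewrite oppr_eq0 oner_eq0.
  pose F (g : measurableTypeR R) := (`|y + - b * g| `^ alpha * gauss_fun g)%:E.
  have mF : measurable_fun setT F.
    apply/measurable_EFinP/measurable_funM; last exact: measurable_gauss_fun.
    apply: measurable_abs_powR; under eq_fun do rewrite addrC.
    exact: measurable_affine.
  have F0 g : (0 <= F g)%E by rewrite lee_fin mulr_ge0// ?powR_ge0// gauss_fun_ge0.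
  have := ge0_integral_affine 0 n1 mF F0; rewrite normrN1 invr1 mul1e => <-.
  by apply: eq_integral => g _; rewrite /F addr0 mulN1r mulrNN /gauss_fun sqrrN.
have sq0 : Num.sqrt q != 0 by rewrite gt_eqF// sqrtr_gt0.
have mphi : measurable_fun setT (fun w : measurableTypeR R => (`|y + w| `^ alpha)%:E).
  by apply/measurable_EFinP/measurable_abs_powR; exact: measurable_funD.
have phi0 (w : measurableTypeR R) : (0 <= (`|y + w| `^ alpha)%:E)%E by rewrite lee_fin powR_ge0.
have := gauss_stable b sq0 mphi phi0.
have e : Num.sqrt q ^+ 2 = q by rewrite sqr_sqrtr// ltW.
rewrite e.
move=> H.
apply: etrans _ H.
apply: eq_integral => x _; apply: (congr1 (mule^~ _)).
by apply: eq_integral => g _; rewrite EFinM addrA.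
Qed.

End gaussian_averages.

Section gaussian_averages_integral.
Context {R : realType} (alpha : R).
Hypothesis halpha : 1 < alpha < 2.
Local Notation mu := (@lebesgue_measure R).

Lemma measurable_gauss_avg d (T : measurableType d) (f q : T -> R) :
  measurable_fun setT f -> measurable_fun setT q ->
  measurable_fun setT (fun s => gauss_avg alpha (f s) (q s)).
Proof.
move=> mf mq.
apply: (@measurable_fun_fubini_tonelli_F _ _ T (measurableTypeR R) R mu
  (fun z => (`|f z.1 + Num.sqrt (q z.1) * z.2| `^ alpha * gauss_fun z.2)%:E)).
  apply/measurable_EFinP/measurable_funM; last exact: measurable_gauss_comp.
  apply: measurable_abs_powR; apply: measurable_funD; first exact: measurableT_comp.
  apply: measurable_funM => //; apply: measurableT_comp; last exact: measurableT_comp.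
  by apply: continuous_measurable_fun; exact: sqrt_continuous.
by move=> z; rewrite lee_fin mulr_ge0// ?powR_ge0// gauss_fun_ge0.
Qed.

Lemma gauss_avg_ge0 (y q : R) : (0 <= gauss_avg alpha y q)%E.
Proof.
by apply: integral_ge0 => g _; rewrite lee_fin mulr_ge0// ?powR_ge0// gauss_fun_ge0.
Qed.

(** Tonelli puts the new Gaussian variable outside. For each fixed [g] the inner integral is of the
    same kind, with [f + g * b] in place of [f] and one square fewer, which is what an induction on
    the number of squares needs. *)
Lemma integral_gauss_avg_stable d (T : measurableType d)
    (m : {sigma_finite_measure set T -> \bar R}) (f b q : T -> R) :
  measurable_fun setT f -> measurable_fun setT b -> measurable_fun setT q ->
  (forall s, 0 <= q s) ->
  ((Num.sqrt pi)%:E * \int[m]_s gauss_avg alpha (f s) (q s + b s ^+ 2)%R =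
   \int[mu]_g ((\int[m]_s gauss_avg alpha (f s + g * b s)%R (q s)) * (gauss_fun g)%:E))%E.
Proof.
move=> mf mb mq q0.
have sp : (0 <= (Num.sqrt (pi : R))%:E)%E by rewrite lee_fin sqrtr_ge0.
have mqb : measurable_fun setT (fun s => q s + b s ^+ 2).
  by apply: measurable_funD => //; exact: measurable_funX.
rewrite -ge0_integralZl//; last 2 first.
- exact: measurable_gauss_avg.
- by move=> s _; exact: gauss_avg_ge0.
under eq_integral do rewrite -gauss_avg_stable//.
have mk : measurable_fun setT (fun z : T * measurableTypeR R =>
    gauss_avg alpha (f z.1 + b z.1 * z.2)%R (q z.1) * (gauss_fun z.2)%:E)%E.
  apply: emeasurable_funM; last exact/measurable_EFinP/measurable_gauss_comp.
  apply: measurable_gauss_avg; last exact: measurableT_comp.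
  apply: measurable_funD; first exact: measurableT_comp.
  by apply: measurable_funM => //; exact: measurableT_comp.
have k0 (z : T * measurableTypeR R) :
    (0 <= gauss_avg alpha (f z.1 + b z.1 * z.2)%R (q z.1) * (gauss_fun z.2)%:E)%E.
  by rewrite mule_ge0// ?gauss_avg_ge0// lee_fin gauss_fun_ge0.
rewrite (fubini_tonelli _ mk k0)/=; apply: eq_integral => g _.
have mg : measurable_fun setT (fun s => gauss_avg alpha (f s + b s * g) (q s)).
  apply: measurable_gauss_avg => //; apply: measurable_funD => //.
  exact: measurable_funM.
have g0 : (0 <= (gauss_fun g)%:E)%E by rewrite lee_fin gauss_fun_ge0.
rewrite (ge0_integralZr m measurableT mg (fun s _ => gauss_avg_ge0 _ _) g0).
apply: (congr1 (mule^~ _)).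
by apply: eq_integral => s _; rewrite (mulrC g).
Qed.

Lemma gauss_avg_0E (q : R) : 0 <= q ->
  gauss_avg alpha 0 q = ((q `^ (alpha / 2))%:E * gauss_avg alpha 0 1)%E.
Proof.
move=> q0; rewrite /gauss_avg -ge0_integralZl//; last 3 first.
- apply/measurable_EFinP/measurable_funM; last exact: measurable_gauss_fun.
  apply: measurable_abs_powR; under eq_fun do rewrite addrC.
  exact: measurable_affine.
- by move=> g _; rewrite lee_fin mulr_ge0// ?powR_ge0// gauss_fun_ge0.
- by rewrite lee_fin powR_ge0.
apply: eq_integral => g _; rewrite !add0r sqrtr1 mul1r.
rewrite -EFinM mulrA; apply: (congr1 (fun u => (u * _)%:E)).
rewrite normrM powRM ?normr_ge0//; apply: (congr1 (fun u => u * _)).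
by rewrite ger0_norm ?sqrtr_ge0// -powR12_sqrt// -powRrM mulrC.
Qed.

(** On [[1, 2]] the integrand is at least [exp (- 4)]. Positivity and finiteness of this constant
    allow it to be cancelled in [same_sumsq]. *)
Lemma gauss_avg_01_gt0 : (0 < gauss_avg alpha 0 1)%E.
Proof.
apply: (@lt_le_trans _ _ (\int[mu]_(g in `[1%R, 2%R]) (expR (- 4))%:E)%E).
  rewrite integral_cst//= lebesgue_measure_itv/= lte_fin ltr1n mule_gt0// lte_fin ?expR_gt0//.
have mF : measurable_fun setT (fun g : measurableTypeR R =>
    (`|0 + Num.sqrt 1 * g| `^ alpha * gauss_fun g)%:E).
  apply/measurable_EFinP/measurable_funM; last exact: measurable_gauss_fun.
  apply: measurable_abs_powR; under eq_fun do rewrite addrC.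
  exact: measurable_affine.
have F0 (g : measurableTypeR R) :
    (0 <= (`|0 + Num.sqrt 1 * g| `^ alpha * gauss_fun g)%:E)%E.
  by rewrite lee_fin mulr_ge0// ?powR_ge0// gauss_fun_ge0.
apply: (@le_trans _ _ (\int[mu]_(g in `[1%R, 2%R])
    (`|0 + Num.sqrt 1 * g| `^ alpha * gauss_fun g)%:E)%E); last first.
  exact: ge0_subset_integral.
apply: ge0_le_integral => //.
- exact: measurable_funTS.
move=> g; rewrite /= in_itv/= => /andP[g1 g2].
rewrite lee_fin add0r sqrtr1 mul1r -[leLHS]mul1r ler_pM//.
- rewrite ger0_norm ?(le_trans _ g1)//.
  by rewrite -(powRr0 g) ler_powR// ltW// (lt_trans _ (andP halpha).1).
- by rewrite /gauss_fun ler_expR lerN2; nra.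
Qed.

(** As [alpha < 2], [|g|^alpha <= 1 + g^2 <= 2 * exp (g^2 / 2)]. This costs half of the Gaussian
    exponent and leaves a Gaussian dilated by [sqrt 2]. *)
Lemma gauss_avg_01_fin : (gauss_avg alpha 0 1 < +oo)%E.
Proof.
have s2 : (Num.sqrt 2)^-1 != 0 :> R by rewrite invr_eq0 gt_eqF// sqrtr_gt0.
have mg : measurable_fun setT (fun x : measurableTypeR R => (gauss_fun x)%:E).
  by apply/measurable_EFinP; exact: measurable_gauss_fun.
have g0 (x : measurableTypeR R) : (0 <= (gauss_fun x)%:E)%E by rewrite lee_fin gauss_fun_ge0.
have := ge0_integral_affine 0 s2 mg g0; rewrite integralT_gauss => E.
apply: (@le_lt_trans _ _
  (2%:E * (\int[mu]_x (gauss_fun ((Num.sqrt 2)^-1 * x + 0)%R)%:E))%E); last first.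
  by rewrite E -!EFinM ltry.
rewrite -ge0_integralZl//; last first.
  by apply/measurable_EFinP/measurable_gauss_comp; exact: measurable_affine.
apply: ge0_le_integral => //.
- by move=> g _; rewrite lee_fin mulr_ge0// ?powR_ge0// gauss_fun_ge0.
- apply/measurable_EFinP/measurable_funM; last exact: measurable_gauss_fun.
  apply: measurable_abs_powR; under eq_fun do rewrite addrC.
  exact: measurable_affine.
- apply/measurable_EFinP/measurable_funM => //.
  by apply/measurable_gauss_comp; exact: measurable_affine.
move=> g _; rewrite add0r sqrtr1 mul1r addr0 -EFinM lee_fin.
have a1 : `|g| `^ alpha <= 1 + g ^+ 2.
  have [g1|g1] := leP `|g| 1.
    apply: (@le_trans _ _ 1); last by rewrite lerDl sqr_ge0.
    have -> : 1 = 1 `^ alpha :> R by rewrite powR1.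
    rewrite ge0_ler_powR ?nnegrE//.
    by rewrite ltW// (lt_trans _ (andP halpha).1).
  apply: (@le_trans _ _ (`|g| `^ 2%:R)).
    by rewrite ler_powR ?ltW// (andP halpha).2.
  by rewrite powR_mulrn// real_normK ?num_real// lerDr.
apply: (le_trans (ler_wpM2r (gauss_fun_ge0 g) a1)).
rewrite /gauss_fun exprMn exprVn sqr_sqrtr//.
have -> : expR (- g ^+ 2) = expR (- (2^-1 * g ^+ 2)) * expR (- (2^-1 * g ^+ 2)).
  by rewrite -expRD; congr expR; field.
rewrite mulrA ler_pM2r ?expR_gt0// expRN ler_pdivrMr ?expR_gt0//.
have := expR_ge1Dx (2^-1 * g ^+ 2); lra.
Qed.

End gaussian_averages_integral.

Section forms.
Context {R : realType} (N : nat).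

Definition lform (a y : nat -> R) : R := \sum_(i < N) a i * y i.

Definition sumsq (l : seq (nat -> R)) (y : nat -> R) : R :=
  \sum_(b <- l) lform b y ^+ 2.

Lemma lformD a b g y :
  lform (fun i => a i + g * b i) y = lform a y + g * lform b y.
Proof.
rewrite /lform mulr_sumr -big_split/=; apply: eq_bigr => i _.
by rewrite mulrDl mulrA.
Qed.

Lemma sumsq_ge0 l y : 0 <= sumsq l y.
Proof. by apply: sumr_ge0 => b _; exact: sqr_ge0. Qed.

Lemma sumsq_cons b l y : sumsq (b :: l) y = lform b y ^+ 2 + sumsq l y.
Proof. exact: big_cons. Qed.

Lemma measurable_lform d (T : measurableType d) (x : nat -> T -> R) a :
  (forall j, measurable_fun setT (x j)) ->
  measurable_fun setT (fun s => lform a (x^~ s)).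
Proof.
move=> mx; rewrite /lform; apply: measurable_sum => i.
exact: measurable_funM.
Qed.

Lemma measurable_sumsq d (T : measurableType d) (x : nat -> T -> R) l :
  (forall j, measurable_fun setT (x j)) ->
  measurable_fun setT (fun s => sumsq l (x^~ s)).
Proof.
move=> mx; rewrite /sumsq; apply: measurable_sum => b.
by apply: measurable_funX; exact: measurable_lform.
Qed.

End forms.

Section sums_of_squares.
Context {R : realType} (alpha : R).
Hypothesis halpha : 1 < alpha < 2.
Context d (S : measurableType d) (m : {sigma_finite_measure set S -> \bar R}).
Context d' (S' : measurableType d') (m' : {sigma_finite_measure set S' -> \bar R}).
Variables (x : nat -> S -> R) (x' : nat -> S' -> R) (N : nat).
Hypothesis mx : forall j, measurable_fun setT (x j).
Hypothesis mx' : forall j, measurable_fun setT (x' j).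
Hypothesis same_norm : forall a : nat -> R,
  (\int[m]_s (`|lform N a (x^~ s)| `^ alpha)%:E =
   \int[m']_s (`|lform N a (x'^~ s)| `^ alpha)%:E)%E.
Local Notation mu := (@lebesgue_measure R).

Let scale_inj (k : R) (u v : \bar R) : k != 0 -> (k%:E * u = k%:E * v)%E -> u = v.
Proof.
by move=> k0 /(congr1 (mule k^-1%:E)); rewrite !muleA -!EFinM mulVf// !mul1e.
Qed.

Let sqrtpi0 : Num.sqrt (pi : R) != 0.
Proof. by rewrite gt_eqF// sqrtr_gt0 pi_gt0. Qed.

(** [same_norm] is the case without squares. The form [a] is generalized in the induction because
    each Gaussian step replaces it by [a + g * b]. *)
Lemma same_gauss_avg (l : seq (nat -> R)) (a : nat -> R) :
  (\int[m]_s gauss_avg alpha (lform N a (x^~ s)) (sumsq N l (x^~ s)) =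
   \int[m']_s gauss_avg alpha (lform N a (x'^~ s)) (sumsq N l (x'^~ s)))%E.
Proof.
elim: l a => [|b l IH] a.
  rewrite /sumsq; under eq_integral do rewrite big_nil gauss_avg0 EFinM.
  under [in RHS]eq_integral do rewrite big_nil gauss_avg0 EFinM.
  rewrite ge0_integralZr//; last first.
    by apply/measurable_EFinP/measurable_abs_powR; exact: measurable_lform.
  rewrite ge0_integralZr//; last first.
    by apply/measurable_EFinP/measurable_abs_powR; exact: measurable_lform.
  by rewrite same_norm.
apply: (scale_inj sqrtpi0).
under eq_integral do rewrite sumsq_cons addrC.
under [in RHS]eq_integral do rewrite sumsq_cons addrC.
rewrite (integral_gauss_avg_stable alpha m (measurable_lform N a mx)
  (measurable_lform N b mx) (measurable_sumsq N l mx) (fun s => sumsq_ge0 N l _)).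
rewrite (integral_gauss_avg_stable alpha m' (measurable_lform N a mx')
  (measurable_lform N b mx') (measurable_sumsq N l mx') (fun s => sumsq_ge0 N l _)).
apply: eq_integral => g _; apply: (congr1 (mule^~ _)).
under eq_integral do rewrite -lformD.
under [in RHS]eq_integral do rewrite -lformD.
exact: IH.
Qed.

(** For the zero form, [gauss_avg] is by homogeneity the power [Q^(alpha/2)] times a fixed positive
    finite constant, which cancels. *)
Lemma same_sumsq (l : seq (nat -> R)) :
  (\int[m]_s (sumsq N l (x^~ s) `^ (alpha / 2))%:E =
   \int[m']_s (sumsq N l (x'^~ s) `^ (alpha / 2))%:E)%E.
Proof.
have /= := same_gauss_avg l (fun=> 0).
have l0 y : lform N (fun=> 0) y = 0 :> R.
  by rewrite /lform big1// => i _; rewrite mul0r.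
under eq_integral do rewrite l0 gauss_avg_0E ?sumsq_ge0//.
under [in RHS]eq_integral do rewrite l0 gauss_avg_0E ?sumsq_ge0//.
have mp e (T : measurableType e) (y : nat -> T -> R) :
    (forall j, measurable_fun setT (y j)) ->
    measurable_fun setT (fun s => (sumsq N l (y^~ s) `^ (alpha / 2))%:E).
  move=> my; apply/measurable_EFinP/(measurableT_comp (measurable_powR _)).
  exact: measurable_sumsq.
rewrite ge0_integralZr ?gauss_avg_ge0//; [|exact: mp|by move=> *; rewrite lee_fin powR_ge0].
rewrite ge0_integralZr ?gauss_avg_ge0//; [|exact: mp|by move=> *; rewrite lee_fin powR_ge0].
have := gauss_avg_01_gt0 halpha; have := gauss_avg_01_fin halpha.
case: (gauss_avg alpha 0 1) => [c _ c0| |]//.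
rewrite muleC [RHS]muleC; apply: scale_inj.
by rewrite gt_eqF.
Qed.

End sums_of_squares.

(** * Differentiation in added squares *)

Section powR_increments.
Context {R : realType}.
Implicit Types Q t e : R.

Lemma powRD_factor Q t e : 0 < Q -> 0 <= t ->
  (Q + t) `^ e = Q `^ e * (1 + t / Q) `^ e.
Proof.
move=> Q0 t0; rewrite -powRM; [|exact: ltW|by rewrite addr_ge0// divr_ge0// ltW].
by congr (_ `^ _); field; rewrite gt_eqF.
Qed.

(** Scaling [Q] out leaves [|(1 + y)^e - 1| <= (1 + |e|) * y]. For [0 <= e <= 1] the power lies
    between [1] and [1 + y]; for [e < 0] it lies between [1 + e * ln (1 + y) >= 1 + e * y] and [1].
    The bound dominates the difference quotients in [qpow_increment_cvg]. *)
Lemma powR_increment_le Q t e : e <= 1 -> 0 < Q -> 0 <= t ->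
  `|(Q + t) `^ e - Q `^ e| <= (1 + `|e|) * (t * Q `^ (e - 1)).
Proof.
move=> e1 Q0 t0; rewrite powRD_factor//.
have -> : t * Q `^ (e - 1) = Q `^ e * (t / Q).
  rewrite powRB; last by rewrite (gt_eqF Q0) implybT.
  by rewrite powRr1 ?ltW// mulrCA.
set y := t / Q; have y0 : 0 <= y by rewrite divr_ge0// ltW.
rewrite -{2}[Q `^ e]mulr1 -mulrBr normrM ger0_norm ?powR_ge0// mulrCA.
rewrite ler_wpM2l ?powR_ge0//.
have y1 : 1 <= 1 + y by rewrite lerDl.
have [e0|e0] := leP 0 e.
  have l1 : 1 <= (1 + y) `^ e by rewrite -[leLHS](powRr0 (1 + y)) ler_powR.
  rewrite ger0_norm ?subr_ge0// lerBlDl.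
  apply: (@le_trans _ _ (1 + y)); last first.
    by rewrite lerD2l mulrDl mul1r lerDl mulr_ge0.
  by rewrite -{2}(powRr1 (le_trans ler01 y1)) ler_powR.
have l1 : (1 + y) `^ e <= 1 by rewrite -{2}(powRr0 (1 + y)) ler_powR// ltW.
rewrite ler0_norm ?subr_le0// opprB lerBlDr -lerBlDl.
apply: (@le_trans _ _ (1 + e * ln (1 + y))); last first.
  by rewrite /powR gt_eqF ?expR_ge1Dx// (lt_le_trans ltr01 y1).
rewrite lerD2l (ltr0_norm e0) mulrDl mul1r opprD mulNr opprK.
apply: (@le_trans _ _ (e * y)); first by rewrite gerDr oppr_le0.
rewrite ler_wnM2l// ?(ltW e0)// le_ln1Dx// (lt_le_trans _ y0)// oppr_lt0.
Qed.

Lemma powR_increment_cvg Q t e : 0 < Q -> 0 <= t ->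
  (n.+1%:R * ((Q + t / n.+1%:R) `^ e - Q `^ e)) @[n --> \oo] --> e * (t * Q `^ (e - 1)).
Proof.
move=> Q0; rewrite le_eqVlt => /predU1P[<-|t0].
  rewrite mul0r mulr0 (_ : (fun _ => _) = cst 0); first exact: cvg_cst.
  by apply/funext => n; rewrite mul0r addr0 subrr mulr0.
have [dQ eQ] := is_derive1_powR e Q0.
have H : (h^-1 *: ((h *: (1 : R) + Q) `^ e - Q `^ e)) @[h --> 0^'] -->
    e * Q `^ (e - 1) by rewrite -eQ; exact: dQ.
have c0 : (t / n.+1%:R) @[n --> \oo] --> (0 : R)^'.
  move=> A [_/posnumP[r]] /= rA.
  have := @cvg_harmonic R => /cvgrPdist_lt /(_ (r%:num / t)).
  rewrite divr_gt0// => /(_ isT) [n _ nA]; exists n => // k /nA/=.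
  rewrite sub0r normrN ltr_pdivlMr// => kr; apply: rA => /=.
    by rewrite sub0r normrN normrM mulrC (gtr0_norm t0).
  by rewrite gt_eqF// divr_gt0.
have ct : (fun=> t) n @[n --> \oo] --> t by exact: cvg_cst.
rewrite mulrCA; apply: cvg_trans (cvgM ct (cvg_comp _ _ c0 H)).
apply: near_eq_cvg; near=> n => /=.
rewrite invf_div /GRing.scale/= mulr1 (addrC _ Q).
by rewrite mulrA mulrCA mulfV ?mulr1// gt_eqF.
Unshelve. all: by end_near. Qed.

End powR_increments.

Section quadratic_products.
Context {R : realType} (alpha : R) (N : nat).
Hypothesis halpha : 1 < alpha < 2.
Let p := alpha / 2.

Let p01 : 0 < p < 1.
Proof. by move: halpha => /andP[a1 a2]; apply/andP; split; rewrite /p; lra. Qed.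

Definition prodq (qs : seq ((nat -> R) * (nat -> R))) (y : nat -> R) : R :=
  \prod_(q <- qs) (lform N q.1 y * lform N q.2 y).

(** Each pair in [qs] has degree 2 in [y] and lowers the exponent of the sum of squares by 1, so the
    total degree is always [alpha]. This is why it is as integrable as an [alpha]-th power of a
    form. *)
Definition qpow (l : seq (nat -> R)) qs (y : nat -> R) : R :=
  sumsq N l y `^ (p - (size qs)%:R) * prodq qs y.

(** Under this condition products of forms are bounded by powers of [sumsq], and all forms vanish
    where [sumsq] does; the negative powers of [sumsq] in [qpow] are then harmless. *)
Definition dominates_forms (l : seq (nat -> R)) :=
  forall a : nat -> R, exists2 C, 0 <= C &
    forall y, lform N a y ^+ 2 <= C * sumsq N l y.

Lemma dominates_forms_cons b l : dominates_forms l -> dominates_forms (b :: l).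
Proof.
move=> dl a; have [C C0 aC] := dl a; exists C => // y.
by apply: le_trans (aC y) _; rewrite ler_wpM2l// sumsq_cons lerDr sqr_ge0.
Qed.

Lemma prodq_cons q qs y :
  prodq (q :: qs) y = lform N q.1 y * lform N q.2 y * prodq qs y.
Proof. exact: big_cons. Qed.

Lemma prodq_le l qs : dominates_forms l -> exists2 C, 0 <= C &
  forall y, `|prodq qs y| <= C * sumsq N l y ^+ size qs.
Proof.
move=> dl; elim: qs => [|[a b] qs [C C0 IH]].
  by exists 1 => // y; rewrite /prodq big_nil normr1 mulr1.
have [A A0 aA] := dl a; have [B B0 bB] := dl b.
exists ((A + B) * C); first by rewrite mulr_ge0// addr_ge0.
move=> y; rewrite prodq_cons normrM /= exprS mulrACA ler_pM//.
have := aA y; have := bB y; have := sumsq_ge0 N l y.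
move: (lform N a y) (lform N b y) (sumsq N l y) => u v Q Q0 vB uA.
rewrite mulrDl; apply: le_trans (lerD uA vB).
by rewrite ler_norml; apply/andP; split; nra.
Qed.

Lemma qpow_le l qs : dominates_forms l -> exists2 C, 0 <= C &
  forall y, `|qpow l qs y| <= C * sumsq N l y `^ p.
Proof.
move=> dl; have [C C0 qC] := prodq_le qs dl; exists C => // y.
rewrite /qpow normrM ger0_norm ?powR_ge0//.
have := qC y; have := sumsq_ge0 N l y; rewrite le_eqVlt => /predU1P[<-|Q0] H.
  case: qs qC H => [_ /=|q qs _ /=].
    by rewrite subr0 /prodq big_nil normr1 !mulr1 => C1; rewrite ler_peMl ?powR_ge0.
  rewrite exprS mul0r mulr0 normr_le0 => /eqP ->.
  by rewrite normr0 mulr0 mulr_ge0// powR_ge0.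
apply: le_trans (ler_wpM2l (powR_ge0 _ _) H) _.
rewrite mulrCA ler_wpM2l// powRB; last by rewrite (gt_eqF Q0) implybT.
by rewrite powR_mulrn ?(ltW Q0)// divfK// expf_neq0// gt_eqF.
Qed.

Section one_space.
Context d (S : measurableType d) (m : {measure set S -> \bar R}).
Variable x : nat -> S -> R.
Hypothesis mx : forall j, measurable_fun setT (x j).
Hypothesis fin_norm : forall a : nat -> R,
  (\int[m]_s (`|lform N a (x^~ s)| `^ alpha)%:E < +oo)%E.

Lemma measurable_prodq qs : measurable_fun setT (fun s => prodq qs (x^~ s)).
Proof.
rewrite /prodq; elim: qs => [|q qs IH].
  by under eq_fun do rewrite big_nil; exact: measurable_cst.
under eq_fun do rewrite big_cons.
by do 2?apply: measurable_funM => //; exact: measurable_lform.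
Qed.

Lemma measurable_sumsq_powR l e :
  measurable_fun setT (fun s => sumsq N l (x^~ s) `^ e).
Proof.
by apply: (measurableT_comp (measurable_powR e)); exact: measurable_sumsq.
Qed.

Lemma measurable_qpow l qs : measurable_fun setT (fun s => qpow l qs (x^~ s)).
Proof.
by apply: measurable_funM; [exact: measurable_sumsq_powR|exact: measurable_prodq].
Qed.

(** Squares are added one at a time with [(u + v)^p <= 2 * (u^p + v^p)], and the [p]-th power of the
    square of a form is its [alpha]-th absolute power. *)
Lemma integrable_sumsq_powR l :
  m.-integrable setT (fun s => (sumsq N l (x^~ s) `^ p)%:E).
Proof.
elim: l => [|b l IH].
  rewrite /sumsq; under eq_fun do rewrite big_nil powR0 ?gt_eqF ?(andP p01).1//.
  exact: integrable0.
have ib : m.-integrable setT (fun s => (`|lform N b (x^~ s)| `^ alpha)%:E).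
  apply/integrableP; split.
    by apply/measurable_EFinP/measurable_abs_powR; exact: measurable_lform.
  apply: le_lt_trans (fin_norm b); apply: ge0_le_integral => //.
  - by apply: measurableT_comp => //; apply/measurable_EFinP/measurable_abs_powR;
      exact: measurable_lform.
  - by apply/measurable_EFinP/measurable_abs_powR; exact: measurable_lform.
  - by move=> s _; rewrite /= lee_fin ger0_norm ?powR_ge0.
have i2 := integrableZl measurableT 2 (integrableD measurableT ib IH).
apply: le_integrable i2 => //.
  by apply/measurable_EFinP; exact: measurable_sumsq_powR.
move=> s _; rewrite /= lee_fin sumsq_cons ger0_norm ?powR_ge0//.
rewrite ger0_norm ?mulr_ge0 ?addr_ge0 ?powR_ge0//.
have -> : `|lform N b (x^~ s)| `^ alpha = (lform N b (x^~ s) ^+ 2) `^ p.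
  rewrite -(real_normK (num_real (lform N b (x^~ s)))) -powR_mulrn//.
  by rewrite -powRrM /p; congr (_ `^ _); field.
have := sqr_ge0 (lform N b (x^~ s)); have := sumsq_ge0 N l (x^~ s).
move: (lform N b _ ^+ 2) (sumsq N l _) => u v v0 u0.
have pge0 : 0 <= p by rewrite ltW// (andP p01).1.
wlog uv : u v v0 u0 / u <= v.
  move=> H; have [uv|/ltW vu] := leP u v; first exact: H.
  by rewrite (addrC u) (addrC (u `^ p)); exact: H.
apply: (@le_trans _ _ ((2 * v) `^ p)).
  by apply: ge0_ler_powR; rewrite ?nnegrE; lra.
rewrite powRM//; apply: (@le_trans _ _ (2 * v `^ p)).
  rewrite ler_wpM2r ?powR_ge0// -[leRHS](powRr1) ?ler_powR ?ler1n//.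
  by rewrite ltW// (andP p01).2.
by rewrite ler_wpM2l// lerDr powR_ge0.
Qed.

Lemma integrable_qpow l qs : dominates_forms l ->
  m.-integrable setT (fun s => (qpow l qs (x^~ s))%:E).
Proof.
move=> dl; have [C C0 qC] := qpow_le qs dl.
apply: le_integrable (integrableZl measurableT C (integrable_sumsq_powR l)) => //.
  by apply/measurable_EFinP; exact: measurable_qpow.
move=> s _; rewrite /= lee_fin (le_trans (qC _))// ger0_norm//.
by rewrite mulr_ge0// powR_ge0.
Qed.

(** Adjoining the form [c / sqrt n.+1] adds [c^2 / n.+1] to the sum of squares, so the quotients
    tend to the derivative of the power in direction [c^2]. By [powR_increment_le] they are
    dominated by a multiple of [|qpow l ((c, c) :: qs)|], which is integrable. *)
Lemma qpow_increment_cvg l qs c : dominates_forms l ->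
  (\int[m]_s (n.+1%:R * (qpow ((fun i => (Num.sqrt n.+1%:R)^-1 * c i) :: l) qs (x^~ s) -
      qpow l qs (x^~ s)))%:E)%E @[n --> \oo] -->
  (\int[m]_s ((p - (size qs)%:R) * qpow l ((c, c) :: qs) (x^~ s))%:E)%E.
Proof.
move=> dl; set e := p - (size qs)%:R.
have e1 : e <= 1.
  by rewrite /e lerBlDr (le_trans (ltW (andP p01).2))// lerDl.
have lc n y : lform N (fun i => (Num.sqrt n.+1%:R)^-1 * c i) y ^+ 2 =
    lform N c y ^+ 2 / n.+1%:R.
  rewrite /lform; under eq_bigr do rewrite -mulrA.
  by rewrite -mulr_sumr exprMn exprVn sqr_sqrtr// mulrC.
have incr n y : n.+1%:R * (qpow ((fun i => (Num.sqrt n.+1%:R)^-1 * c i) :: l) qs y -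
    qpow l qs y) =
    n.+1%:R * ((sumsq N l y + lform N c y ^+ 2 / n.+1%:R) `^ e - sumsq N l y `^ e) *
    prodq qs y.
  by rewrite /qpow sumsq_cons lc -mulrBl mulrA (addrC _ (sumsq N l y)).
have qE y : qpow l ((c, c) :: qs) y =
    lform N c y ^+ 2 * sumsq N l y `^ (e - 1) * prodq qs y.
  rewrite /qpow prodq_cons /= -natr1 opprD addrA -/e -expr2; ring.
have Q0c y : sumsq N l y = 0 -> lform N c y ^+ 2 = 0.
  have [C C0 /(_ y) H] := dl c => Q0; rewrite Q0 mulr0 in H.
  by apply/eqP; rewrite eq_le H sqr_ge0.
have ig := integrableZl measurableT (1 + `|e|)
  (integrable_norm (integrable_qpow ((c, c) :: qs) dl)).
apply: (@dominated_cvg _ _ _ m setT measurableT _ _ _ _ _ _ ig).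
- move=> n; apply/measurable_EFinP/measurable_funM => //.
  by apply: measurable_funB; exact: measurable_qpow.
- move=> s _; apply/fine_cvgP; split; first exact: nearW.
  rewrite [X in X @ _](_ : _ = fun n =>
    n.+1%:R * ((sumsq N l (x^~ s) + lform N c (x^~ s) ^+ 2 / n.+1%:R) `^ e -
      sumsq N l (x^~ s) `^ e) * prodq qs (x^~ s)); last by apply/funext => n /=; exact: incr.
  rewrite /= qE mulrA; apply: cvgMl.
  have := sumsq_ge0 N l (x^~ s); rewrite le_eqVlt => /predU1P[Q0|Q0].
    rewrite Q0c// mul0r mulr0 (_ : (fun _ => _) = cst 0); first exact: cvg_cst.
    by apply/funext => n; rewrite mul0r addr0 subrr mulr0.
  by apply: powR_increment_cvg => //; exact: sqr_ge0.
- by [].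
- move=> n s _; rewrite /= lee_fin incr qE normrM [X in _ <= _ * X]normrM.
  rewrite [leRHS]mulrA ler_wpM2r//.
  have := sumsq_ge0 N l (x^~ s); rewrite le_eqVlt => /predU1P[Q0|Q0].
    by rewrite Q0c// mul0r addr0 subrr mulr0 normr0 mulr_ge0// addr_ge0.
  have n0 : 0 <= n.+1%:R :> R by [].
  rewrite normrM (ger0_norm n0) [X in _ <= _ * X](ger0_norm (mulr_ge0 (sqr_ge0 _) (powR_ge0 _ _))).
  apply: le_trans (ler_wpM2l n0 (powR_increment_le e1 Q0 _)) _.
    by rewrite divr_ge0 ?sqr_ge0.
  rewrite le_eqVlt; apply/orP; left; apply/eqP; field.
  by rewrite nat1r pnatr_eq0.
Qed.

End one_space.

Section two_spaces.
Context d (S : measurableType d) (m : {sigma_finite_measure set S -> \bar R}).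
Context d' (S' : measurableType d') (m' : {sigma_finite_measure set S' -> \bar R}).
Variables (x : nat -> S -> R) (x' : nat -> S' -> R).
Hypothesis mx : forall j, measurable_fun setT (x j).
Hypothesis mx' : forall j, measurable_fun setT (x' j).
Hypothesis fin_norm : forall a : nat -> R,
  (\int[m]_s (`|lform N a (x^~ s)| `^ alpha)%:E < +oo)%E.
Hypothesis same_norm : forall a : nat -> R,
  (\int[m]_s (`|lform N a (x^~ s)| `^ alpha)%:E =
   \int[m']_s (`|lform N a (x'^~ s)| `^ alpha)%:E)%E.

Let fin_norm' a : (\int[m']_s (`|lform N a (x'^~ s)| `^ alpha)%:E < +oo)%E.
Proof. by rewrite -same_norm. Qed.

(* Replacing [Q] by [Q + c ^ 2 / n] and letting [n] tend to infinity
   multiplies [Q `^ e] by [e * c ^ 2 / Q], where [e = p - size qs != 0]. *)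
Lemma same_qpow l qs : dominates_forms l ->
  (\int[m]_s (qpow l qs (x^~ s))%:E = \int[m']_s (qpow l qs (x'^~ s))%:E)%E.
Proof.
elim: qs l => [l dl|[a b] qs IH l dl].
  rewrite /qpow /prodq/=; under eq_integral do rewrite big_nil mulr1 subr0.
  under [in RHS]eq_integral do rewrite big_nil mulr1 subr0.
  exact: same_sumsq.
set e := p - (size qs)%:R.
(* [p] lies strictly between 0 and 1, so [p] minus a natural number never vanishes and the factor
   produced by differentiation can be cancelled. *)
have e0 : e != 0.
  move: p01; rewrite /e; case: (size qs) => [|k] /andP[p0 p1].
    by rewrite subr0 gt_eqF.
  by rewrite lt_eqF// subr_lt0 (lt_le_trans p1)// ler1n.
have square c : (\int[m]_s (qpow l ((c, c) :: qs) (x^~ s))%:E =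
    \int[m']_s (qpow l ((c, c) :: qs) (x'^~ s))%:E)%E.
  pose cn n i := (Num.sqrt n.+1%:R)^-1 * c i.
  have dn n : dominates_forms (cn n :: l) by exact: dominates_forms_cons.
  have incr n : (\int[m]_s (n.+1%:R * (qpow (cn n :: l) qs (x^~ s) - qpow l qs (x^~ s)))%:E =
      \int[m']_s (n.+1%:R * (qpow (cn n :: l) qs (x'^~ s) - qpow l qs (x'^~ s)))%:E)%E.
    under eq_integral do rewrite EFinM EFinB.
    under [in RHS]eq_integral do rewrite EFinM EFinB.
    rewrite !integralZl//; [|by apply: integrableB => //; exact: integrable_qpow..].
    by rewrite !integralB//; [rewrite !IH|exact: integrable_qpow..].
  have H := @qpow_increment_cvg _ S m x mx fin_norm l qs c dl.
  have H' := @qpow_increment_cvg _ S' m' x' mx' fin_norm' l qs c dl.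
  have E := cvg_unique _ (H : (fun n =>
    (\int[m]_s (n.+1%:R * (qpow (cn n :: l) qs (x^~ s) - qpow l qs (x^~ s)))%:E)%E) @ \oo --> _).
  have {H'} := H' : (fun n =>
    (\int[m']_s (n.+1%:R * (qpow (cn n :: l) qs (x'^~ s) - qpow l qs (x'^~ s)))%:E)%E) @ \oo --> _.
  rewrite (_ : (fun n => _) = (fun n =>
    (\int[m]_s (n.+1%:R * (qpow (cn n :: l) qs (x^~ s) - qpow l qs (x^~ s)))%:E)%E)); last first.
    by apply/funext => n; rewrite incr.
  move=> /E{E} => /(_ (@ereal_hausdorff R)).
  under eq_integral do rewrite EFinM.
  under [in X in _ = X -> _]eq_integral do rewrite EFinM.
  rewrite !integralZl//; [|exact: integrable_qpow..].
  move=> /(congr1 (mule e^-1%:E)).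
  by rewrite !muleA -!EFinM mulVf// !mul1e.
(* Only squares can be added to the sum, so a product of two different forms is obtained from
   squares by polarization. *)
have polar y : qpow l ((a, b) :: qs) y =
    4^-1 * qpow l (((fun i => a i + 1 * b i), (fun i => a i + 1 * b i)) :: qs) y -
    4^-1 * qpow l (((fun i => a i + -1 * b i), (fun i => a i + -1 * b i)) :: qs) y.
  by rewrite /qpow/= !prodq_cons/= !lformD; field.
under eq_integral do rewrite polar EFinB EFinM (EFinM 4^-1).
under [in RHS]eq_integral do rewrite polar EFinB EFinM (EFinM 4^-1).
rewrite integralB//; [|by apply: integrableZl => //; exact: integrable_qpow..].
rewrite integralB//; [|by apply: integrableZl => //; exact: integrable_qpow..].
rewrite !integralZl//; [|exact: integrable_qpow..].
by rewrite !square.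
Qed.

End two_spaces.

End quadratic_products.

(** * Sign patterns of linear forms *)

Section polynomial_threshold.
Context {R : realType}.
Implicit Types x u r : R.

Lemma bernoulli_inequality x n : -1 <= x -> 1 + n%:R * x <= (1 + x) ^+ n.
Proof.
move=> x1; elim: n => [|n IH]; first by rewrite mul0r addr0 expr0.
have x10 : 0 <= 1 + x by lra.
rewrite exprS; apply: le_trans (ler_wpM2l x10 IH).
rewrite -natr1; have := sqr_ge0 x; have := ler0n R n.
by move: (n%:R) => k k0 x2; rewrite -subr_ge0; have := mulr_ge0 k0 x2; lra.
Qed.

Lemma cvg_natr_expr r : 0 <= r -> r < 1 -> n%:R * r ^+ n @[n --> \oo] --> 0.
Proof.
rewrite le_eqVlt => /predU1P[<- _|r0 r1].
  rewrite (_ : (fun _ => _) = cst 0); first exact: cvg_cst.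
  by apply/funext => -[|n]; rewrite ?mul0r// expr0n mulr0.
pose s := Num.sqrt r; have s0 : 0 < s by rewrite sqrtr_gt0.
have s1 : s < 1 by rewrite -sqrtr1 ltr_sqrt.
pose h := s^-1 - 1; have h0 : 0 < h by rewrite subr_gt0 invf_gt1.
have sE n : n%:R * r ^+ n <= h^-1 * s ^+ n.
  have -> : r = s * s by rewrite -expr2 sqr_sqrtr// ltW.
  rewrite exprMn mulrA ler_wpM2r ?exprn_ge0 ?(ltW s0)//.
  rewrite -ler_pdivlMr ?exprn_gt0// -exprVn -ler_pdivrMl ?invr_gt0// invrK.
  have -> : s^-1 = 1 + h by rewrite /h; ring.
  have h1 : -1 <= h by lra.
  by apply: le_trans (bernoulli_inequality n h1); rewrite mulrC lerDr.
apply: (@squeeze_cvgr _ _ _ _ (fun=> 0) (fun n => h^-1 * s ^+ n)).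
- by near=> n; rewrite sE mulr_ge0// exprn_ge0// ltW.
- exact: cvg_cst.
- by apply: cvg_geometric; rewrite ger0_norm// ltW.
Unshelve. all: by end_near. Qed.

(** Polynomials in [u] approximating the indicator of [u < 1/2] on [[0, 1]]. By Bernoulli they are
    at least [1 - n * (2 * u)^n], which tends to 1 below 1/2; from 1/2 on, [n * (2 * u)^n >= n]
    forces them to 0. The extra factor [n] in the exponent settles the boundary point [u = 1/2]. *)
Definition threshold n u := (1 - u ^+ n) ^+ (n * 2 ^ n).

Lemma threshold_itv n u : 0 <= u <= 1 -> 0 <= threshold n u <= 1.
Proof.
move=> /andP[u0 u1].
have un1 : u ^+ n <= 1 by exact: exprn_ile1.
have un0 : 0 <= u ^+ n by exact: exprn_ge0.
by rewrite exprn_ge0 ?subr_ge0// exprn_ile1 ?subr_ge0// gerBl.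
Qed.

Lemma threshold_cvg u : 0 <= u <= 1 ->
  threshold n u @[n --> \oo] --> ((u < 2^-1)%R%:R : R).
Proof.
move=> u01; have /andP[u0 u1] := u01.
have [u2|u2] := ltP u 2^-1.
  apply: (@squeeze_cvgr _ _ _ _ (fun n => 1 - n%:R * (2 * u) ^+ n) (fun=> 1)).
  - near=> n; rewrite (andP (threshold_itv n u01)).2 andbT.
    have n1 : -1 <= - u ^+ n by rewrite lerN2 exprn_ile1.
    apply: le_trans (bernoulli_inequality _ n1).
    by rewrite mulrN natrM natrX exprMn mulrA.
  - rewrite -[X in _ --> X]subr0; apply: cvgB; first exact: cvg_cst.
    by apply: cvg_natr_expr; lra.
  - exact: cvg_cst.
apply: (@squeeze_cvgr _ _ _ _ (fun=> 0) harmonic).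
- near=> n; rewrite (andP (threshold_itv n u01)).1/= /harmonic/= /threshold.
  rewrite -[leRHS]mul1r ler_pdivlMr// -nat1r.
  have un0 : 0 <= u ^+ n by exact: exprn_ge0.
  have un1 : u ^+ n <= 1 by exact: exprn_ile1.
  have nu : (n%:R : R) <= (n * 2 ^ n)%:R * u ^+ n.
    rewrite natrM natrX -mulrA -exprMn ler_peMr// exprn_ege1//; lra.
  have n1 : -1 <= u ^+ n by lra.
  apply: (@le_trans _ _ ((1 - u ^+ n) ^+ (n * 2 ^ n) * (1 + u ^+ n) ^+ (n * 2 ^ n))).
    rewrite ler_wpM2l ?exprn_ge0 ?subr_ge0//.
    by apply: le_trans (bernoulli_inequality (n * 2 ^ n) n1); rewrite lerD2l.
  by rewrite -exprMn exprn_ile1//; nra.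
- exact: cvg_cst.
- exact: cvg_harmonic.
Unshelve. all: by end_near. Qed.

End polynomial_threshold.

Section moments.
Context {R : realType} (C : R).
Hypothesis C0 : 0 < C.

(** The affine change of variable carries [[-C, C]] to [[0, 1]] and the cut at 0 to the cut at
    1/2. *)
Let P n : {poly R} := (1 - (2^-1%:P + (2 * C)^-1 *: 'X) ^+ n) ^+ (n * 2 ^ n).

Let PE n y : (P n).[y] = threshold n (2^-1 + y / (2 * C)).
Proof.
rewrite /P /threshold !horner_exp hornerD hornerN hornerC.
rewrite horner_exp hornerD hornerC hornerZ hornerX.
by rewrite (mulrC _ y).
Qed.

Let uC y : `|y| <= C -> 0 <= 2^-1 + y / (2 * C) <= 1.
Proof.
move=> yC; have : `|y / (2 * C)| <= 2^-1.
  have C2 : 0 < 2 * C by rewrite mulr_gt0.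
  rewrite normrM normfV (gtr0_norm C2) ler_pdivrMr// mulrA mulVf ?mul1r//.
by rewrite ler_norml => /andP[? ?]; apply/andP; split; lra.
Qed.

Section one_space.
Context d (S : measurableType d) (m : {measure set S -> \bar R}).
Variables (Y Z : S -> R).
Hypothesis mY : measurable_fun setT Y.
Hypothesis YC : forall s, `|Y s| <= C.
Hypothesis iZ : m.-integrable setT (EFin \o Z).

Let mZ : measurable_fun setT Z.
Proof. by apply/measurable_EFinP; exact: (measurable_int _ iZ). Qed.

Lemma integrable_bounded_mul (f : S -> R) (B : R) : measurable_fun setT f ->
  (forall s, `|f s| <= B) -> m.-integrable setT (fun s => (f s * Z s)%:E).
Proof.
move=> mf fB; apply: le_integrable (integrableZl measurableT B iZ) => //.
  by apply/measurable_EFinP; exact: measurable_funM.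
move=> s _; rewrite /= lee_fin !normrM ler_wpM2r//.
by apply: le_trans (fB s) _; exact: ler_norm.
Qed.

Lemma integral_horner (p : {poly R}) :
  (\int[m]_s (p.[Y s] * Z s)%:E =
   \sum_(i < size p) (p`_i)%:E * \int[m]_s (Y s ^+ i * Z s)%:E)%E.
Proof.
have iY i : m.-integrable setT (fun s => (Y s ^+ i * Z s)%:E).
  apply: (@integrable_bounded_mul _ (C ^+ i)); first exact: measurable_funX.
  by move=> s; rewrite normrX lerXn2r ?nnegrE// (le_trans _ (YC s)).
under eq_integral do rewrite horner_coef mulr_suml -sumEFin.
rewrite integral_sum//=; last first.
  move=> i; under eq_fun do rewrite -mulrA EFinM.
  exact: integrableZl.
apply: eq_bigr => i _; under eq_integral do rewrite -mulrA EFinM.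
by rewrite integralZl.
Qed.

Lemma integral_threshold_cvg :
  (\int[m]_s ((P n).[Y s] * Z s)%:E)%E @[n --> \oo] -->
  (\int[m]_s ((Y s < 0)%R%:R * Z s)%:E)%E.
Proof.
apply: (@dominated_cvg _ _ _ m setT measurableT _ _ _ _ _ _ (integrable_norm iZ)).
- move=> n; apply/measurable_EFinP/measurable_funM => //.
  under eq_fun do rewrite PE /threshold.
  apply: measurable_funX; apply: measurable_funB => //; apply: measurable_funX.
  by apply: measurable_funD => //; exact: measurable_funM.
- move=> s _; apply/fine_cvgP; split; first exact: nearW.
  rewrite [X in X @ _](_ : _ = fun n => threshold n (2^-1 + Y s / (2 * C)) * Z s); last first.
    by apply/funext => n /=; rewrite PE.
  apply: cvgMl.
  have -> : (Y s < 0) = (2^-1 + Y s / (2 * C) < 2^-1).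
    by rewrite gtrDl pmulr_llt0// invr_gt0 mulr_gt0.
  by apply: threshold_cvg; exact: uC.
- by [].
- move=> n s _; rewrite /= lee_fin normrM ler_piMl// PE.
  by have /andP[q0 q1] := threshold_itv n (uC (YC s)); rewrite ger0_norm.
Qed.

End one_space.

(** The approximating polynomials converge at every point, the cut included, and stay in [[0, 1]].
    Dominated convergence therefore gives the exact strict inequality, without any exceptional
    atoms, and for weights [Z] of arbitrary sign. *)
Lemma moments_lt0 d (S : measurableType d) (m : {measure set S -> \bar R})
    d' (S' : measurableType d') (m' : {measure set S' -> \bar R})
    (Y Z : S -> R) (Y' Z' : S' -> R) :
  measurable_fun setT Y -> measurable_fun setT Y' ->
  (forall s, `|Y s| <= C) -> (forall s, `|Y' s| <= C) ->
  m.-integrable setT (EFin \o Z) -> m'.-integrable setT (EFin \o Z') ->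
  (forall n, (\int[m]_s (Y s ^+ n * Z s)%:E = \int[m']_s (Y' s ^+ n * Z' s)%:E)%E) ->
  (\int[m]_s ((Y s < 0)%R%:R * Z s)%:E = \int[m']_s ((Y' s < 0)%R%:R * Z' s)%:E)%E.
Proof.
move=> mY mY' YC YC' iZ iZ' same.
have H := integral_threshold_cvg mY YC iZ.
have := integral_threshold_cvg mY' YC' iZ'.
rewrite (_ : (fun n => _) = fun n => (\int[m]_s ((P n).[Y s] * Z s)%:E)%E); last first.
  apply/funext => n; rewrite !integral_horner//.
  by apply: eq_bigr => i _; rewrite same.
exact: cvg_unique.
Qed.

End moments.

Section sign_patterns.
Context {R : realType} (alpha : R) (N : nat).
Hypothesis halpha : 1 < alpha < 2.
Let p := alpha / 2.

(** A product of two forms is used because it is even in [y]: the norms [|lform a y|^alpha] do not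
    distinguish [y] from [-y], so the sign of a single form is not determined by them. *)
Definition neg_form (q : (nat -> R) * (nat -> R)) (y : nat -> R) : bool :=
  lform N q.1 y * lform N q.2 y < 0.

Definition pattern (cs : seq (((nat -> R) * (nat -> R)) * bool)) y : R :=
  \prod_(c <- cs) (neg_form c.1 y == c.2)%:R.

Lemma pattern_norm_le1 cs y : `|pattern cs y| <= 1.
Proof.
rewrite /pattern; elim: cs => [|c cs IH]; first by rewrite big_nil normr1.
by rewrite big_cons normrM; case: eqP => _; rewrite ?normr1 ?mul1r// normr0 mul0r.
Qed.

Lemma measurable_pattern d (S : measurableType d) (x : nat -> S -> R) cs :
  (forall j, measurable_fun setT (x j)) ->
  measurable_fun setT (fun s => pattern cs (x^~ s)).
Proof.
move=> mx; rewrite /pattern; elim: cs => [|c cs IH].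
  by under eq_fun do rewrite big_nil; exact: measurable_cst.
under eq_fun do rewrite big_cons.
apply: measurable_funM => //.
apply: (measurableT_comp (f := (fun b : bool => (b == c.2)%:R : R))) => //.
apply: measurable_fun_ltr => //.
by apply: measurable_funM; exact: measurable_lform.
Qed.

Section two_spaces.
Context d (S : measurableType d) (m : {sigma_finite_measure set S -> \bar R}).
Context d' (S' : measurableType d') (m' : {sigma_finite_measure set S' -> \bar R}).
Variables (x : nat -> S -> R) (x' : nat -> S' -> R).
Hypothesis mx : forall j, measurable_fun setT (x j).
Hypothesis mx' : forall j, measurable_fun setT (x' j).
Hypothesis fin_norm : forall a : nat -> R,
  (\int[m]_s (`|lform N a (x^~ s)| `^ alpha)%:E < +oo)%E.
Hypothesis same_norm : forall a : nat -> R,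
  (\int[m]_s (`|lform N a (x^~ s)| `^ alpha)%:E =
   \int[m']_s (`|lform N a (x'^~ s)| `^ alpha)%:E)%E.

Let fin_norm' a : (\int[m']_s (`|lform N a (x'^~ s)| `^ alpha)%:E < +oo)%E.
Proof. by rewrite -same_norm. Qed.

Let ratio (l : seq (nat -> R)) q (y : nat -> R) :=
  lform N q.1 y * lform N q.2 y / sumsq N l y.

Let measurable_ratio e (T : measurableType e) (y : nat -> T -> R) l q :
  (forall j, measurable_fun setT (y j)) ->
  measurable_fun setT (fun s => ratio l q (y^~ s)).
Proof.
move=> my; apply: measurable_funM.
  by apply: measurable_funM; exact: measurable_lform.
under eq_fun do rewrite -powR_inv1 ?sumsq_ge0//.
exact: measurable_sumsq_powR.
Qed.

Let ratio_le l q : dominates_forms N l -> exists2 C, 0 < C & forall y, `|ratio l q y| <= C.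
Proof.
move=> dl; have [C C0 qC] := prodq_le [:: q] dl; exists (C + 1); first by lra.
move=> y; have := qC y; rewrite prodq_cons /prodq big_nil mulr1 expr1 /ratio.
have := sumsq_ge0 N l y; rewrite le_eqVlt => /predU1P[<- _|Q0 H].
  by rewrite invr0 mulr0 normr0; lra.
rewrite normrM normfV (gtr0_norm Q0) ler_pdivrMr// (le_trans H)//.
by rewrite ler_pM2r// lerDl.
Qed.

Let ratio_lt0 l q y : dominates_forms N l -> (ratio l q y < 0) = neg_form q y.
Proof.
move=> dl; rewrite /ratio /neg_form.
have := sumsq_ge0 N l y; rewrite le_eqVlt => /predU1P[Q0|Q0]; last first.
  by rewrite pmulr_llt0 ?invr_gt0.
have [C C0 /(_ y)] := prodq_le [:: q] dl.
rewrite prodq_cons /prodq big_nil mulr1 expr1 -Q0 mulr0 normr_le0 => /eqP ->.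
by rewrite mul0r.
Qed.

(** Moments of the bounded ratio against some [qpow] are again integrals of a [qpow], with [n] more
    pairs, so the hypothesis of [moments_lt0] reduces to integrals already compared. *)
Let qpow_ratio l q qs n y : dominates_forms N l ->
  ratio l q y ^+ n * qpow alpha N l qs y = qpow alpha N l (nseq n q ++ qs) y.
Proof.
move=> dl; elim: n => [|n IH]; first by rewrite expr0 mul1r.
rewrite exprS -mulrA IH /= /qpow prodq_cons.
have := sumsq_ge0 N l y; rewrite le_eqVlt => /predU1P[Q0|Q0].
  have [C C0 /(_ y)] := prodq_le [:: q] dl.
  rewrite prodq_cons /prodq big_nil mulr1 expr1 -Q0 mulr0 normr_le0 => /eqP E.
  by rewrite /ratio E !mul0r mulr0.
have -> : (size (q :: nseq n q ++ qs))%:R = (size (nseq n q ++ qs))%:R + 1 :> R by rewrite natr1.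
rewrite opprD addrA [X in _ = X * _]powRB; last by rewrite (gt_eqF Q0) implybT.
by rewrite powRr1 ?(ltW Q0)// /ratio; field; rewrite gt_eqF.
Qed.

(** Induction on the sign conditions with [qs] arbitrary: a further condition is the negativity of a
    bounded ratio, and its moments against the remaining pattern fall under the induction hypothesis
    for longer [qs]. The opposite condition is the complement. *)
Lemma same_pattern_qpow l qs cs : dominates_forms N l ->
  (\int[m]_s (pattern cs (x^~ s) * qpow alpha N l qs (x^~ s))%:E =
   \int[m']_s (pattern cs (x'^~ s) * qpow alpha N l qs (x'^~ s))%:E)%E.
Proof.
move=> dl; elim: cs qs => [|[q b] cs IH] qs.
  rewrite /pattern; under eq_integral do rewrite big_nil mul1r.
  under [in RHS]eq_integral do rewrite big_nil mul1r.
  exact: same_qpow.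
pose Z y := pattern cs y * qpow alpha N l qs y.
have iZ : m.-integrable setT (EFin \o (fun s => Z (x^~ s))).
  apply: (integrable_bounded_mul (integrable_qpow halpha mx fin_norm qs dl)).
    exact: measurable_pattern.
  by move=> s; exact: pattern_norm_le1.
have iZ' : m'.-integrable setT (EFin \o (fun s => Z (x'^~ s))).
  apply: (integrable_bounded_mul (integrable_qpow halpha mx' fin_norm' qs dl)).
    exact: measurable_pattern.
  by move=> s; exact: pattern_norm_le1.
have [C C0 rC] := ratio_le q dl.
have E := moments_lt0 C0 (measurable_ratio l q mx) (measurable_ratio l q mx')
  (fun s => rC (x^~ s)) (fun s => rC (x'^~ s)) iZ iZ'.
have {E} : (\int[m]_s ((neg_form q (x^~ s))%:R * Z (x^~ s))%:E =
    \int[m']_s ((neg_form q (x'^~ s))%:R * Z (x'^~ s))%:E)%E.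
  under eq_integral do rewrite -(ratio_lt0 q _ dl).
  under [in RHS]eq_integral do rewrite -(ratio_lt0 q _ dl).
  apply: E => n.
  under eq_integral do rewrite /Z mulrCA (qpow_ratio q _ _ _ dl).
  under [in RHS]eq_integral do rewrite /Z mulrCA (qpow_ratio q _ _ _ dl).
  exact: IH.
move=> E; rewrite /pattern.
under eq_integral do rewrite big_cons -mulrA -/(pattern cs _) -/(Z _).
under [in RHS]eq_integral do rewrite big_cons -mulrA -/(pattern cs _) -/(Z _).
case: b => /=.
  under eq_integral do rewrite eqb_id.
  by under [in RHS]eq_integral do rewrite eqb_id.
have negE (c : bool) (z : R) : (c == false)%:R * z = z - c%:R * z.
  by case: c; rewrite ?mul1r ?mul0r ?subr0 ?subrr.
under eq_integral do rewrite negE EFinB.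
under [in RHS]eq_integral do rewrite negE EFinB.
have mneg e (T : measurableType e) (y : nat -> T -> R) :
    (forall j, measurable_fun setT (y j)) ->
    measurable_fun setT (fun s => (neg_form q (y^~ s))%:R : R).
  move=> my; apply: (measurableT_comp (f := (fun b : bool => b%:R : R))) => //.
  by apply: measurable_fun_ltr => //; apply: measurable_funM; exact: measurable_lform.
have bneg y : `|(neg_form q y)%:R : R| <= 1.
  by case: neg_form; rewrite ?normr1 ?normr0.
rewrite !integralB//.
- by rewrite E; congr (_ - _)%E; exact: IH.
- exact: (integrable_bounded_mul iZ' (mneg _ _ _ mx') (fun s => bneg _)).
- exact: (integrable_bounded_mul iZ (mneg _ _ _ mx) (fun s => bneg _)).
Qed.

End two_spaces.

End sign_patterns.

Section coordinate_weight.
Context {R : realType} (alpha : R) (N : nat).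
Hypothesis halpha : 1 < alpha < 2.
Let p := alpha / 2.

Definition coord (k : nat) : nat -> R := fun i => (i == k)%:R.

Lemma lform_coord k y : (k < N)%N -> lform N (coord k) y = y k.
Proof.
move=> kN; rewrite /lform (bigD1 (Ordinal kN))//= /coord eqxx mul1r big1 ?addr0// => i ik.
by rewrite (_ : (_ == _) = false) ?mul0r//; 
apply/negbTE; apply: contra ik => /eqP ik; apply/eqP/val_inj.
Qed.

(** Its sum of squares is [y k ^+ 2] plus [dl] times the full square norm. The ridge makes it
    dominate all forms for [dl > 0], while for [dl] tending to 0 its power tends to the weight
    [|y k|^alpha]. *)
Definition ridge_base (dl : R) k : seq (nat -> R) :=
  coord k :: [seq (fun i => Num.sqrt dl * coord j i) | j <- iota 0 N].

Lemma sumsq_ridge_base dl k y : 0 <= dl -> (k < N)%N ->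
  sumsq N (ridge_base dl k) y = y k ^+ 2 + dl * \sum_(j < N) y j ^+ 2.
Proof.
move=> dl0 kN; rewrite sumsq_cons lform_coord// /sumsq big_map.
rewrite -[X in iota _ X]subn0 big_mkord mulr_sumr; congr (_ + _).
apply: eq_bigr => j _; rewrite -[X in X ^+ 2]/(lform N _ y).
have -> : lform N (fun i => Num.sqrt dl * coord j i) y = Num.sqrt dl * lform N (coord j) y.
  by rewrite /lform mulr_sumr; apply: eq_bigr => i _; rewrite mulrA.
by rewrite lform_coord// exprMn sqr_sqrtr.
Qed.

Lemma lform_sqr_le (a : nat -> R) : exists2 C, 0 <= C &
  forall y, lform N a y ^+ 2 <= C * \sum_(j < N) y j ^+ 2.
Proof.
rewrite /lform; elim: N => [|n [C C0 IH]].
  by exists 0 => // y; rewrite !big_ord0 expr0n mulr0.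
exists (2 * C + 2 * a n ^+ 2) => [|y]; first by have := sqr_ge0 (a n); lra.
rewrite !big_ord_recr /=; have := IH y.
have : 0 <= \sum_(j < n) y j ^+ 2 by apply: sumr_ge0 => j _; exact: sqr_ge0.
move: (\sum_(i < n) a i * y i) (\sum_(j < n) y j ^+ 2) => u v v0 uv.
have := sqr_ge0 (u - a n * y n); have := mulr_ge0 C0 (sqr_ge0 (y n)).
have := mulr_ge0 (sqr_ge0 (a n)) v0; nra.
Qed.

Lemma dominates_forms_ridge_base dl k : 0 < dl -> (k < N)%N ->
  dominates_forms N (ridge_base dl k).
Proof.
move=> dl0 kN a; have [C C0 aC] := lform_sqr_le a.
exists (C / dl) => [|y]; first by rewrite divr_ge0// ltW.
apply: le_trans (aC y) _; rewrite sumsq_ridge_base ?(ltW dl0)// -mulrA ler_wpM2l//.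
by rewrite mulrDr mulrA mulVf ?gt_eqF// mul1r lerDr mulr_ge0// ?invr_ge0 ?(ltW dl0)// sqr_ge0.
Qed.

(** [y k != 0] written as a sign condition: the product of [y k] and [- y k] is negative. It
    confines the limit of the ridge to points where the base of the power stays positive. *)
Definition nonzero_code k : ((nat -> R) * (nat -> R)) * bool :=
  ((coord k, fun i => -1 * coord k i), true).

Lemma pattern_nonzero k cs y : (k < N)%N ->
  pattern N (nonzero_code k :: cs) y = (y k != 0)%:R * pattern N cs y.
Proof.
move=> kN; rewrite /pattern big_cons; congr (_%:R * _).
rewrite /neg_form /= lform_coord//.
have -> : lform N (fun i => -1 * coord k i) y = - y k.
  rewrite -[in RHS](lform_coord y kN) -[RHS]mulN1r /lform mulr_sumr.
  by apply: eq_bigr => i _; rewrite mulrA.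
by rewrite eqb_id mulrN -expr2 oppr_lt0 exprn_even_gt0.
Qed.

Lemma qpow_ridge_base_cvg k y : (k < N)%N -> y k != 0 ->
  qpow alpha N (ridge_base n.+1%:R^-1 k) [::] y @[n --> \oo] --> `|y k| `^ alpha.
Proof.
move=> kN yk0; set W := \sum_(j < N) y j ^+ 2.
have W0 : 0 <= W by apply: sumr_ge0 => j _; exact: sqr_ge0.
have Q0 : 0 < y k ^+ 2 by rewrite exprn_even_gt0.
have qE n : qpow alpha N (ridge_base n.+1%:R^-1 k) [::] y = (y k ^+ 2 + W / n.+1%:R) `^ p.
  by rewrite /qpow /prodq big_nil mulr1 subr0 sumsq_ridge_base// (mulrC _ W).
rewrite (_ : (fun n => _) = fun n => (y k ^+ 2 + W / n.+1%:R) `^ p); last exact/funext.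
have -> : `|y k| `^ alpha = (y k ^+ 2) `^ p.
  rewrite -(real_normK (num_real (y k))) -powR_mulrn// -powRrM.
  by congr (_ `^ _); rewrite /p; field.
(* Continuity is read off from the difference quotients: these converge, so [n.+1^-1] times them
   tends to 0. *)
have H := @powR_increment_cvg R _ _ p Q0 W0.
have c0 : (fun=> (y k ^+ 2) `^ p) n @[n --> \oo] --> (y k ^+ 2) `^ p by exact: cvg_cst.
rewrite -[X in _ --> X]add0r -(mul0r (p * (W * (y k ^+ 2) `^ (p - 1)))).
apply: cvg_trans (cvgD (cvgM (@cvg_harmonic R) H) c0).
apply: near_eq_cvg; near=> n => /=.
transitivity (n.+1%:R^-1 * (n.+1%:R * ((y k ^+ 2 + W / n.+1%:R) `^ p -
  (y k ^+ 2) `^ p)) + (y k ^+ 2) `^ p) => //.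
by rewrite mulKf ?pnatr_eq0// subrK.
Unshelve. all: by end_near. Qed.

Section one_space.
Context d (S : measurableType d) (m : {measure set S -> \bar R}).
Variable x : nat -> S -> R.
Hypothesis mx : forall j, measurable_fun setT (x j).
Hypothesis fin_norm : forall a : nat -> R,
  (\int[m]_s (`|lform N a (x^~ s)| `^ alpha)%:E < +oo)%E.

Lemma pattern_ridge_base_cvg k cs : (k < N)%N ->
  (\int[m]_s (pattern N (nonzero_code k :: cs) (x^~ s) *
      qpow alpha N (ridge_base n.+1%:R^-1 k) [::] (x^~ s))%:E)%E @[n --> \oo] -->
  (\int[m]_s (pattern N cs (x^~ s) * `|x k s| `^ alpha)%:E)%E.
Proof.
move=> kN.
have ig := integrable_qpow halpha mx fin_norm [::] (dominates_forms_ridge_base (@ltr01 R) kN).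
have ge0q l y : 0 <= qpow alpha N l [::] y.
  by rewrite /qpow /prodq big_nil mulr1 powR_ge0.
apply: (@dominated_cvg _ _ _ m setT measurableT _ _ _ _ _ _ ig).
- move=> n; apply/measurable_EFinP/measurable_funM; first exact: measurable_pattern.
  exact: measurable_qpow.
- move=> s _; apply/fine_cvgP; split; first exact: nearW.
  rewrite [X in X @ _](_ : _ = fun n => pattern N (nonzero_code k :: cs) (x^~ s) *
      qpow alpha N (ridge_base n.+1%:R^-1 k) [::] (x^~ s))//.
  have a0 : alpha != 0 by rewrite gt_eqF// (lt_trans _ (andP halpha).1).
  rewrite pattern_nonzero//; have [x0|x0] := eqVneq (x k s) 0.
    rewrite x0 normr0 powR0// mulr0 (_ : (fun _ => _) = cst 0); first exact: cvg_cst.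
    by apply/funext => n; rewrite /= !mul0r.
  rewrite mul1r; apply: cvgMr.
  exact: (@qpow_ridge_base_cvg k (x^~ s) kN x0).
- by [].
- move=> n s _; rewrite /= lee_fin normrM (ger0_norm (ge0q _ _)).
  apply: (@le_trans _ _ (qpow alpha N (ridge_base n.+1%:R^-1 k) [::] (x^~ s))).
    by rewrite ler_piMl// pattern_norm_le1.
  rewrite /qpow /prodq !big_nil !mulr1 subr0 ge0_ler_powR ?nnegrE ?sumsq_ge0//.
    by rewrite divr_ge0// (le_trans _ (ltW (andP halpha).1)).
  rewrite !sumsq_ridge_base// lerD2l ler_wpM2r//.
    by apply: sumr_ge0 => j _; exact: sqr_ge0.
  by rewrite invf_le1// ler1n.
Qed.

End one_space.

Lemma same_pattern d (S : measurableType d) (m : {sigma_finite_measure set S -> \bar R})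
    d' (S' : measurableType d') (m' : {sigma_finite_measure set S' -> \bar R})
    (x : nat -> S -> R) (x' : nat -> S' -> R) :
  (forall j, measurable_fun setT (x j)) -> (forall j, measurable_fun setT (x' j)) ->
  (forall a : nat -> R, (\int[m]_s (`|lform N a (x^~ s)| `^ alpha)%:E < +oo)%E) ->
  (forall a : nat -> R, (\int[m]_s (`|lform N a (x^~ s)| `^ alpha)%:E =
     \int[m']_s (`|lform N a (x'^~ s)| `^ alpha)%:E)%E) ->
  forall k cs, (k < N)%N ->
  (\int[m]_s (pattern N cs (x^~ s) * `|x k s| `^ alpha)%:E =
   \int[m']_s (pattern N cs (x'^~ s) * `|x' k s| `^ alpha)%:E)%E.
Proof.
move=> mx mx' fin_norm same k cs kN.
have fin_norm' a : (\int[m']_s (`|lform N a (x'^~ s)| `^ alpha)%:E < +oo)%E.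
  by rewrite -same.
have H := @pattern_ridge_base_cvg _ S m x mx fin_norm k cs kN.
have H' := @pattern_ridge_base_cvg _ S' m' x' mx' fin_norm' k cs kN.
apply: (cvg_unique _ H) => //; move: H'.
rewrite (_ : (fun n => _) = fun n => (\int[m]_s (pattern N (nonzero_code k :: cs) (x^~ s) *
      qpow alpha N (ridge_base n.+1%:R^-1 k) [::] (x^~ s))%:E)%E)//.
apply/funext => n; rewrite (same_pattern_qpow halpha mx mx' fin_norm same)//.
by apply: dominates_forms_ridge_base.
Qed.

End coordinate_weight.

(** * Matching standard Borel spaces with equal codes *)

Section product_complete.
Context {R : realType} (U V : completePseudoMetricType R).

HB.instance Definition _ := Pointed.on (U * V)%type.

Lemma prod_cauchy_cvg (F : set_system (U * V)) : ProperFilter F -> cauchy F ->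
  [cvg F in (U * V)%type].
Proof.
move=> FF /cauchy_ballP Fc.
have /cauchy_cvg c1 : cauchy (fst @ F).
  apply/cauchy_ballP => e e0; have := Fc e e0.
  by case=> [[A B]] /= [FA FB] AB; exists (fst @` A, fst @` B) => /=;
    [split; [apply: filterS FA|apply: filterS FB] => z; exists z
    |move=> [_ _] /= [[a Aa <-] [b Bb <-]]; have [] := AB (a, b) (conj Aa Bb)].
have /cauchy_cvg c2 : cauchy (snd @ F).
  apply/cauchy_ballP => e e0; have := Fc e e0.
  by case=> [[A B]] /= [FA FB] AB; exists (snd @` A, snd @` B) => /=;
    [split; [apply: filterS FA|apply: filterS FB] => z; exists z
    |move=> [_ _] /= [[a Aa <-] [b Bb <-]]; have [] := AB (a, b) (conj Aa Bb)].
apply/cvg_ex; exists (lim (fst @ F), lim (snd @ F)).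
move=> W [[A B] /= [Al Bl] AB].
have H : F (fst @^-1` A `&` snd @^-1` B).
  by apply: filterI; [exact: (c1 _ Al)|exact: (c2 _ Bl)].
apply: (@filterS _ F _ (fst @^-1` A `&` snd @^-1` B) W _ H).
by move=> z [Az Bz]; exact: AB.
Qed.

HB.instance Definition _ := Uniform_isComplete.Build (U * V)%type prod_cauchy_cvg.

End product_complete.

Section standard_borel_product.
Context {R : realType}.

Lemma countable_dense_seq (M : ptopologicalType) (D : set M) : countable D -> dense D ->
  exists e : nat -> M, forall O : set M, O !=set0 -> open O -> exists n, O (e n).
Proof.
move=> /pfcard_geP[D0 dD|[f] dD].
  by have [x []] := dD setT (ex_intro _ point I) openT; rewrite D0.
exists f => O O0 oO; have [x [Ox Dx]] := dD O O0 oO.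
by have [n _ nx] := @surj _ _ setT D f x Dx; exists n; rewrite nx.
Qed.

Lemma standard_borel_R : standard_borel R (measurableTypeR R).
Proof.
exists R, (id : measurableTypeR R -> R); split.
- exact: Rhausdorff.
- exists (range ratr); last exact: dense_rat.
  exact: sub_countable (card_image_le _ _) (countableP _).
- by [].
- move=> B; apply: smallest_sub; first exact: sigma_algebra_measurable.
  by move=> O oO; exact: open_measurable.
- move=> A; rewrite image_id RGenOpens.measurableE.
  apply: smallest_sub; first exact: smallest_sigma_algebra.
  move=> _ [x [y ->]]; apply: sub_sigma_algebra; exact: interval_open.
Qed.

Context d1 (S1 : measurableType d1) d2 (S2 : measurableType d2).

(** Separability makes the preimage of an open set a countable union of measurable rectangles.
    Conversely the image of a rectangle is an intersection of two preimages under the projections,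
    and injectivity lets images commute with complements. *)
Lemma standard_borel_prod : standard_borel R S1 -> standard_borel R S2 ->
  standard_borel R (S1 * S2)%type.
Proof.
move=> [M1 [f1 [h1 [D1 cD1 dD1] i1 p1 m1]]] [M2 [f2 [h2 [D2 cD2 dD2] i2 p2 m2]]].
exists (M1 * M2)%type, (fun z => (f1 z.1, f2 z.2)); split.
- move=> [a1 a2] [b1 b2] cl; congr (_, _).
    apply: h1 => A B aA bB.
    have [||[z1 z2] [/= [zA _] [zB _]]] := cl (A `*` setT) (B `*` setT).
    + by exists (A, setT) => //=; split => //; exact: filterT.
    + by exists (B, setT) => //=; split => //; exact: filterT.
    + by exists z1.
  apply: h2 => A B aA bB.
  have [||[z1 z2] [/= [_ zA] [_ zB]]] := cl (setT `*` A) (setT `*` B).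
  + by exists (setT, A) => //=; split => //; exact: filterT.
  + by exists (setT, B) => //=; split => //; exact: filterT.
  + by exists z2.
- exists (D1 `*` D2); first exact: countableX.
  move=> O [[z1 z2] Oz] oO; have [[A B] /= [z1A z2B] AB] := oO _ Oz.
  have [a [aA Da]] : exists a, (A° `&` D1) a.
    by apply: dD1; [exists z1|exact: open_interior].
  have [b [bB Db]] : exists b, (B° `&` D2) b.
    by apply: dD2; [exists z2|exact: open_interior].
  exists (a, b); split => //; apply: AB; split => /=; exact: interior_subset.
- by move=> [x1 x2] [y1 y2] [/i1 -> /i2 ->].
- apply: smallest_sub; first split.
  + by rewrite /= preimage_set0; exact: measurable0.
  + by move=> A mA; rewrite setTD /= preimage_setC; exact: measurableC.
  + by move=> F mF; rewrite /= preimage_bigcup; exact: bigcupT_measurable.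
  move=> O oO /=.
  have [e1 e1P] := countable_dense_seq cD1 dD1.
  have [e2 e2P] := countable_dense_seq cD2 dD2.
  (* Balls of a pseudometric type need not be open, so their interiors are used. Centres are later
     chosen within half the radius of the point, which puts the point in the interior. *)
  pose W := [set w : nat * nat * nat |
    (ball (e1 w.1.1) (w.2.+1%:R^-1 : R))° `*` (ball (e2 w.1.2) (w.2.+1%:R^-1 : R))° `<=` O].
  have -> : (fun z => (f1 z.1, f2 z.2)) @^-1` O = \bigcup_(w in W)
      ((f1 @^-1` (ball (e1 w.1.1) (w.2.+1%:R^-1 : R))°) `*`
       (f2 @^-1` (ball (e2 w.1.2) (w.2.+1%:R^-1 : R))°)).
    apply/seteqP; split => [[z1 z2] /= Oz|[z1 z2] /= [w wO [w1 w2]]]; last first.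
      exact: wO.
    have /nbhs_ballP [e /= e0 eO] := oO _ Oz.
    have [n ne] : exists n : nat, 2 * n.+1%:R^-1 < e.
      have [n] := @ltr_add_invr R 0 (e / 2) (divr_gt0 e0 (ltr0n _ 2)).
      by rewrite add0r => ne; exists n; rewrite -ltr_pdivlMl// mulrC.
    have n0 : 0 < n.+1%:R^-1 :> R by rewrite invr_gt0.
    have pick (M : completePseudoMetricType R) (f : nat -> M) (z : M) :
        (forall O : set M, O !=set0 -> open O -> exists n, O (f n)) ->
        exists a, (ball (f a) (n.+1%:R^-1 : R))° z /\ ball (f a) (n.+1%:R^-1 : R) `<=` ball z e.
      move=> dD; have [||a az] := dD (ball z (n.+1%:R^-1 / 2))°.
      + by exists z; exact: nbhsx_ballx _ _ (divr_gt0 n0 (ltr0n _ 2)).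
      + exact: open_interior.
      have {}az := interior_subset az.
      exists a => //; split.
        apply/nbhs_ballP; exists (n.+1%:R^-1 / 2) => /=; first by rewrite divr_gt0.
        by move=> y zy; rewrite [n.+1%:R^-1]splitr; apply: ball_triangle zy; exact: ball_sym.
      have re : n.+1%:R^-1 / 2 + n.+1%:R^-1 <= e.
        by move: n0 ne; move: (n.+1%:R^-1 : R) => r; lra.
      move=> y ay; apply: (@le_ball _ _ _ _ _ re).
      exact: ball_triangle az ay.
    have [a1 [az1 b1]] := pick _ _ (f1 z1) e1P.
    have [a2 [az2 b2]] := pick _ _ (f2 z2) e2P.
    exists (a1, a2, n) => //= -[y1 y2] [/= y1a y2a]; apply: eO.
    by split; [apply: b1|apply: b2]; exact: interior_subset.
  rewrite bigcup_mkcond; apply: countable_bigcupT_measurable => // -[[a1 a2] n].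
  case: ifP => _ //; apply: measurableX.
    by apply: p1; apply: sub_sigma_algebra; exact: open_interior.
  by apply: p2; apply: sub_sigma_algebra; exact: open_interior.
pose T := g_sigma_algebraType (@open (M1 * M2)%type).
have mfst (B : set M1) : <<s open >> B -> @measurable _ T (fst @^-1` B).
  apply: (@smallest_sub _ _ _ [set A | @measurable _ T (fst @^-1` A)]); first split.
  - by rewrite /= preimage_set0; exact: (@measurable0 _ T).
  - by move=> A mA; rewrite setTD /= preimage_setC; exact: (@measurableC _ T).
  - by move=> F mF; rewrite /= preimage_bigcup; exact: (@bigcupT_measurable _ T).
  move=> O oO /=; apply: sub_sigma_algebra; apply: open_comp => // x _.
  exact: cvg_fst.
have msnd (B : set M2) : <<s open >> B -> @measurable _ T (snd @^-1` B).
  apply: (@smallest_sub _ _ _ [set A | @measurable _ T (snd @^-1` A)]); first split.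
  - by rewrite /= preimage_set0; exact: (@measurable0 _ T).
  - by move=> A mA; rewrite setTD /= preimage_setC; exact: (@measurableC _ T).
  - by move=> F mF; rewrite /= preimage_bigcup; exact: (@bigcupT_measurable _ T).
  move=> O oO /=; apply: sub_sigma_algebra; apply: open_comp => // x _.
  exact: cvg_snd.
have mrect A1 A2 : measurable A1 -> measurable A2 ->
    @measurable _ T ((fun z => (f1 z.1, f2 z.2)) @` (A1 `*` A2)).
  move=> mA1 mA2.
  have -> : (fun z => (f1 z.1, f2 z.2)) @` (A1 `*` A2) =
      fst @^-1` (f1 @` A1) `&` snd @^-1` (f2 @` A2).
    apply/seteqP; split => [_ [[x y] [/= Ax Ay] <-]|[_ _] [[x /= Ax <-] [y Ay <-]]].
      by split; [exists x|exists y].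
    by exists (x, y).
  by apply: (@measurableI _ T); [apply: mfst; exact: m1|apply: msnd; exact: m2].
rewrite measurable_prod_measurableType.
apply: (@smallest_sub _ _ _ [set A |
  @measurable _ T ((fun z => (f1 z.1, f2 z.2)) @` A)]); first split.
- by rewrite /= image_set0; exact: (@measurable0 _ T).
- move=> A mA; rewrite /= setTD.
  have -> : (fun z => (f1 z.1, f2 z.2)) @` (~` A) =
      (fun z => (f1 z.1, f2 z.2)) @` (setT `*` setT) `\` (fun z => (f1 z.1, f2 z.2)) @` A.
    apply/seteqP; split => [_ [[x y] /= nA <-]|_ [[[x y] _ <-] /= nA]].
      split; first by exists (x, y).
      by move=> [[x' y'] Axy' [/i1 ex /i2 ey]]; apply: nA; rewrite -ex -ey.
    by exists (x, y) => // Axy; apply: nA; exists (x, y).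
  by apply: (@measurableD _ T) => //; exact: mrect.
- by move=> F mF; rewrite /= image_bigcup; exact: (@bigcupT_measurable _ T).
by move=> _ [A1 mA1 [A2 mA2 <-]]; exact: mrect.
Qed.

End standard_borel_product.

Lemma measure_bigcup_small {R : realType} d (S : measurableType d)
    (nu : {measure set S -> \bar R}) (L : nat -> set S) (eps : R) :
  0 <= eps -> (forall i, measurable (L i)) ->
  (forall i, (nu (L i) <= (eps / (2 ^ i.+1)%:R)%:E)%E) ->
  (nu (\bigcup_i L i) <= eps%:E)%E.
Proof.
move=> e0 mL Le.
have mU : measurable (\bigcup_i L i) by exact: bigcupT_measurable.
apply: le_trans (measure_sigma_subadditive nu mL mU (@subset_refl _ _)) _.
have := @epsilon_trick R (fun=> 0%E) eps xpredT (fun=> lexx _) e0.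
rewrite [X in (_ <= X + _)%E -> _]eseries0// add0e; apply: le_trans.
by apply: lee_nneseries => [i _ _|i _]; rewrite ?add0e.
Qed.

(** * Closed inner regularity and tightness of finite measures *)

Section closed_regularity.
Context {R : realType} d (S : measurableType d) (M : completePseudoMetricType R).
Variables (phi : S -> M) (nu : {measure set S -> \bar R}).
Hypothesis mphi : forall B, <<s @open M >> B -> measurable (phi @^-1` B).
Hypothesis nu_fin : (nu setT < +oo)%E.

Let T := g_sigma_algebraType (@open M).

Let closed_borel (C : set M) : closed C -> @measurable _ T C.
Proof.
move=> cC; rewrite -[C]setCK; apply: (@measurableC _ T).
by apply: sub_sigma_algebra; exact: closed_openC.
Qed.

Let inner (B : set M) := forall eps : R, 0 < eps ->
  exists C : set M, [/\ closed C, C `<=` B & (nu (phi @^-1` (B `\` C)) <= eps%:E)%E].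

Let mpre (B : set M) : @measurable _ T B -> measurable (phi @^-1` B).
Proof. exact: mphi. Qed.

Let fin_nu A : measurable A -> (nu A < +oo)%E.
Proof. by move=> mA; apply: le_lt_trans nu_fin; rewrite le_measure ?inE. Qed.

Lemma increasing_inner (B : set M) (F : nat -> set M) : @measurable _ T B ->
  (forall n, closed (F n)) -> {homo F : n m / (n <= m)%N >-> (n <= m)%O} ->
  (forall n, F n `<=` B) ->
  forall eps : R, 0 < eps -> exists n,
    (nu (phi @^-1` (B `\` F n)) <= nu (phi @^-1` (B `\` \bigcup_n F n)) + eps%:E)%E.
Proof.
move=> mB cF ndF FB eps e0.
have mF n : @measurable _ T (F n) by exact: closed_borel.
have mU : @measurable _ T (\bigcup_n F n) by exact: (@bigcupT_measurable _ T).
have := @nonincreasing_cvg_mu _ S R nu (fun n => phi @^-1` (B `\` F n)).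
have mD n : measurable (phi @^-1` (B `\` F n)) by apply: mpre; exact: (@measurableD _ T).
have E : \bigcap_n phi @^-1` (B `\` F n) = phi @^-1` (B `\` \bigcup_n F n).
  apply/seteqP; split => [x H|x [Bx nF] n _]; last by split => // Fx; apply: nF; exists n.
  by split; [have [] := H 0%N I|move=> [n _ Fx]; have [] := H n I].
have mE : measurable (phi @^-1` (B `\` \bigcup_n F n)) by apply: mpre; exact: (@measurableD _ T).
rewrite E => /(_ (fin_nu (mD 0%N)) mD mE) H.
have {}H := H _.
have ndD : {homo (fun n => phi @^-1` (B `\` F n)) : n m / (n <= m)%N >-> (m <= n)%O}.
  by move=> n m nm; apply/subsetPset => x [Bx nF]; split => // Fx; apply: nF;
    have /subsetPset := ndF _ _ nm; exact.
have {H} := H ndD.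
have finE : nu (phi @^-1` (B `\` \bigcup_n F n)) \is a fin_num.
  by rewrite ge0_fin_numE ?fin_nu.
rewrite -(fineK finE) => /fine_cvgP[_] /cvgrPdist_le /(_ _ e0)[n _ /(_ n (leqnn n))].
rewrite /= distrC => /ler_normlW; rewrite lerBlDl => H.
exists n; rewrite -EFinD -(@fineK _ (nu (phi @^-1` (B `\` F n)))) ?lee_fin//.
by rewrite ge0_fin_numE ?fin_nu.
Qed.

(** The points whose ball of radius [n.+1^-1] stays in [O] have closures contained in [O], and these
    increase to [O]. *)
Let inner_open (O : set M) : open O -> inner O.
Proof.
move=> oO eps e0; pose F n := closure [set x | ball x (n.+1%:R^-1 : R) `<=` O].
have FO n : F n `<=` O.
  move=> z /(_ (ball z (n.+1%:R^-1 : R))) [|x [xO zx]].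
    by apply: nbhsx_ballx; rewrite invr_gt0.
  by apply: xO; exact: ball_sym.
have cF n : closed (F n) by exact: closed_closure.
have ndF : {homo F : n m / (n <= m)%N >-> (n <= m)%O}.
  move=> n m nm; apply/subsetPset; apply: closure_subset => x xO; apply: subset_trans xO.
  by apply: le_ball; rewrite lef_pV2 ?posrE// ler_nat.
have mO : @measurable _ T O by exact: sub_sigma_algebra.
have [n] := increasing_inner mO cF ndF FO e0.
have -> : O `\` \bigcup_n F n = set0.
  apply/seteqP; split => // x [Ox]; apply.
  have /nbhs_ballP [e /= e_gt0 eO] : nbhs x O by exact: open_nbhs_nbhs.
  have [k] := @ltr_add_invr R 0 e e_gt0; rewrite add0r => ke.
  exists k => //; apply: subset_closure => /=; apply: subset_trans eO.
  by apply: le_ball; exact: ltW.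
rewrite preimage_set0 measure0 add0e => H.
by exists (F n); split.
Qed.

Let half_pos (eps : R) i : 0 < eps -> 0 < eps / (2 ^ i.+1)%:R.
Proof. by move=> e0; rewrite divr_gt0// ltr0n expn_gt0. Qed.

Let inner_bigcap (B : nat -> set M) : (forall i, @measurable _ T (B i)) ->
  (forall i, inner (B i)) -> inner (\bigcap_i B i).
Proof.
move=> mB iB eps e0.
have /choice[C CP] i := iB i _ (half_pos i e0).
exists (\bigcap_i C i); split.
- by apply: closed_bigI => i _; have [] := CP i.
- by move=> x Cx i _; have [_ CB _] := CP i; exact: CB (Cx i I).
have mC i : @measurable _ T (C i) by apply: closed_borel; have [] := CP i.
have mBC i : measurable (phi @^-1` (B i `\` C i)) by apply: mpre; exact: (@measurableD _ T).
have CPn i : (nu (phi @^-1` (B i `\` C i)) <= (eps / (2 ^ i.+1)%:R)%:E)%E.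
  by have [] := CP i.
apply: le_trans (measure_bigcup_small (ltW e0) mBC CPn).
rewrite le_measure ?inE//.
- by apply: mpre; apply: (@measurableD _ T); exact: (@bigcapT_measurable _ T).
- exact: bigcupT_measurable.
move=> x [Bx nC]; have [i nCi] : exists i, ~ C i (phi x).
  by apply: contrapT => /forallNP H; apply: nC => i _; apply: contrapT; exact: H.
by exists i => //; split => //; exact: Bx.
Qed.

Let inner_bigcup (B : nat -> set M) : (forall i, @measurable _ T (B i)) ->
  (forall i, inner (B i)) -> inner (\bigcup_i B i).
Proof.
move=> mB iB eps e0; have e20 : 0 < eps / 2 by rewrite divr_gt0.
have /choice[C CP] i := iB i _ (half_pos i e20).
pose F n := \big[setU/set0]_(i < n.+1) C i.
have cF n : closed (F n) by apply: closed_bigsetU => i _; have [] := CP i.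
have ndF : {homo F : n m / (n <= m)%N >-> (n <= m)%O}.
  by move=> n m nm; apply/subsetPset;
    exact: (@subset_bigsetU _ C n.+1 m.+1).
have UF : \bigcup_n F n = \bigcup_n C n.
  rewrite -(bigcup_bigsetU_bigcup C); apply/seteqP; split => x [n _ Fx]; exists n => //.
have mU : @measurable _ T (\bigcup_i B i) by exact: (@bigcupT_measurable _ T).
have FU n : F n `<=` \bigcup_i B i.
  move=> x Fx; have [i _ Cx] : (\bigcup_n C n) x by rewrite -UF; exists n.
  by exists i => //; have [_ CB _] := CP i; exact: CB.
have [n nP] := increasing_inner mU cF ndF FU e20.
exists (F n); split => //; apply: (le_trans nP).
rewrite [in leRHS](splitr eps) EFinD leeD2r//.
have mC i : @measurable _ T (C i) by apply: closed_borel; have [] := CP i.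
have mBC i : measurable (phi @^-1` (B i `\` C i)) by apply: mpre; exact: (@measurableD _ T).
have CPn i : (nu (phi @^-1` (B i `\` C i)) <= (eps / 2 / (2 ^ i.+1)%:R)%:E)%E.
  by have [] := CP i.
apply: le_trans (measure_bigcup_small (ltW e20) mBC CPn).
rewrite le_measure ?inE//.
- apply: mpre; apply: (@measurableD _ T) => //; rewrite UF.
  exact: (@bigcupT_measurable _ T).
- exact: bigcupT_measurable.
move=> x [[i _ Bx] nF]; exists i => //; split => // Cx; apply: nF; rewrite UF.
by exists i.
Qed.

(** The sets that are inner regular together with their complement form a sigma-algebra: the
    approximation passes to countable unions and intersections with errors [eps / 2^i.+1], and open
    sets belong to it. *)
Lemma closed_inner_regular (B : set M) : <<s @open M >> B -> forall eps : R, 0 < eps ->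
  exists C : set M, [/\ closed C, C `<=` B & (nu (phi @^-1` (B `\` C)) <= eps%:E)%E].
Proof.
move=> mB; suff [] : [/\ @measurable _ T B, inner B & inner (~` B)] by [].
move: B mB.
apply: (@smallest_sub _ _ _ [set B | [/\ @measurable _ T B, inner B & inner (~` B)]]).
  split => /=.
  - split; first exact: (@measurable0 _ T).
      by apply: inner_open; exact: open0.
    by rewrite setC0; apply: inner_open; exact: openT.
  - move=> A [mA iA iAc]; rewrite setTD; split; rewrite ?setCK//.
    exact: (@measurableC _ T).
  - move=> F FP; split.
    + by apply: (@bigcupT_measurable _ T) => i; have [] := FP i.
    + by apply: inner_bigcup => i; have [] := FP i.
    + rewrite setC_bigcup; apply: inner_bigcap => i; last by have [] := FP i.
      by apply: (@measurableC _ T); have [] := FP i.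
move=> O oO; split; first exact: sub_sigma_algebra.
  exact: inner_open.
move=> eps e0; exists (~` O); split => //; first exact: open_closedC.
by rewrite setDv preimage_set0 measure0 lee_fin ltW.
Qed.

(** Balls around a dense sequence cover the space, so finitely many miss only a small mass.
    Intersecting such finite covers over all radii yields a totally bounded set, the substitute for
    a compact set in [compact_code]. *)
Lemma tight_cover (e : nat -> M) (r eps : R) :
  (forall O : set M, O !=set0 -> open O -> exists n, O (e n)) -> 0 < r -> 0 < eps ->
  exists n, (nu (phi @^-1` ~` (\big[setU/set0]_(i < n) closure (ball (e i) r))) <= eps%:E)%E.
Proof.
move=> eP r0 eps0; pose F n := \big[setU/set0]_(i < n) closure (ball (e i) r).
have cF n : closed (F n) by apply: closed_bigsetU => i _; exact: closed_closure.
have ndF : {homo F : n m / (n <= m)%N >-> (n <= m)%O}.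
  by move=> n m nm; apply/subsetPset; exact: (@subset_bigsetU _ (fun i => closure (ball (e i) r)) n m).
have [n] := increasing_inner (@measurableT _ T) cF ndF (fun _ _ _ => I) eps0.
have -> : setT `\` \bigcup_n F n = set0.
  apply/seteqP; split => // x [_]; apply.
  have [||i xi] := eP (ball x r)°.
  - by exists x; exact: nbhsx_ballx.
  - exact: open_interior.
  exists i.+1 => //; rewrite /F big_ord_recr/=; right.
  by apply: subset_closure; apply: ball_sym; exact: interior_subset.
by rewrite preimage_set0 measure0 add0e setTD => H; exists n.
Qed.

End closed_regularity.

(* Up to a small loss, every countable family of measurable sets consists of
   the clopen sets of a compact topology: the code of [K] in [2 ^ nat] is
   closed. *)
Lemma compact_code {R : realType} d (S : measurableType d)
    (nu : {measure set S -> \bar R}) (A : nat -> set S) (E : set S) (eps : R) :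
  standard_borel R S -> (nu setT < +oo)%E -> (forall i, measurable (A i)) ->
  measurable E -> 0 < eps ->
  exists K : set S, [/\ measurable K, K `<=` E, (nu (E `\` K) <= eps%:E)%E &
    forall e : nat -> bool,
      (forall n, exists2 s, K s & forall i, (i < n)%N -> (s \in A i) = e i) ->
      exists2 s, K s & forall i, (s \in A i) = e i].
Proof.
move=> [M [phi [_ [D cD dD] iphi mphi borel_phi]]] nu_fin mA mE eps0.
have [q qP] := countable_dense_seq cD dD.
(* One third of [eps] for each loss: approximating [E], approximating all [A i] and their
   complements, and passing to finite covers at all radii. *)
have e30 : 0 < eps / 3 by rewrite divr_gt0.
have half i : 0 < eps / 3 / (2 ^ i.+1)%:R by rewrite divr_gt0// ltr0n expn_gt0.
have closed_meas (C : set M) : closed C -> measurable (phi @^-1` C).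
  move=> cC; rewrite -[C]setCK preimage_setC; apply: measurableC; apply: (mphi (~` C)).
  by apply: sub_sigma_algebra; exact: closed_openC.
have [C0 [cC0 C0E C0e]] := closed_inner_regular mphi nu_fin (borel_phi _ mE) e30.
have /choice[C1 C1P] i := closed_inner_regular mphi nu_fin (borel_phi _ (mA i))
  (divr_gt0 (half i) (ltr0n _ 2)).
have /choice[C2 C2P] i := closed_inner_regular mphi nu_fin
  (borel_phi _ (measurableC (mA i))) (divr_gt0 (half i) (ltr0n _ 2)).
have inv0 k : 0 < k.+1%:R^-1 :> R by rewrite invr_gt0.
have /choice[N NP] k := tight_cover mphi nu_fin qP (inv0 k) (half k).
pose F k := \big[setU/set0]_(i < N k) closure (ball (q i) (k.+1%:R^-1 : R)).
have cF k : closed (F k) by apply: closed_bigsetU => i _; exact: closed_closure.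
have cC1 i : closed (C1 i) by have [] := C1P i.
have cC2 i : closed (C2 i) by have [] := C2P i.
have cC12 i : closed (C1 i `|` C2 i) by exact: closedU.
(* Over [KM] membership in [A i] is decided by the closed sets [C1 i] and [C2 i], so prescribing
   finitely many bits is a closed condition; the covers [F k] make [KM] totally bounded. *)
pose KM := C0 `&` ((\bigcap_i (C1 i `|` C2 i)) `&` \bigcap_k F k).
have cKM : closed KM.
  by apply: closedI => //; apply: closedI; exact: closed_bigI.
have img (B : set S) s : (phi @` B) (phi s) -> B s.
  by move=> [s' Bs' /iphi <-].
exists (phi @^-1` KM); split.
- exact: closed_meas.
- by move=> s [/C0E /img].
- pose L0 := phi @^-1` (phi @` E `\` C0).
  pose L1 i := phi @^-1` (phi @` A i `\` C1 i) `|` phi @^-1` (phi @` (~` A i) `\` C2 i).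
  pose L2 k := phi @^-1` (~` F k).
  have mpi (B : set S) : measurable B -> measurable (phi @^-1` (phi @` B)).
    by move=> mB; apply: mphi; exact: borel_phi.
  have mD (B : set S) (C : set M) : measurable B -> closed C ->
      measurable (phi @^-1` (phi @` B `\` C)).
    by move=> mB cC; apply: measurableD; [exact: mpi|exact: closed_meas].
  have mL0 : measurable L0 by exact: mD.
  have mL1 i : measurable (L1 i).
    by apply: measurableU; apply: mD => //; exact: measurableC.
  have mL2 k : measurable (L2 k) by apply: measurableC; exact: closed_meas.
  have L1e i : (nu (L1 i) <= (eps / 3 / (2 ^ i.+1)%:R)%:E)%E.
    apply: le_trans (measureU2 _ _ _) _; [by apply: mD|by apply: mD => //; exact: measurableC|].
    rewrite [in leRHS](splitr (eps / 3 / _)) EFinD leeD//.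
      by have [] := C1P i.
    by have [] := C2P i.
  have mU1 : measurable (\bigcup_i L1 i) by exact: bigcupT_measurable.
  have mU2 : measurable (\bigcup_i L2 i) by exact: bigcupT_measurable.
  have sub : E `\` phi @^-1` KM `<=` L0 `|` (\bigcup_i L1 i `|` \bigcup_k L2 k).
    move=> s [Es nK]; apply: contrapT => nL; apply: nK.
    have [L0s|] := pselect (C0 (phi s)); last 
      by move=> nC0; exfalso; apply: nL; left; split => //; exists s.
    split => //; split.
      move=> i _; apply: contrapT => nC; apply: nL; right; left; exists i => //.
      have [As|nAs] := pselect (A i s).
        by left; split; [exists s|move=> ?; apply: nC; left].
      by right; split; [exists s|move=> ?; apply: nC; right].
    by move=> k _; apply: contrapT => nF; apply: nL; right; right; exists k.
  apply: (@le_trans _ _ (nu (L0 `|` (\bigcup_i L1 i `|` \bigcup_k L2 k)))).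
    rewrite le_measure ?inE//; last by do 2?apply: measurableU.
    by apply: measurableD => //; exact: closed_meas.
  apply: le_trans (measureU2 _ mL0 (measurableU _ _ mU1 mU2)) _.
  have -> : eps%:E = ((eps / 3)%:E + ((eps / 3)%:E + (eps / 3)%:E))%E.
    by rewrite -!EFinD; congr EFin; field.
  apply: leeD => //; apply: le_trans (measureU2 _ mU1 mU2) _; apply: leeD.
    exact: measure_bigcup_small (ltW e30) mL1 L1e.
  exact: measure_bigcup_small (ltW e30) mL2 NP.
move=> e He.
pose Ne n := [set m | KM m /\ forall i, (i < n)%N -> (if e i then C1 i else C2 i) m].
have Ne0 n : Ne n !=set0.
  have [s [K0 [K1 K2]] se] := He n; exists (phi s); split => // i /se.
  have := K1 i I; case: (e i) => -[] // c sA.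
    have [_ C2A _] := C2P i; have /img nA := C2A _ c.
    by have := nA (set_mem sA).
  have [_ C1A _] := C1P i; have /img As := C1A _ c.
  by move: sA; rewrite mem_set.
have cNe n : closed (Ne n).
  apply: closedI => //.
  apply: (@closed_bigI _ _ `I_n (fun i => if e i then C1 i else C2 i)) => i _.
  by case: (e i).
have FNe : ProperFilter (filter_from setT Ne).
  apply: filter_from_proper; last by move=> n _; exact: Ne0.
  apply: filter_from_filter; first by exists 0%N.
  move=> n m _ _; exists (maxn n m) => // z [Kz zi]; split; split => // i im.
    by apply: zi; rewrite leq_max im.
  by apply: zi; rewrite leq_max im orbT.
have [U [UU NU]] := ultraFilterLemma FNe.
have UNe n : U (Ne n) by apply: NU; exists n.
(* For every radius the cover [F k] is finite, so the ultrafilter contains one of its closed balls;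
   it is Cauchy and converges by completeness. The limit lies in every closed [Ne n], hence has the
   whole code [e]. *)
have : cvg U.
  apply: cauchy_cvg; apply/cauchy_exP => r r0.
  have [k kr] : exists k : nat, 2 * k.+1%:R^-1 < r.
    have [k] := @ltr_add_invr R 0 (r / 2) (divr_gt0 r0 (ltr0n _ 2)).
    by rewrite add0r => kr; exists k; rewrite -ltr_pdivlMl// mulrC.
  have UF : U (F k) by apply: filterS (UNe 0%N) => z [[_ [_ Fz]] _]; exact: Fz.
  have : exists i, U (closure (ball (q i) (k.+1%:R^-1 : R))).
    move: UF; rewrite /F; elim: (N k) => [|n IH].
      by rewrite big_ord0 => U0; have [] := filter_ex U0.
    rewrite big_ord_recr/= => UF.
    have [Uc|nUc] := in_ultra_setVsetC (closure (ball (q n) (k.+1%:R^-1 : R))) UU.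
      by exists n.
    by apply: IH; apply: filterS (filterI UF nUc) => z [[]].
  move=> [i Ui]; exists (q i); apply: filterS Ui => z.
  have k0 : 0 < k.+1%:R^-1 :> R by rewrite invr_gt0.
  move=> /(_ (ball z (k.+1%:R^-1 : R)) (nbhsx_ballx _ _ k0)) [w [qw zw]].
  apply: (@le_ball _ _ _ (k.+1%:R^-1 + k.+1%:R^-1)).
    by apply: ltW; move: kr; move: (k.+1%:R^-1 : R) => t; lra.
  exact: ball_triangle qw (ball_sym zw).
move=> /cvg_ex [m Um].
have mNe n : Ne n m.
  apply: cNe => B mB; have [z [zB zN]] := filter_ex (filterI (Um _ mB) (UNe n)).
  by exists z.
have [s Es sm] : (phi @` E) m by apply: C0E; have [[]] := mNe 0%N.
exists s; first by rewrite /preimage/= sm; have [] := mNe 0%N.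
move=> i; have [_ /(_ i (ltnSn i))] := mNe i.+1; rewrite -sm; case: (e i) => mC.
  by have [_ C1A _] := C1P i; rewrite mem_set//; apply: (img (A i)); exact: C1A.
by have [_ C2A _] := C2P i; rewrite memNset//; apply: (img (~` A i)); exact: C2A.
Qed.

(** The generators are preimages of balls with rational-type radii around a dense sequence; by
    injectivity each measurable set is the preimage of its Borel image. *)
Lemma standard_borel_countably_generated {R : realType} d (S : measurableType d) :
  standard_borel R S -> exists B : nat -> set S,
    (forall i, measurable (B i)) /\ (@measurable _ S `<=` <<s range B >>).
Proof.
move=> [M [phi [_ [D cD dD] iphi mphi borel_phi]]].
have [q qP] := countable_dense_seq cD dD.
pose W (w : nat * nat) : set S := phi @^-1` (ball (q w.1) (w.2.+1%:R^-1 : R))°.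
exists (fun i => W (odflt (0%N, 0%N) (unpickle i))); split.
  by move=> i; apply: mphi; apply: sub_sigma_algebra; exact: open_interior.
pose G := range (fun i : nat => W (odflt (0%N, 0%N) (unpickle i))).
rewrite -/G.
have WG w : <<s G >> (W w).
  by apply: sub_sigma_algebra; exists (pickle w) => //; rewrite pickleK.
pose T := g_sigma_algebraType G.
suff H (B : set M) : <<s @open M >> B -> @measurable _ T (phi @^-1` B).
  move=> A mA; have := H _ (borel_phi _ mA).
  rewrite (_ : phi @^-1` (phi @` A) = A)//.
  by apply/seteqP; split => [s [s' As' /iphi <-]//|s As]; exists s.
apply: (@smallest_sub _ _ _ [set B | @measurable _ T (phi @^-1` B)]).
  split => /=.
  - by rewrite preimage_set0; exact: (@measurable0 _ T).
  - by move=> A mA; rewrite setTD preimage_setC; exact: (@measurableC _ T).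
  - by move=> F mF; rewrite preimage_bigcup; exact: (@bigcupT_measurable _ T).
move=> O oO /=.
have -> : phi @^-1` O = \bigcup_(w in [set w | W w `<=` phi @^-1` O]) W w.
  apply/seteqP; split => [s Os|s [w wO ws]]; last exact: wO.
  have /nbhs_ballP [e /= e0 eO] : nbhs (phi s) O by exact: open_nbhs_nbhs.
  have [n] := @ltr_add_invr R 0 (e / 2) (divr_gt0 e0 (ltr0n _ 2)).
  rewrite add0r => ne.
  have n0 : 0 < n.+1%:R^-1 :> R by rewrite invr_gt0.
  have [||i iz] := qP (ball (phi s) (n.+1%:R^-1 / 2))°.
  - by exists (phi s); apply: nbhsx_ballx; rewrite divr_gt0.
  - exact: open_interior.
  have {}iz := interior_subset iz.
  exists (i, n) => /=.
    move=> z /interior_subset /= qz; apply: eO.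
    have re : n.+1%:R^-1 / 2 + n.+1%:R^-1 <= e.
      by move: n0 ne; move: (n.+1%:R^-1 : R) => r; lra.
    by apply: (@le_ball _ _ _ _ _ re); exact: ball_triangle iz qz.
  apply/nbhs_ballP; exists (n.+1%:R^-1 / 2) => /=; first by rewrite divr_gt0.
  by move=> y zy; rewrite [n.+1%:R^-1]splitr; apply: ball_triangle zy; exact: ball_sym.
rewrite bigcup_mkcond; apply: countable_bigcupT_measurable => // w.
by case: ifP => _ //; exact: WG.
Qed.

(** * Codes of points and measurable selection of a point with a given code *)

Section patterns_of_sets.
Context d (S : measurableType d) (C : nat -> set S).
Hypothesis mC : forall i, measurable (C i).

Definition atom N (e : nat -> bool) : set S :=
  [set s | forall i, (i < N)%N -> (s \in C i) = e i].

Definition local N (T : (nat -> bool) -> Prop) :=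
  forall e e', (forall i, (i < N)%N -> e i = e' i) -> T e -> T e'.

Definition ext_pattern N (e : {ffun 'I_N -> bool}) (i : nat) : bool :=
  if insub i is Some j then e j else false.

Lemma measurable_atom N e : measurable (atom N e).
Proof.
rewrite (_ : atom N e = \bigcap_(i in `I_N) (if e i then C i else ~` C i)).
  apply: fin_bigcap_measurable => // i _.
  by case: (e i) => //; exact: measurableC.
apply/seteqP; split => [s se i /= iN|s se i iN].
  have := se _ iN; case: (e i); first by move/set_mem.
  by move=> /negbT/negP nC Cs; apply: nC; exact: mem_set.
by have := se _ iN; case: (e i) => H; [exact: mem_set|exact: memNset].
Qed.

Lemma local_bigcup N T : local N T ->
  [set s | T (fun i => s \in C i)] =
  \bigcup_(e in [set e : {ffun 'I_N -> bool} | T (ext_pattern e)]) atom N (ext_pattern e).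
Proof.
move=> lT; apply/seteqP; split => [s Ts|s [e Te se]]; last first.
  by apply: lT Te => i iN; rewrite se.
have E i : (i < N)%N -> ext_pattern [ffun j : 'I_N => s \in C j] i = (s \in C i).
  by move=> iN; rewrite /ext_pattern insubT ffunE.
exists [ffun j : 'I_N => s \in C j]; last by move=> i iN; rewrite E.
by apply: lT Ts => i iN; rewrite E.
Qed.

Lemma trivIset_atom N D : trivIset D (fun e : {ffun 'I_N -> bool} => atom N (ext_pattern e)).
Proof.
move=> e e' _ _ [s [se se']]; apply/ffunP => j.
have := se _ (ltn_ord j); rewrite se' ?ltn_ord// /ext_pattern.
by rewrite insubT ?ltn_ord//= => jN; rewrite (_ : Sub _ _ = j)//; exact: val_inj.
Qed.

Lemma measurable_local N T : local N T -> measurable [set s | T (fun i => s \in C i)].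
Proof.
move=> lT; rewrite (local_bigcup lT); apply: fin_bigcup_measurable => // e _.
exact: measurable_atom.
Qed.

End patterns_of_sets.

(** A condition on the first [N] bits is a finite disjoint union of cylinders [atom]. *)
Lemma same_measure_local {R : realType} d (S : measurableType d) d' (S' : measurableType d')
    (mu : {measure set S -> \bar R}) (nu : {measure set S' -> \bar R})
    (C : nat -> set S) (C' : nat -> set S') :
  (forall i, measurable (C i)) -> (forall i, measurable (C' i)) ->
  (forall N e, mu (atom C N e) = nu (atom C' N e)) ->
  forall N T, local N T ->
  mu [set s | T (fun i => s \in C i)] = nu [set s | T (fun i => s \in C' i)].
Proof.
move=> mC mC' same N T lT; rewrite !(local_bigcup _ lT).
rewrite !measure_fin_bigcup//; first by apply: eq_fsbigr => e _; exact: same.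
- exact: finite_finset.
- exact: trivIset_atom.
- by move=> e _; exact: measurable_atom.
- exact: finite_finset.
- exact: trivIset_atom.
- by move=> e _; exact: measurable_atom.
Qed.

Section measurable_selection.
Context {R : realType} d (S : measurableType d) d' (S' : measurableType d').
Variables (C : nat -> set S) (C' B : nat -> set S') (K : set S').
Hypothesis mC : forall i, measurable (C i).

(* [s] is compatible with the prefix [l] of a code with respect to [B] when
   finitely many values of the codes never rule out a common point of [K]. *)
Definition compatible (l : seq bool) (s : S) : Prop := forall N, exists2 s', K s' &
  (forall i, (i < N)%N -> (s' \in C' i) = (s \in C i)) /\
  (forall i, (i < size l)%N -> (s' \in B i) = nth false l i).

(** At each level [N] the existence of [s'] depends on only [N] bits of the code of [s]. The set is
    thus a countable intersection of finite unions of cylinders, and no projection of a measurable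
    set has to be measured. *)
Lemma measurable_compatible l : measurable [set s | compatible l s].
Proof.
pose T N (e : nat -> bool) := exists2 s', K s' &
  (forall i, (i < N)%N -> (s' \in C' i) = e i) /\
  (forall i, (i < size l)%N -> (s' \in B i) = nth false l i).
rewrite (_ : [set s | _] = \bigcap_N [set s | T N (fun i => s \in C i)]).
  apply: bigcapT_measurable => N; apply: (measurable_local mC (N := N)).
  by move=> e e' ee' [s' Ks' [se sl]]; exists s' => //; split => // i iN; rewrite se// ee'.
by apply/seteqP; split => [s cs N _|s cs N]; [exact: cs|exact: cs N I].
Qed.

(** If the two extensions failed at levels [N1] and [N2], the point found at the larger level would
    realize one of them. *)
Lemma compatible_rcons l s : compatible l s ->
  compatible (rcons l false) s \/ compatible (rcons l true) s.
Proof.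
move=> cl; apply: contrapT => /not_orP[/existsNP[N1 n1] /existsNP[N2 n2]].
have [s' Ks' [sC sl]] := cl (maxn N1 N2).
have ext b : (s' \in B (size l)) = b -> forall i, (i < size (rcons l b))%N ->
    (s' \in B i) = nth false (rcons l b) i.
  move=> sb i; rewrite size_rcons ltnS leq_eqVlt nth_rcons => /predU1P[->|il].
    by rewrite ltnn eqxx.
  by rewrite il sl.
case sB : (s' \in B (size l)).
  apply: n2; exists s' => //; split; last exact: ext.
  by move=> i iN; apply: sC; rewrite leq_max iN orbT.
apply: n1; exists s' => //; split; last exact: ext.
by move=> i iN; apply: sC; rewrite leq_max iN.
Qed.

(** The lexicographically least compatible code over [B]: the next bit is [false] whenever this is
    compatible. Such a canonical choice is what makes the selected point depend measurably on
    [s]. *)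
Fixpoint least_prefix n (s : S) : seq bool :=
  if n is n'.+1 then
    let l := least_prefix n' s in rcons l (~~ `[< compatible (rcons l false) s >])
  else [::].

Lemma size_least_prefix n s : size (least_prefix n s) = n.
Proof. by elim: n => //= n IH; rewrite size_rcons IH. Qed.

Lemma least_prefix_compatible n s : compatible [::] s -> compatible (least_prefix n s) s.
Proof.
move=> c0; elim: n => //= n /compatible_rcons.
by case: asboolP => [//|nc [/nc|]].
Qed.

Lemma nth_least_prefix n m i s : (i < n)%N -> (n <= m)%N ->
  nth false (least_prefix m s) i = nth false (least_prefix n s) i.
Proof.
move=> il; elim: m => [|m IH]; first by rewrite leqn0 => /eqP n0; rewrite n0 in il.
rewrite leq_eqVlt => /predU1P[->//|nm].
by rewrite /= nth_rcons size_least_prefix (leq_trans il nm) IH.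
Qed.

Lemma measurable_least_prefix n l : measurable [set s | least_prefix n s = l].
Proof.
elim: n l => [|n IH] l /=.
  by have [<-|nl] := eqVneq [::] l;
    [rewrite (_ : [set s | _] = setT)//; apply/seteqP; split
    |rewrite (_ : [set s | _] = set0)//; apply/seteqP; split => // s /= /eqP; rewrite (negbTE nl)].
case/lastP: l => [|l b].
  rewrite (_ : [set s | _] = set0)//; apply/seteqP; split => // s /= /(congr1 size).
  by rewrite size_rcons.
rewrite (_ : [set s | _] = [set s | least_prefix n s = l] `&`
    (if b then ~` [set s | compatible (rcons l false) s] 
     else [set s | compatible (rcons l false) s])).
  apply: measurableI => //.
  by case: b; [apply: measurableC|]; exact: measurable_compatible.
apply/seteqP; split => s /=.
  by move=> /rcons_inj[-> <-]; split => //; case: asboolP.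
by move=> [->]; case: b => /=; case: asboolP.
Qed.

End measurable_selection.

(** [P] collects the points whose code is compatible with [K]. The closedness of codes in
    [compact_code] turns compatibility at all finite levels into a point of [K] with the full code,
    and the least code over a generating sequence [B] singles out one measurably. *)
Lemma measurable_matching {R : realType} d (S : measurableType d) d' (S' : measurableType d')
    (mu : {measure set S -> \bar R}) (nu : {measure set S' -> \bar R})
    (C : nat -> set S) (C' : nat -> set S') (E' : set S') (eps : R) :
  standard_borel R S' -> (nu setT < +oo)%E ->
  (forall i, measurable (C i)) -> (forall i, measurable (C' i)) ->
  (forall N e, mu (atom C N e) = nu (atom C' N e)) ->
  measurable E' -> nu (~` E') = 0%E -> 0 < eps ->
  exists (P : set S) (Phi : S -> S'),
    [/\ measurable P, (mu (~` P) <= eps%:E)%E, measurable_fun P Phi &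
      forall s, P s -> E' (Phi s) /\ forall i, (Phi s \in C' i) = (s \in C i)].
Proof.
move=> sb nu_fin mC mC' same mE' nE' eps0.
have [B [mB Bgen]] := standard_borel_countably_generated sb.
(* Even indices carry the code to be matched, odd ones the generators [B], so that one compactness
   argument realizes both. *)
pose A i := if odd i then B i./2 else C' i./2.
have mA i : measurable (A i) by rewrite /A; case: ifP.
have [K [mK KE Keps Kcode]] := compact_code sb nu_fin mA mE' eps0.
pose P := [set s | compatible C C' B K [::] s].
have mP : measurable P by exact: measurable_compatible.
have PPhi s : P s -> exists2 s', K s' & (forall i, (s' \in C' i) = (s \in C i)) /\
    forall i, (s' \in B i) = nth false (least_prefix C C' B K i.+1 s) i.
  move=> Ps.
  have [n|s' Ks' sA] := Kcode (fun i => if odd i then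
      nth false (least_prefix C C' B K i./2.+1 s) i./2 else s \in C i./2).
    have [s' Ks' [sC sB]] := least_prefix_compatible n Ps n.
    exists s' => // i iN.
    have hn : (i./2 < n)%N.
      by apply: leq_ltn_trans iN; rewrite -[leqRHS]odd_double_half -addnn addnA leq_addl.
    rewrite /A; case: ifP => oi; last by rewrite sC.
    by rewrite sB ?size_least_prefix//; exact: nth_least_prefix.
  exists s' => //; split => i.
    by have := sA i.*2; rewrite /A odd_double doubleK.
  by have := sA i.*2.+1; rewrite /A /= odd_double/= uphalf_double.
have /choice[Phi PhiP] s : exists s', P s -> K s' /\ (forall i, (s' \in C' i) = (s \in C i)) /\
    forall i, (s' \in B i) = nth false (least_prefix C C' B K i.+1 s) i.
  have [Ps|nPs] := pselect (P s); last by exists point.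
  by have [s' Ks' H] := PPhi s Ps; exists s'.
exists P, Phi; split => //.
(* Incompatibility shows at a finite level [N], as a condition on [N] bits. Equality on atoms
   transfers its measure to [S'], where no point of [K] satisfies it; hence it is at most the mass
   outside [K], uniformly in [N]. *)
- pose T N (e : nat -> bool) := exists2 s', K s' & forall i, (i < N)%N -> (s' \in C' i) = e i.
  have lT N : local N (T N).
    by move=> e e' ee' [s' Ks' se]; exists s' => // i iN; rewrite se// ee'.
  have lTc N : local N (fun e => ~ T N e).
    by move=> e e' ee' nT Te'; apply: nT; apply: lT Te' => i iN; rewrite ee'.
  pose F N := [set s | ~ T N (fun i => s \in C i)].
  have mF N : measurable (F N) by exact: (measurable_local mC (lTc N)).
  have FE : ~` P = \bigcup_N F N.
    apply/seteqP; split => [s nP|s [N _ nT] Ps].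
      apply: contrapT => nF; apply: nP => N.
      apply: contrapT => nT; apply: nF; exists N => // -[s' Ks' sC]; apply: nT.
      by exists s'.
    by apply: nT; have [s' Ks' [sC _]] := Ps N; exists s'.
  have Feps N : (mu (F N) <= eps%:E)%E.
    rewrite (same_measure_local mC mC' same (lTc N)).
    have KE0 : (nu (~` K) <= eps%:E)%E.
      apply: (@le_trans _ _ (nu ((E' `\` K) `|` ~` E'))).
        rewrite le_measure ?inE//; first exact: measurableC.
          by apply: measurableU; [exact: measurableD|exact: measurableC].
        by move=> s nK; have [Es|nEs] := pselect (E' s); [left|right].
      apply: le_trans (measureU2 _ _ _) _; [exact: measurableD|exact: measurableC|].
      by rewrite [X in (_ + X)%E]nE' adde0.
    apply: le_trans KE0; rewrite le_measure ?inE//.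
    - exact: (measurable_local mC' (lTc N)).
    - exact: measurableC.
    - by move=> s nT Ks; apply: nT; exists s.
  rewrite FE; have ndF : {homo F : n m / (n <= m)%N >-> (n <= m)%O}.
    move=> n m nm; apply/subsetPset => s nT [s' Ks' sC]; apply: nT; exists s' => // i iN.
    by apply: sC; exact: leq_trans nm.
  have H := nondecreasing_cvg_mu (mu := mu) mF (bigcupT_measurable _ mF) ndF.
  by rewrite -(cvg_lim _ H)//; apply: lime_le; [apply/cvg_ex; eexists; exact: H|exact: nearW].
(* It suffices to treat the generators [B i], whose preimage is read off from bit [i] of the least
   prefix of length [i.+1]. *)
- pose G := [set D | measurable (P `&` Phi @^-1` D)].
  suff H : @measurable _ S' `<=` G by move=> _ D mD; exact: H.
  apply: (subset_trans Bgen); apply: smallest_sub.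
    split => /=.
    + by rewrite /G /= preimage_set0 setI0.
    + move=> D mD; rewrite /G /= setTD preimage_setC -setDE.
      rewrite (_ : P `\` _ = P `\` (P `&` Phi @^-1` D)); first exact: measurableD.
      by apply/seteqP; split => [s [Ps nD]|s [Ps nD]]; split => //;
        [move=> []|move=> D1; apply: nD].
    + by move=> D mD; rewrite /G /= preimage_bigcup setI_bigcupr; exact: bigcupT_measurable.
  move=> _ [i _ <-]; rewrite /G /=.
  rewrite (_ : _ `&` _ = P `&` [set s | nth false (least_prefix C C' B K i.+1 s) i]).
    apply: measurableI => //.
    rewrite (_ : [set s | _] = \bigcup_(l in [set l : i.+1.-tuple bool | nth false l i])
        [set s | least_prefix C C' B K i.+1 s = l]).
      apply: fin_bigcup_measurable; first exact: finite_finset.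
      by move=> l _; exact: measurable_least_prefix.
    apply/seteqP; split => [s /= si|s [l /= li sl]]; last by rewrite /= sl.
    by exists (Tuple (introT eqP (size_least_prefix C C' B K i.+1 s))).
  apply/seteqP; split => s [Ps Bs]; have [_ [_ /(_ i) sB]] := PhiP s Ps; split => //.
    by have : Phi s \in B i := mem_set (Bs : B i (Phi s)); rewrite sB.
  have H : Phi s \in B i by rewrite sB.
  exact: set_mem H.
- move=> s Ps; have [Ks [sC _]] := PhiP s Ps; split => //.
  exact: KE.
Qed.

(** * Matching up to scaling *)

Lemma weighted_measure {R : realType} d (S : measurableType d)
    (m : {measure set S -> \bar R}) (f : S -> \bar R) :
  measurable_fun setT f -> (forall s, 0 <= f s)%E ->
  exists nu : {measure set S -> \bar R}, forall A, nu A = (\int[m]_(s in A) f s)%E.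
Proof.
move=> mf f0; pose w A := (\int[m]_(s in A) f s)%E.
have w0 : w set0 = 0%E by rewrite /w integral_set0.
have wge0 A : (0 <= w A)%E by exact: integral_ge0.
have wadd := semi_sigma_additive_nng_induced (mu := m) mf f0.
pose nu : {measure set S -> \bar R} :=
  HB.pack w (isMeasure.Build _ _ _ w w0 wge0 wadd).
by exists nu.
Qed.

Lemma weighted_eq0 {R : realType} d (S : measurableType d)
    (m : {measure set S -> \bar R}) (f : S -> \bar R) A :
  measurable A -> measurable_fun setT f -> (forall s, A s -> 0 < f s)%E ->
  (\int[m]_(s in A) f s = 0)%E -> m A = 0%E.
Proof.
move=> mA mf f0 I0.
have /(ae_eq_integral_abs m mA (measurable_funTS mf)) [N [mN N0 sub]] :
    (\int[m]_(s in A) `|f s| = 0)%E.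
  rewrite -I0; apply: eq_integral => s /set_mem As.
  by rewrite gee0_abs// (ltW (f0 _ As)).
apply: (subset_measure0 mA mN _ N0) => s As; apply: sub => /= /(_ As) fs0.
by have := f0 _ As; rewrite fs0 ltxx.
Qed.

(** [(a - r * b) * b < 0] means [a / b < r], so equal answers for all rational [r] force
    [a / b = a' / b']. *)
Lemma ratio_eq {R : realType} (a b a' b' : R) : b != 0 -> b' != 0 ->
  (forall r : rat, ((a - ratr r * b) * b < 0) = ((a' - ratr r * b') * b' < 0)) ->
  a = b / b' * a'.
Proof.
move=> b0 b'0 cut.
have E (u v r : R) : v != 0 -> ((u - r * v) * v < 0) = (u / v < r).
  move=> v0; have v2 : 0 < v ^+ 2 by rewrite exprn_even_gt0.
  rewrite (_ : (u - r * v) * v = (u / v - r) * v ^+ 2); last by field.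
  by rewrite pmulr_llt0// subr_lt0.
suff : a / b = a' / b' by move=> ab; rewrite -mulrA (mulrC _ a') -ab mulrC divfK.
apply/eqP; rewrite eq_le; apply/andP; split; rewrite leNgt; apply/negP => /rat_in_itvoo[r];
  rewrite in_itv/= => /andP[ltr gtr]; have := cut r; rewrite !E//.
  by rewrite ltr => /lt_trans-/(_ _ gtr); rewrite ltxx.
by rewrite ltr => /esym /lt_trans-/(_ _ gtr); rewrite ltxx.
Qed.

Section matching_up_to_scaling.
Context {R : realType} (alpha : R).
Hypothesis halpha : 1 < alpha < 2.

Definition rational_cut (n : nat) : nat * rat := odflt (0%N, 0) (unpickle n).

(** Where [y k != 0], negativity of the product says that the ratio of coordinate [jr.1] to
    coordinate [k] is below the rational [jr.2]. These cuts over all coordinates and rationals are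
    the bits of the code. *)
Definition cut_form k n : (nat -> R) * (nat -> R) :=
  let jr := rational_cut n in
  (fun i => coord jr.1 i + - ratr jr.2 * coord k i, coord k).

Definition cut_set S (x : nat -> S -> R) k n : set S :=
  let jr := rational_cut n in
  [set s | (x jr.1 s - ratr jr.2 * x k s) * x k s < 0].

Lemma mem_cut_set S (x : nat -> S -> R) k n s : (s \in cut_set x k n) =
  ((x (rational_cut n).1 s - ratr (rational_cut n).2 * x k s) * x k s < 0).
Proof. by apply/idP/idP => [/set_mem//|?]; rewrite inE. Qed.

Lemma neg_cut_form N S (x : nat -> S -> R) k n s : (k < N)%N ->
  ((rational_cut n).1 < N)%N ->
  neg_form N (cut_form k n) (x^~ s) = (s \in cut_set x k n).
Proof.
by move=> *; rewrite mem_cut_set /neg_form /cut_form /= lformD !lform_coord// mulNr.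
Qed.

Lemma pattern_atom N n d (S : measurableType d) (x : nat -> S -> R) k e s : (k < N)%N ->
  (forall i, (i < n)%N -> ((rational_cut i).1 < N)%N) ->
  pattern N [seq (cut_form k i, e i) | i <- iota 0 n] (x^~ s) =
    (s \in atom (cut_set x k) n e)%:R.
Proof.
move=> kN jN; rewrite /pattern big_map.
have [/set_mem sA|/negP sA] := boolP (s \in _).
  rewrite big1_seq// => i /=; rewrite mem_iota add0n => iN.
  by rewrite neg_cut_form ?jN// sA// eqxx.
have [i iN /eqP ei] : exists2 i, (i < n)%N & (s \in cut_set x k i) <> e i.
  apply: contrapT => H; apply: sA; rewrite inE => i iN.
  by apply: contrapT => ei; apply: H; exists i.
rewrite (bigD1_seq i) ?mem_iota ?iota_uniq//= neg_cut_form ?jN//.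
by rewrite (negbTE ei) mul0r.
Qed.

Section two_spaces.
Context d (S : measurableType d) (m : {sigma_finite_measure set S -> \bar R}).
Context d' (S' : measurableType d') (m' : {sigma_finite_measure set S' -> \bar R}).
Variables (x : nat -> S -> R) (x' : nat -> S' -> R).
Hypothesis mx : forall j, measurable_fun setT (x j).
Hypothesis mx' : forall j, measurable_fun setT (x' j).
Hypothesis fin_norm : forall N (a : nat -> R),
  (\int[m]_s (`|lform N a (x^~ s)| `^ alpha)%:E < +oo)%E.
Hypothesis same_norm : forall N (a : nat -> R),
  (\int[m]_s (`|lform N a (x^~ s)| `^ alpha)%:E =
   \int[m']_s (`|lform N a (x'^~ s)| `^ alpha)%:E)%E.

Let weight_atom e (T : measurableType e) (mu : {measure set T -> \bar R}) (y : nat -> T -> R)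
    N n k b : (k < N)%N ->
  (forall i, (i < n)%N -> ((rational_cut i).1 < N)%N) ->
  (\int[mu]_(s in atom (cut_set y k) n b) (`|y k s| `^ alpha)%:E =
   \int[mu]_s (pattern N [seq (cut_form k i, b i) | i <- iota 0 n] (y^~ s) *
     `|y k s| `^ alpha)%:E)%E.
Proof.
move=> kN jN; rewrite integral_mkcond; apply: eq_integral => s _.
by rewrite pattern_atom// patchE; case: ifP => _; rewrite ?mul1r ?mul0r.
Qed.

Let measurable_cut_set e (T : measurableType e) (y : nat -> T -> R) k n :
  (forall j, measurable_fun setT (y j)) -> measurable (cut_set y k n).
Proof.
move=> my; rewrite /cut_set; case: (rational_cut n) => j r /=.
pose f t := (y j t - ratr r * y k t) * y k t.
rewrite (_ : [set s | _] = setT `&` f @^-1` `]-oo, 0[); last first.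
  by rewrite setTI; apply/seteqP; split => t; rewrite /= in_itv.
have mf : measurable_fun setT f.
  apply: measurable_funM => //; apply: measurable_funB => //.
  exact: measurable_funM.
exact: mf.
Qed.

(** Under the weights [|x k|^alpha] and [|x' k|^alpha] the codes by rational cuts have the same law,
    by [same_pattern]. Matching with losses [n.+1^-1] for all [n] leaves out a null part of
    [x k != 0], and equal codes mean equal ratios to coordinate [k]. *)
Lemma matching_up_to_scaling k (E' : set S') : standard_borel R S' -> measurable E' ->
  m' (~` E' `&` [set s | x' k s != 0]) = 0%E ->
  exists (P : nat -> set S) (Phi : nat -> S -> S'),
    [/\ forall j, measurable (P j) /\ measurable_fun (P j) (Phi j),
        m ([set s | x k s != 0] `\` \bigcup_j P j) = 0%E &
        forall j s, P j s -> [/\ E' (Phi j s), x k s != 0, x' k (Phi j s) != 0 &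
          forall i, x i s = x k s / x' k (Phi j s) * x' i (Phi j s)]].
Proof.
move=> sb mE' nE'.
have mw e (T : measurableType e) (y : nat -> T -> R) : (forall j, measurable_fun setT (y j)) ->
    measurable_fun setT (fun s => (`|y k s| `^ alpha)%:E).
  by move=> my; apply/measurable_EFinP; exact: measurable_abs_powR.
have w0 e (T : measurableType e) (y : nat -> T -> R) (s : T) :
  (0 <= (`|y k s| `^ alpha)%:E)%E by rewrite lee_fin powR_ge0.
have mnz e (T : measurableType e) (y : nat -> T -> R) : (forall j, measurable_fun setT (y j)) ->
    measurable [set s | y k s != 0].
  move=> my; rewrite (_ : [set s | _] = y k @^-1` (~` [set 0])); last first.
    by apply/seteqP; split => s /= /eqP.
  by rewrite -[X in measurable X]setTI; apply: my => //; exact: measurableC.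
have [mu muE] := weighted_measure m (mw _ _ _ mx) (w0 _ _ x).
have [nu nuE] := weighted_measure m' (mw _ _ _ mx') (w0 _ _ x').
have nu_fin : (nu setT < +oo)%E.
  rewrite nuE; have := @fin_norm k.+1 (coord k); rewrite same_norm.
  rewrite (_ : (fun s => _) = fun s => (`|x' k s| `^ alpha)%:E)//.
  by apply/funext => s; rewrite lform_coord.
have same N b : mu (atom (cut_set x k) N b) = nu (atom (cut_set x' k) N b).
  pose J i := (rational_cut i).1.
  (* Large enough for [k] and every coordinate occurring in the first [N] cuts. *)
  pose N0 := (maxn k (\max_(i < N) J i)).+1.
  have kN : (k < N0)%N by rewrite ltnS leq_maxl.
  have jN i : (i < N)%N -> (J i < N0)%N.
    by move=> iN; rewrite ltnS leq_max (leq_bigmax (Ordinal iN) (F := fun i : 'I_N => J i)) orbT.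
  rewrite muE nuE (weight_atom m x b kN jN) (weight_atom m' x' b kN jN).
  exact: (same_pattern halpha mx mx' (@fin_norm N0) (@same_norm N0)).
(* The weight vanishes where [x' k] does, so the target set may also be restricted to [x' k != 0],
   where the ratios make sense. *)
have nuE' : nu (~` (E' `&` [set s | x' k s != 0])) = 0%E.
  have mC : measurable (~` E' `&` [set s | x' k s != 0]).
    by apply: measurableI => //; [exact: measurableC|exact: mnz].
  have mC0 : measurable (~` [set s | x' k s != 0]) by apply: measurableC; exact: mnz.
  apply/eqP; rewrite -measure_le0.
  apply: (@le_trans _ _ (nu ((~` E' `&` [set s | x' k s != 0]) `|` ~` [set s | x' k s != 0]))).
    apply: le_measure; rewrite ?inE.
    - by apply: measurableC; apply: measurableI => //; exact: mnz.
    - exact: measurableU.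
    - move=> s nEs; case: (pselect (x' k s != 0)) => xs; [left; split => //|by right].
      by move=> Es; apply: nEs.
  have n1 : nu (~` E' `&` [set s | x' k s != 0]) = 0%E.
    by rewrite nuE null_set_integral//; exact/measurable_funTS/mw.
  have n2 : nu (~` [set s | x' k s != 0]) = 0%E.
    rewrite nuE integral0_eq// => s /= /negP; rewrite negbK => /eqP ->.
    by rewrite normr0 powR0// gt_eqF//; case/andP: halpha => a1 _; apply: lt_trans a1.
  by apply: le_trans (measureU2 nu mC mC0) _; move: n1 n2; rewrite /= => -> ->; rewrite add0e.
have mEk : measurable (E' `&` [set s | x' k s != 0]).
  by apply: measurableI => //; exact: mnz.
have /choice[P0 /choice[Phi PPhi]] : forall n : nat, exists (P0 : set S) (Phi : S -> S'),
    [/\ measurable P0, (mu (~` P0) <= (n.+1%:R^-1)%:E)%E, measurable_fun P0 Phi &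
      forall s, P0 s -> (E' `&` [set s | x' k s != 0]) (Phi s) /\
        forall i, (Phi s \in cut_set x' k i) = (s \in cut_set x k i)].
  move=> n; apply: measurable_matching => //.
  - exact: nu_fin.
  - by move=> i; exact: measurable_cut_set.
  - by move=> i; exact: measurable_cut_set.
exists (fun n => P0 n `&` [set s | x k s != 0]), Phi; split.
- move=> n; have [mP _ mPhi _] := PPhi n; split.
    by apply: measurableI => //; exact: mnz.
  by apply: measurable_funS mPhi.
- pose A := [set s | x k s != 0] `\` \bigcup_n (P0 n `&` [set s | x k s != 0]).
  have mA : measurable A.
    apply: measurableD; first exact: mnz.
    by apply: bigcup_measurable => n _; apply: measurableI; [have [] := PPhi n|exact: mnz].
  apply: (weighted_eq0 mA (mw _ _ _ mx)).
    by move=> s [xs _]; rewrite lte_fin powR_gt0// normr_gt0.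
  rewrite -muE; apply/eqP; rewrite -measure_le0; apply/lee_addgt0Pr => e e0.
  have [n ne] : exists n : nat, n.+1%:R^-1 < e.
    by have [n _ /(_ n (leqnn n))] := near_infty_natSinv_lt (PosNum e0); exists n.
  have [mP muP _ _] := PPhi n; rewrite add0e.
  apply: (@le_trans _ _ (mu (~` P0 n))).
    apply: le_measure; rewrite ?inE//; first exact: measurableC.
    by move=> s [xs nP] Ps; apply: nP; exists n.
  by apply: le_trans muP _; rewrite lee_fin ltW.
- move=> n s [Ps xs]; have [_ _ _ /(_ _ Ps)[[EPhi x's] cut]] := PPhi n; split=> // j.
  apply: ratio_eq => // r; have := cut (pickle (j, r)).
  by rewrite !mem_cut_set /rational_cut pickleK => <-.
Qed.

End two_spaces.

End matching_up_to_scaling.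

(** * Characteristic functions of stable processes *)

Section laws_of_combinations.
Context {R : realType}.

Lemma same_cos_expectation d (Om : measurableType d) (P : probability Om R)
    d' (Om' : measurableType d') (P' : probability Om' R) (Y : Om -> R) (Y' : Om' -> R) :
  measurable_fun setT Y -> measurable_fun setT Y' ->
  (forall B : set (measurableTypeR R), measurable B -> P (Y @^-1` B) = P' (Y' @^-1` B)) ->
  'E_P[fun w => cos (Y w)]%E = 'E_P'[fun w => cos (Y' w)]%E.
Proof.
move=> mY mY' same; rewrite unlock.
have mcos : measurable_fun [set: measurableTypeR R] (fun y => (cos y)%:E).
  apply/measurable_EFinP; apply: continuous_measurable_fun; exact: continuous_cos.
have icos e (T : measurableType e) (Q : probability T R) (W : T -> R) :
    measurable_fun setT W -> Q.-integrable setT (fun w => (cos (W w))%:E).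
  move=> mW; have i1 := @finite_measure_integrable_cst _ _ _ Q setT (1 : R) measurableT.
  apply: (@le_integrable _ _ _ Q setT measurableT _ _ _ _ i1) => //.
    exact: (measurableT_comp mcos).
  by move=> w _; rewrite /= lee_fin normr1 ler_norml cos_geN1 cos_le1.
have push e (T : measurableType e) (Q : probability T R) (W : T -> R)
    (mW : measurable_fun setT W) :
    (\int[Q]_w (cos (W w))%:E =
     \int[pushforward Q (W : T -> measurableTypeR R)]_y (cos y)%:E)%E.
  have := @integral_pushforward _ _ T (measurableTypeR R) R W mW Q setT
    (fun y => (cos y)%:E) mcos.
  by rewrite preimage_setT => ->//; exact: icos.
rewrite (push _ _ _ _ mY) (push _ _ _ _ mY').
by apply: eq_measure_integral => A mA _; exact: same.
Qed.

Lemma eq_fdd_cos d (Om : measurableType d) (P : probability Om R)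
    d' (Om' : measurableType d') (P' : probability Om' R)
    (X : R -> Om -> R) (Y : R -> Om' -> R) N (a t : 'I_N -> R) :
  (forall r, measurable_fun setT (X r)) -> (forall r, measurable_fun setT (Y r)) ->
  eq_fdd P P' X Y ->
  'E_P[fun w => cos (\sum_(i < N) a i * X (t i) w)]%E =
  'E_P'[fun w => cos (\sum_(i < N) a i * Y (t i) w)]%E.
Proof.
move=> mX mY XY; apply: same_cos_expectation.
- by apply: measurable_sum => i; exact: measurable_funM.
- by apply: measurable_sum => i; exact: measurable_funM.
move=> B mB; pose L (y : N.-tuple (measurableTypeR R)) : measurableTypeR R :=
  \sum_(i < N) a i * tnth y i.
have mL : measurable_fun setT L.
  apply: measurable_sum => i; apply: measurable_funM => //.
  exact: measurable_tnth.
have mLB : measurable (L @^-1` B) by rewrite -[X in measurable X]setTI; exact: mL.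
have := XY N [tuple t i | i < N] _ mLB.
set A1 := [set w | _]; set A2 := [set w | _] => A12.
rewrite (_ : _ @^-1` B = A1); last first.
  apply: eq_set => w /=; rewrite /L; congr (B _).
  by apply: eq_bigr => i _; rewrite !tnth_mktuple.
rewrite A12; congr (P' _); apply: eq_set => w /=; rewrite /L; congr (B _).
by apply: eq_bigr => i _; rewrite !tnth_mktuple.
Qed.

Section characteristic_function.
Context (alpha : R) d (S : measurableType d) (m : {measure set S -> \bar R}).
Hypothesis alpha1 : 1 <= alpha.

Lemma Lfun_lcomb (a b : R) (f g : S -> R) :
  f \in Lfun m alpha%:E -> g \in Lfun m alpha%:E ->
  (fun x => a * f x + b * g x) \in Lfun m alpha%:E.
Proof.
have scale c (h : S -> R) : h \in Lfun m alpha%:E -> (fun x => c * h x) \in Lfun m alpha%:E.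
  rewrite (_ : (fun x => c * h x) = (c \o* h)); first exact: Lfun_scale.
  by apply/funext => x /=; rewrite mulrC.
have p1 : (1 <= alpha%:E)%E by rewrite lee_fin.
move=> /(scale a) Lf /(scale b) Lg.
exact: ((Lfun_addr_closed m p1).2 _ _ Lf Lg).
Qed.

(** [f0] serves the empty sum, which is written as a combination of [f0] with zero coefficients. *)
Lemma Lfun_sum N (a : 'I_N -> R) (f : 'I_N -> S -> R) (f0 : S -> R) :
  f0 \in Lfun m alpha%:E -> (forall i, f i \in Lfun m alpha%:E) ->
  (fun x => \sum_(i < N) a i * f i x) \in Lfun m alpha%:E.
Proof.
move=> Lf0; elim: N a f => [|n IH] a f Lf.
  rewrite (_ : (fun x => _) = (fun x => 0 * f0 x + 0 * f0 x)); first exact: Lfun_lcomb.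
  by apply/funext => x; rewrite big_ord0 !mul0r addr0.
pose u := widen_ord (leqnSn n).
rewrite (_ : (fun x => _) =
  (fun x => 1 * (\sum_(i < n) (a \o u) i * (f \o u) i x) + a ord_max * f ord_max x)).
  by apply: Lfun_lcomb => //; apply: IH => i; exact: Lf.
by apply/funext => x; rewrite big_ord_recr/= mul1r.
Qed.

Lemma Lfun_int_lty (f : S -> R) : f \in Lfun m alpha%:E ->
  (\int[m]_s (`|f s| `^ alpha)%:E < +oo)%E.
Proof.
by move=> /(Lfun_integrable alpha1) /integrable_lty; exact.
Qed.

Context d1 (Om : measurableType d1) (P : probability Om R).
Variable M : (S -> R) -> {RV P >-> R}.
Hypothesis hM : stable_random_measure alpha m M.

Lemma stable_sum N (a : 'I_N -> R) (f : 'I_N -> S -> R) (f0 : S -> R) :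
  f0 \in Lfun m alpha%:E -> (forall i, f i \in Lfun m alpha%:E) ->
  {ae P, forall w, M (fun x => \sum_(i < N) a i * f i x) w = \sum_(i < N) a i * M (f i) w}.
Proof.
move=> Lf0; elim: N a f => [|n IH] a f Lf.
  have := hM.1 0 0 _ _ Lf0 Lf0; apply: filterS => w E; rewrite [RHS]big_ord0.
  move: E; rewrite !mul0r addr0 => E; rewrite -[RHS]E.
  congr (M _ w); apply/funext => x.
  by rewrite big_ord0 !mul0r addr0.
pose u := widen_ord (leqnSn n).
have Lw i : f (u i) \in Lfun m alpha%:E by [].
have := hM.1 1 (a ord_max) _ _ (Lfun_sum (a \o u) Lf0 Lw) (Lf ord_max).
have := IH (a \o u) (f \o u) Lw; apply: filterS2 => w E1 E2.
rewrite big_ord_recr/= -E1 -[X in X + _]mul1r -E2; congr (M _ w).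
by apply/funext => x; rewrite big_ord_recr/= mul1r.
Qed.

Lemma stable_cos N (a : 'I_N -> R) (f : 'I_N -> S -> R) (f0 : S -> R) :
  f0 \in Lfun m alpha%:E -> (forall i, f i \in Lfun m alpha%:E) ->
  'E_P[fun w => cos (\sum_(i < N) a i * M (f i) w)]%E =
  (expR (- fine (\int[m]_s (`|\sum_(i < N) a i * f i s| `^ alpha)%:E)%E))%:E.
Proof.
move=> Lf0 Lf; have Lsum := Lfun_sum a Lf0 Lf.
have [+ _] := hM.2 _ 1 Lsum; rewrite normr1 powR1 mul1r => <-.
rewrite unlock; apply: ae_eq_integral => //.
- apply/measurable_EFinP; apply: measurableT_comp.
    apply: continuous_measurable_fun; exact: continuous_cos.
  by apply: measurable_sum => i; exact: measurable_funM.
- apply/measurable_EFinP; apply: measurableT_comp.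
    apply: continuous_measurable_fun; exact: continuous_cos.
  exact: measurable_funM.
have := stable_sum a Lf0 Lf; apply: filterS => w E _ /=.
by rewrite mul1r E.
Qed.

End characteristic_function.

Lemma representation_cos (alpha : R) d (Om : measurableType d) (P : probability Om R)
    (X : R -> {RV P >-> R}) dS (S : measurableType dS) (m : {measure set S -> \bar R})
    (D : set S) (f : R -> S -> R) N (a t : 'I_N -> R) :
  1 <= alpha -> stable_representation alpha P X m D f ->
  'E_P[fun w => cos (\sum_(i < N) a i * X (t i) w)]%E =
  (expR (- fine (\int[m]_s (`|\sum_(i < N) a i * (f (t i) \_ D) s| `^ alpha)%:E)%E))%:E.
Proof.
move=> a1 [Lf [d' [Om' [P' [M [hM XM]]]]]].
rewrite (eq_fdd_cos a t _ _ XM)//.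
exact: (stable_cos a1 hM a (Lf 0) (fun i => Lf (t i))).
Qed.

End laws_of_combinations.

(** The characteristic function at 1 of a combination determines its norm, [expR] being injective
    and the integrals finite. The time changes [u], [v] and the factor [c] let it serve both
    self-similarity, with [u] a dilation and [X' = X], and essential identity. *)
Lemma same_norm_of_fdd {R : realType} (alpha : R)
    d (Om : measurableType d) (P : probability Om R) (X : R -> {RV P >-> R})
    d' (Om' : measurableType d') (P' : probability Om' R) (X' : R -> {RV P' >-> R})
    dS (S : measurableType dS) (m : {measure set S -> \bar R}) (D : set S) (f : R -> S -> R)
    dS' (S' : measurableType dS') (m' : {measure set S' -> \bar R}) (D' : set S')
    (f' : R -> S' -> R) (c : R) (u v : R -> R) :
  1 <= alpha -> stable_representation alpha P X m D f ->
  stable_representation alpha P' X' m' D' f' ->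
  eq_fdd P P' (fun r => X (u r)) (fun r w => c * X' (v r) w) ->
  forall N (a t : 'I_N -> R),
  (\int[m]_s (`|\sum_(i < N) a i * (f (u (t i)) \_ D) s| `^ alpha)%:E =
   \int[m']_s (`|\sum_(i < N) a i * (c * (f' (v (t i)) \_ D') s)| `^ alpha)%:E)%E.
Proof.
move=> a1 rep rep' XX' N a t.
have fin e (T : measurableType e) (mu : {measure set T -> \bar R}) E (g : R -> T -> R)
    (b r : 'I_N -> R) : (forall t, g t \_ E \in Lfun mu alpha%:E) ->
    (\int[mu]_s (`|\sum_(i < N) b i * (g (r i) \_ E) s| `^ alpha)%:E)%E \is a fin_num.
  move=> Lg; rewrite ge0_fin_numE; last by apply: integral_ge0 => x _; rewrite lee_fin powR_ge0.
  apply: (Lfun_int_lty a1).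
  exact: (@Lfun_sum _ _ _ _ _ a1 N b (fun i => g (r i) \_ E) _ (Lg 0) (fun i => Lg (r i))).
under [RHS]eq_integral do under eq_bigr do rewrite mulrA.
rewrite -[LHS]fineK ?(fin _ _ _ _ _ a (u \o t) rep.1)//.
rewrite -[RHS]fineK ?(fin _ _ _ _ _ (fun i => a i * c) (v \o t) rep'.1)//.
have mX r : measurable_fun setT (X (u r)) by [].
have mX' r : measurable_fun setT (fun w => c * X' (v r) w) by exact: measurable_funM.
have := eq_fdd_cos a t mX mX' XX'.
rewrite (representation_cos a (u \o t) a1 rep).
under [X in expectation _ X]eq_fun do under eq_bigr do rewrite mulrA.
rewrite (representation_cos (fun i => a i * c) (v \o t) a1 rep').
by move=> [E]; congr (_%:E); apply: oppr_inj; apply: expR_inj.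
Qed.

(** * Approximation along a countable grid *)

Section null_sections.
Context {R : realType} d (T : measurableType d) d' (T' : measurableType d').
Variables (m : {sigma_finite_measure set T -> \bar R}).
Variables (m' : {sigma_finite_measure set T' -> \bar R}).

Lemma product_null_ysection A : measurable A ->
  (forall y, m (ysection A y) = 0%E) -> (m \x m')%E A = 0%E.
Proof.
move=> mA A0; rewrite (product_measure_unique (m' := (m \x^ m')%E))//; last first.
  by move=> B C mB mC; exact: product_measure2E.
by apply: integral0_eq => y _ /=.
Qed.

Lemma product_null_xsection A : (forall x, m' (xsection A x) = 0%E) ->
  (m \x m')%E A = 0%E.
Proof. by move=> A0; apply: integral0_eq => x _ /=. Qed.

Lemma null_xsection A : measurable A -> (m \x m')%E A = 0%E ->
  exists E, [/\ measurable E, m (~` E) = 0%E & forall x, E x -> m' (xsection A x) = 0%E].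
Proof.
move=> mA A0; pose f x := m' (xsection A x).
have mf : measurable_fun setT f by exact: measurable_fun_xsection.
have mE : measurable (~` (f @^-1` [set 0%E])).
  apply: measurableC; rewrite -[X in measurable X]setTI; apply: mf => //.
exists (f @^-1` [set 0%E]); split => //.
  by rewrite -[X in measurable X]setCK; exact: measurableC.
apply: (weighted_eq0 mE mf).
  by move=> x /eqP fx; rewrite lt_neqAle eq_sym fx /f measure_ge0.
apply/eqP; rewrite eq_le integral_ge0 ?andbT//.
have I0 : (\int[m]_x f x = 0)%E by exact: A0.
rewrite -[X in (_ <= X)%E]I0; apply: ge0_subset_integral => //.
Qed.

End null_sections.

Section grid_approximation.
Context {R : realType} (beta : R).
Hypothesis beta0 : 0 < beta.

(* [mesh n `^ beta = 2 ^- n.+1] is summable, so grid approximations of a family with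
   [beta]-Hoelder moments converge almost everywhere. *)
Definition mesh n : R := (2 ^ n.+1)%:R^-1 `^ beta^-1.

Lemma mesh_gt0 n : 0 < mesh n.
Proof. by rewrite powR_gt0// invr_gt0 ltr0n expn_gt0. Qed.

Lemma mesh_powR n : mesh n `^ beta = (2 ^ n.+1)%:R^-1.
Proof. by rewrite -powRrM mulVf ?gt_eqF// powRr1// invr_ge0. Qed.

Definition grid n (t : R) : R := mesh n * (Num.floor (t / mesh n))%:~R.

Lemma grid_le n t : grid n t <= t.
Proof. by rewrite /grid mulrC -ler_pdivlMr ?mesh_gt0// floor_le. Qed.

Lemma grid_dist n t : t - grid n t <= mesh n.
Proof.
rewrite lerBlDl -[X in _ + X]mulr1 -mulrDr mulrC -ler_pdivrMr ?mesh_gt0// ltW//.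
by rewrite -[1]/(1%:~R) -intrD floorD1_gt.
Qed.

Lemma measurable_floorR : measurable_fun setT (fun t : R => (Num.floor t)%:~R : R).
Proof.
apply: nondecreasing_measurable => // r s rs.
by rewrite ler_int le_floor.
Qed.

Lemma measurable_grid n : measurable_fun setT (grid n).
Proof.
apply: measurable_funM => //; apply: (measurableT_comp measurable_floorR).
exact: measurable_funM.
Qed.

(** A single sequence running through the points of all grids, so that results on sequences of
    functions apply. Indices that code no pair give time 0. *)
Definition grid_time k : R :=
  if unpickle k is Some (n, i) then mesh n * (i : int)%:~R else 0.

Lemma grid_timeP n t : exists k, grid n t = grid_time k.
Proof.
by exists (pickle (n, Num.floor (t / mesh n))); rewrite /grid_time pickleK.
Qed.

Context d (S : measurableType d) (m : {sigma_finite_measure set S -> \bar R}).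
Variables (x : R -> S -> R) (alpha C : R).
Hypothesis mx : measurable_fun [set: S * measurableTypeR R] (fun p => x p.2 p.1).
Hypothesis alpha0 : 0 < alpha.
Hypothesis C0 : 0 <= C.
Hypothesis hx : forall r t, r <= t ->
  (\int[m]_s (`|x t s - x r s| `^ alpha)%:E <= (C * (t - r) `^ beta)%:E)%E.

Let gap n (p : S * R) : \bar R := (`|x p.2 p.1 - x (grid n p.2) p.1| `^ alpha)%:E.
Let defect p : \bar R := (\sum_(n <oo) gap n p)%E.

Let gap0 n p : (0 <= gap n p)%E. Proof. by rewrite lee_fin powR_ge0. Qed.

Let measurable_gap n : measurable_fun [set: S * measurableTypeR R] (gap n).
Proof.
apply/measurable_EFinP/measurable_abs_powR; apply: measurable_funB => //.
pose k (p : S * measurableTypeR R) : S * measurableTypeR R := (p.1, grid n p.2).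
rewrite (_ : (fun _ => _) = (fun p : S * measurableTypeR R => x p.2 p.1) \o k)//.
apply: measurableT_comp => //; apply: measurable_fun_pair => //.
exact: (measurableT_comp (measurable_grid n)).
Qed.

Let measurable_defect : measurable_fun [set: S * measurableTypeR R] defect.
Proof. by apply: ge0_emeasurable_sum => // n p. Qed.

Let bad : set (S * measurableTypeR R) := defect @^-1` [set +oo%E].

Let measurable_bad : measurable bad.
Proof. by rewrite -[X in measurable X]setTI; exact: measurable_defect. Qed.

Let defect_cvg s t : ~ bad (s, t) -> x (grid n t) s @[n --> \oo] --> x t s.
Proof.
move=> nb; have fin : (defect (s, t) < +oo)%E by rewrite ltey; apply/eqP.
have tl := nneseries_tail_cvg fin (fun n _ => gap0 n (s, t)).
have gap_cvg : gap n (s, t) @[n --> \oo] --> 0%E.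
  apply: (squeeze_cvge _ (cvg_cst 0%E) tl).
  apply: nearW => n; rewrite gap0/=.
  have := @nneseries_lim_ge R (gap ^~ (s, t)) xpredT n n.+1 (fun k _ _ => gap0 k (s, t)).
  by rewrite big_nat1.
have /fine_cvgP[_ fgap] := gap_cvg.
apply/cvgrPdist_lt => e e0.
have ea : 0 < e `^ alpha by rewrite powR_gt0.
have /cvgrPdist_lt/(_ _ ea) := fgap; apply: filterS => n /=.
rewrite sub0r normrN ger0_norm ?powR_ge0// => lt_e.
rewrite ltNge; apply/negP => le_e; move: lt_e; rewrite ltNge => /negP; apply.
by rewrite ge0_ler_powR// ?nnegrE ?(ltW alpha0)// ltW.
Qed.

(** At fixed [t] the [n]-th gap has integral at most [C * 2 ^- n.+1], so the defect has integral at
    most [C] and is finite almost everywhere. *)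
Let bad_ysection t : m (ysection bad t) = 0%E.
Proof.
pose E := defect \o (fun s => (s, t)).
have mpt : measurable_fun setT (fun s : S => (s, t) : S * measurableTypeR R).
  exact: measurable_fun_pair.
have fin : (\int[m]_s E s < +oo)%E.
  apply: (@le_lt_trans _ _ C%:E); last exact: ltry.
  rewrite /E /defect /= integral_nneseries//; last 1 first.
    by move=> n; exact: (measurableT_comp (measurable_gap n) mpt).
  apply: le_trans (epsilon_trick0 xpredT C0); apply: lee_nneseries => [n _ _|n _].
    exact: integral_ge0.
  apply: (le_trans (hx (grid_le n t))); rewrite lee_fin ler_wpM2l//.
  rewrite -mesh_powR ge0_ler_powR ?nnegrE ?(ltW beta0) ?(ltW (mesh_gt0 _)) ?grid_dist//.
  by rewrite subr_ge0 grid_le.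
have mE : measurable_fun setT E by exact: (measurableT_comp measurable_defect mpt).
have iE : m.-integrable setT E.
  apply/integrableP; split => //; under eq_integral do rewrite gee0_abs ?nneseries_ge0//.
  exact: fin.
have [N [mN N0 sub]] := integrable_ae measurableT iE.
apply: (subset_measure0 (measurable_ysection _ measurable_bad) mN _ N0) => s.
rewrite /ysection/= inE => bs; apply: sub => /= /(_ Logic.I).
by rewrite /E/= bs.
Qed.

Lemma ae_grid_cvg t : {ae m, forall s, x (grid n t) s @[n --> \oo] --> x t s}.
Proof.
exists (ysection bad t); split => //; first exact: measurable_ysection.
move=> s ns; rewrite /ysection/= inE; apply: contrapT => nb; apply: ns.
exact: defect_cvg.
Qed.

(** Tonelli exchanges the quantifiers: the bad set has null sections at every [t], hence null
    sections at almost every [s]. *)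
Lemma ae_ae_grid_cvg : exists E, [/\ measurable E, m (~` E) = 0%E &
  forall s, E s -> {ae @lebesgue_measure R, forall t, x (grid n t) s @[n --> \oo] --> x t s}].
Proof.
have [E [mE E0 Ebad]] := null_xsection measurable_bad
  (product_null_ysection (@lebesgue_measure R) measurable_bad bad_ysection).
exists E; split => // s Es; exists (xsection bad s); split.
- exact: measurable_xsection.
- exact: Ebad.
move=> t nt; rewrite /xsection/= inE; apply: contrapT => nb; apply: nt.
exact: defect_cvg.
Qed.

End grid_approximation.

(** * The canonical kernel *)

(** Parity expressed through real floor functions, from which the sign [b1 ^ ipart] inherits
    measurability. *)
Lemma signz_floor {R : realType} (n : int) :
  (-1 : R) ^ n = 1 - 2 * (n%:~R - 2 * (Num.floor (n%:~R / 2 : R))%:~R).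
Proof.
have [m [r [-> r01]]] : exists m r, n = m * 2 + r /\ (r = 0 \/ r = 1).
  exists (n %/ 2)%Z, (n %% 2)%Z; split; first exact: divz_eq.
  have : (n %% 2)%Z < 2 by exact: ltz_pmod.
  have : 0 <= (n %% 2)%Z by exact: modz_ge0.
  by case: (n %% 2)%Z => [[|[|k]]|k]//; [left|right].
have fl : Num.floor ((m * 2 + r)%:~R / 2 : R) = m.
  apply: floor_def; rewrite !intrD !intrM /=.
  by move: (m%:~R : R) => M; case: r01 => ->; apply/andP; split; rewrite ?mulr0z ?mulr1z; lra.
have e2 : ((-1 : R) ^ m) ^ 2 = 1.
  by rewrite exprz_exp mulrC -exprz_exp (_ : (-1 : R) ^ 2 = 1) ?exp1rz//
    -[LHS]/((-1) ^+ 2) sqrrN expr1n.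
rewrite fl expfzDr ?oppr_eq0 ?oner_eq0// -exprz_exp e2 mul1r intrD intrM.
move: (m%:~R : R) => M; case: r01 => ->; rewrite ?mulr0z ?mulr1z ?expr0z ?expr1z; lra.
Qed.

Lemma measurable_inv {R : realType} d (T : measurableType d) (f : T -> R) :
  measurable_fun setT f -> measurable_fun setT (fun x => (f x)^-1).
Proof.
move=> mf; rewrite (_ : (fun _ => _) = fun x => f x * (`|f x| `^ (-1)) ^+ 2).
  by apply: measurable_funM => //; apply: measurable_funX; exact: measurable_abs_powR.
apply/funext => x; rewrite powR_inv1// exprVn real_normK ?num_real//.
have [->|f0] := eqVneq (f x) 0; first by rewrite invr0 mul0r.
by rewrite expr2 invfM mulrA divff// mul1r.
Qed.

Section canonical_kernel.
Context {R : realType} (kappa : R) d (Z : measurableType d).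
Variables (b1 s q : Z -> R) (F1 F2 : Z -> R -> R) (F3 : Z -> R).
Let G := canonical_kernel kappa b1 s q F1 F2 F3.
Let S : measurableType _ := ((Z * measurableTypeR R) * measurableTypeR R)%type.

Definition good_fiber : set Z := [set z | [/\ b1 z = 1 \/ b1 z = -1, s z != 0 & 0 < q z]].

Lemma pospowM c u : 0 < c -> pospow kappa (c * u) = c `^ kappa * pospow kappa u.
Proof.
move=> c0; rewrite /pospow; case: eqP => [->|_]; rewrite pmulr_rgt0//.
  by rewrite powRr0 mul1r.
by rewrite normrM powRM// (gtr0_norm c0) mulrA.
Qed.

Lemma negpowM c u : 0 < c -> negpow kappa (c * u) = c `^ kappa * negpow kappa u.
Proof.
move=> c0; rewrite /negpow; case: eqP => [->|_].
  by rewrite pmulr_rle0// powRr0 mul1r.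
by rewrite pmulr_rlt0// normrM powRM// (gtr0_norm c0) mulrA.
Qed.

(** With [c = exp (v / s)] one has [v + s * ln |u| = s * ln |c * u|], so both sides evaluate [F1],
    [F2] and the sign at the same place. The powers of [u] contribute [c^kappa]. The logarithmic
    term contributes an additive constant, and only for [kappa = 0], when [c^kappa = 1]. *)
Lemma kernel_scaling z v u : s z != 0 -> u != 0 ->
  G z v u = (expR (v / s z) `^ kappa)^-1 * G z 0 (expR (v / s z) * u) -
    (b1 z == 1)%:R * (kappa == 0)%:R * (F3 z * (v / s z)).
Proof.
move=> s0 u0; set c := expR (v / s z); have c0 : 0 < c by exact: expR_gt0.
rewrite /G /canonical_kernel normrM (gtr0_norm c0) lnM ?posrE ?normr_gt0// expRK.
rewrite add0r (_ : s z * (v / s z + ln `|u|) = v + s z * ln `|u|); last by field.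
rewrite pospowM// negpowM//.
have ck : c `^ kappa != 0 by rewrite gt_eqF// powR_gt0.
have ee : (c `^ kappa)^-1 * (kappa == 0)%:R = (kappa == 0)%:R :> R.
  by case: eqP => [->|_]; rewrite ?mulr0// powRr0 invr1 mul1r.
move: ee ck; move: (c `^ kappa) ((kappa == 0)%:R : R) ((b1 z == 1)%:R : R) => k e b ee k0.
move: (fpart _ _) (ipart _ _) => y n.
move: (b1 z ^ n) (F1 z y) (F2 z y) (F3 z) (pospow kappa u) (negpow kappa u) (ln `|u|) (v / s z).
move=> B f1 f2 f3 P N L w; rewrite [k^-1 * _]mulrDr (mulrCA f1) (mulrCA f2).
rewrite -[k * _ + k * _]mulrDr (mulrCA B) mulKf//.
rewrite (_ : k^-1 * _ = b * (k^-1 * e) * (f3 * (w + L))); last by ring.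
by rewrite ee; ring.
Qed.

Hypothesis mb1 : measurable_fun setT b1.
Hypothesis ms : measurable_fun setT s.
Hypothesis mq : measurable_fun setT q.

Let measurable_preim e (T : measurableType e) (f : T -> R) (B : set (measurableTypeR R)) :
  measurable_fun setT f -> measurable B -> measurable (f @^-1` B).
Proof. by move=> mf mB; rewrite -[X in measurable X]setTI; exact: mf. Qed.

Lemma measurable_good_fiber : measurable good_fiber.
Proof.
rewrite (_ : good_fiber = (b1 @^-1` ([set 1] `|` [set -1])) `&` (s @^-1` (~` [set 0])) `&`
  (q @^-1` `]0, +oo[)).
  apply: measurableI; [apply: measurableI|]; apply: measurable_preim => //.
  - exact: measurableU.
  - exact: measurableC.
apply/seteqP; split => z /= => [[bz sz qz]|[[bz sz]]]; rewrite in_itv/= andbT.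
  by split => //; split => //; exact/eqP.
by split => //; exact/eqP.
Qed.

Lemma measurable_under_graph : measurable (under_graph q : set (Z * measurableTypeR R)).
Proof.
rewrite (_ : under_graph q = (snd @^-1` `[0, +oo[) `&`
  ((fun p : Z * measurableTypeR R => q p.1 - p.2) @^-1` `]0, +oo[)).
  apply: measurableI; apply: measurable_preim => //.
  by apply: measurable_funB => //; exact: (measurableT_comp mq).
apply/seteqP; split => p /=; rewrite /under_graph/= !in_itv/= !andbT subr_gt0.
  by move=> /andP.
by move=> /andP.
Qed.

Hypothesis mF1 : measurable_fun (under_graph q : set (Z * measurableTypeR R))
  (fun p => F1 p.1 p.2).
Hypothesis mF2 : measurable_fun (under_graph q : set (Z * measurableTypeR R))
  (fun p => F2 p.1 p.2).
Hypothesis mF3 : measurable_fun setT F3.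

(** The conditions on [b1], [s], [q] hold almost everywhere only. Over this conull part [b1] is a
    sign and [fpart] falls into [[0, q)], where [F1] and [F2] are known to be measurable. *)
Definition good_part : set S := [set p | good_fiber p.1.1].

Lemma measurable_good_part : measurable good_part.
Proof.
rewrite (_ : good_part = (good_fiber `*` setT) `*` setT).
  by apply: measurableX => //; apply: measurableX => //; exact: measurable_good_fiber.
by apply/seteqP; split => p //= [[]].
Qed.

Let mz f : measurable_fun setT f -> measurable_fun [set: S] (fun p => f p.1.1 : R).
Proof.
move=> mf; apply: (measurableT_comp mf); apply: measurableT_comp => //.
Qed.

Let mv : measurable_fun [set: S] (fun p => p.1.2 : R).
Proof. by apply: measurableT_comp. Qed.

Let mu : measurable_fun [set: S] (fun p => p.2 : R).
Proof. exact: measurable_snd. Qed.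

Let my : measurable_fun [set: S] (fun p => p.1.2 + s p.1.1 * ln `|p.2|).
Proof.
apply: measurable_funD; first exact: mv.
apply: measurable_funM; first exact: mz.
apply: (measurableT_comp (@measurable_ln R)).
exact: (measurableT_comp (@normr_measurable R setT)).
Qed.

Let mquo : measurable_fun [set: S] (fun p => (p.1.2 + s p.1.1 * ln `|p.2|) / q p.1.1).
Proof.
apply: measurable_funM; first exact: my.
exact: (mz (measurable_inv mq)).
Qed.

Let mfloor (f : S -> R) : measurable_fun setT f ->
  measurable_fun setT (fun p => (Num.floor (f p))%:~R : R).
Proof. by move=> mf; apply: (measurableT_comp (@measurable_floorR R)). Qed.

Let msign : measurable_fun good_part
  (fun p => b1 p.1.1 ^ ipart (q p.1.1) (p.1.2 + s p.1.1 * ln `|p.2|)).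
Proof.
pose n (p : S) : R := (Num.floor ((p.1.2 + s p.1.1 * ln `|p.2|) / q p.1.1))%:~R.
(* For [b1 = 1] or [b1 = -1] this weighted mean of [1] and [(-1)^n] is [b1^n], and it is a
   measurable expression in [b1] and [n]. *)
apply: (@eq_measurable_fun _ _ _ _ _ (fun p : S => (1 + b1 p.1.1) / 2 +
  (1 - b1 p.1.1) / 2 * (1 - 2 * (n p - 2 * (Num.floor (n p / 2))%:~R)))).
  move=> p /set_mem [+ _ _]; rewrite /ipart -signz_floor; move: (Num.floor _) => k [->|->].
    by rewrite exp1rz subrr mul0r mul0r addr0 divff.
  by rewrite subrr mul0r add0r opprK divff// mul1r.
apply: measurable_funTS; have mn : measurable_fun setT n by exact: mfloor.
apply: measurable_funD.
  by apply: measurable_funM => //; apply: measurable_funD => //; exact: mz.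
apply: measurable_funM.
  by apply: measurable_funM => //; apply: measurable_funB => //; exact: mz.
apply: measurable_funB => //; apply: measurable_funM => //; apply: measurable_funB => //.
by apply: measurable_funM => //; apply: mfloor; exact: measurable_funM.
Qed.

Let mF F : measurable_fun (under_graph q : set (Z * measurableTypeR R))
    (fun p => F p.1 p.2) -> measurable_fun good_part
  (fun p => F p.1.1 (fpart (q p.1.1) (p.1.2 + s p.1.1 * ln `|p.2|)) : R).
Proof.
move=> mF; pose g (p : S) : Z * measurableTypeR R :=
  (p.1.1, fpart (q p.1.1) (p.1.2 + s p.1.1 * ln `|p.2|)).
apply: (measurable_comp measurable_under_graph (g := g) _ mF).
  move=> _ [p [_ _ q0] <-]; rewrite /under_graph /g /=.
  move: (p.1.2 + _) => y; rewrite /fpart /ipart; have := floor_itv (y / q p.1.1).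
  rewrite ler_pdivlMr// ltr_pdivrMr// intrD mulrDl mul1r => /andP[h1 h2].
  by apply/andP; split; rewrite mulrC; lra.
apply: measurable_funTS; apply: measurable_fun_pair.
  by apply: measurableT_comp.
apply: measurable_funB => //; apply: measurable_funM; first exact: mz.
exact: mfloor.
Qed.

Let mpos : measurable_fun [set: S] (fun p => pospow kappa p.2).
Proof.
have mi : measurable_fun [set: S] (fun p => (0 < p.2)%R%:R : R).
  rewrite (_ : (fun _ => _) = fun p : S => \1_(`]0, +oo[ : set R) (p.2 : R)); last first.
    by apply/funext => p; rewrite indicE mem_setE in_itv/= andbT.
  exact: (measurableT_comp (@measurable_indic _ _ _ setT _ (measurable_itv _))).
rewrite /pospow; case: eqP => _ //; apply: measurable_funM => //.
exact: (measurable_abs_powR _ mu).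
Qed.

Let mneg : measurable_fun [set: S] (fun p => negpow kappa p.2).
Proof.
have mi (i : interval R) : measurable_fun [set: S] (fun p => (p.2 \in i)%:R : R).
  rewrite (_ : (fun _ => _) = fun p : S => \1_([set` i] : set R) (p.2 : R)); last first.
    by apply/funext => p; rewrite indicE mem_setE.
  exact: (measurableT_comp (@measurable_indic _ _ _ setT _ (measurable_itv _))).
rewrite /negpow; case: eqP => _.
  by have := mi `]-oo, 0]; under eq_fun do rewrite in_itv.
apply: measurable_funM => //; first exact: (measurable_abs_powR _ mu).
by have := mi `]-oo, 0[; under eq_fun do rewrite in_itv.
Qed.

Lemma measurable_kernel : measurable_fun good_part (fun p => G p.1.1 p.1.2 p.2).
Proof.
rewrite /G /canonical_kernel /=; apply: measurable_funD.
  apply: measurable_funM => //; apply: measurable_funD; apply: measurable_funM.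
  - exact: mF.
  - exact: measurable_funTS.
  - exact: mF.
  - exact: measurable_funTS.
apply: measurable_funTS; apply: measurable_funM.
  apply: measurable_funM => //; apply: (mz (f := fun z => (b1 z == 1)%:R)).
  rewrite (_ : (fun _ => _) = fun z => \1_([set 1] : set R) (b1 z)).
    exact: (measurableT_comp (@measurable_indic _ _ _ setT _ _)).
  apply/funext => z; rewrite indicE (_ : (b1 z == 1) = (b1 z \in [set 1]))//.
  by apply/eqP/idP => [->|/set_mem//]; exact/mem_set.
apply: measurable_funM; first exact: mz.
apply: (measurableT_comp (@measurable_ln R)).
exact: (measurableT_comp (@normr_measurable R setT)).
Qed.

End canonical_kernel.

(* The library declares [m1 \x m2] sigma-finite, but this instance is shadowed by
   the one for products of sub-probabilities. *)
Definition sigma_finite_product {R : realType} d (T : measurableType d)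
    d' (T' : measurableType d') (m : {sigma_finite_measure set T -> \bar R})
    (m' : {sigma_finite_measure set T' -> \bar R}) : set (T * T')%type -> \bar R :=
  (m \x m')%E.

Section sigma_finite_product.
Context {R : realType} d (T : measurableType d) d' (T' : measurableType d').
Variables (m : {sigma_finite_measure set T -> \bar R}).
Variables (m' : {sigma_finite_measure set T' -> \bar R}).

HB.instance Definition _ := Measure.copy (sigma_finite_product m m') (m \x m')%E.

Let sigma_finite_product_sigma_finite : sigma_finite setT (sigma_finite_product m m').
Proof.
have [F FT Ffin] := sigma_finiteT m; have [F' FT' Ffin'] := sigma_finiteT m'.
pose W n : set (T * T')%type :=
  if unpickle n is Some (i, j) then F i `*` F' j else set0.
exists W => [|n].
  apply/seteqP; split => // -[x y] _.
  have [i _ Fx] : (\bigcup_i F i) x by rewrite -FT.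
  have [j _ Fy] : (\bigcup_i F' i) y by rewrite -FT'.
  by exists (pickle (i, j)) => //; rewrite /W pickleK.
rewrite /W; case: (unpickle n) => [[i j]|]; last by rewrite measure0.
have [mF fF] := Ffin i; have [mF' fF'] := Ffin' j.
split; first exact: measurableX.
rewrite /sigma_finite_product product_measure1E// lte_mul_pinfty//.
by rewrite ge0_fin_numE.
Qed.

HB.instance Definition _ := Measure_isSigmaFinite.Build _ _ _ (sigma_finite_product m m')
  sigma_finite_product_sigma_finite.

End sigma_finite_product.

Section canonical_family.
Context {R : realType} (kappa : R) d (Z : measurableType d).
Variables (sigma : {sigma_finite_measure set Z -> \bar R}).
Variables (b1 s q : Z -> R) (F1 F2 : Z -> R -> R) (F3 : Z -> R).
Let G := canonical_kernel kappa b1 s q F1 F2 F3.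
Local Notation S := ((Z * measurableTypeR R) * measurableTypeR R)%type.
Local Notation mu := (@lebesgue_measure R).
Let m : {sigma_finite_measure set S -> \bar R} :=
  sigma_finite_product (sigma_finite_product sigma mu) mu.
Hypothesis data : canonical_data sigma b1 s q F1 F2 F3.

Definition good_domain : set S := canonical_domain q `&` good_part b1 s q.

(** Cutting the integrand off to the good part makes it measurable everywhere; as only a null set of
    fibres is lost, the norms of linear combinations stay the same. *)
Definition canonical_family (t : R) : S -> R :=
  canonical_integrand G t \_ good_domain.
Local Notation x := canonical_family.

Lemma canonical_familyE t p : good_domain p ->
  x t p = G p.1.1 p.1.2 (t + p.2) - G p.1.1 p.1.2 p.2.
Proof. by move=> gp; rewrite /x patchE mem_set. Qed.

Lemma canonical_family0 t p : ~ good_domain p -> x t p = 0.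
Proof. by move=> gp; rewrite /x patchE memNset. Qed.

Lemma measurable_canonical_domain : measurable (canonical_domain q : set S).
Proof.
have [[_ _ mq] _ _] := data.
rewrite (_ : canonical_domain q = under_graph q `*` setT).
  by apply: measurableX => //; exact: measurable_under_graph.
by apply/seteqP; split => p //= [].
Qed.

Lemma measurable_good_domain : measurable good_domain.
Proof.
have [[mb1 ms mq] _ _] := data.
apply: measurableI; first exact: measurable_canonical_domain.
exact: measurable_good_part.
Qed.

Lemma good_fiber_conull : sigma (~` good_fiber b1 s q) = 0%E.
Proof.
have [[mb1 ms mq] _ [N [mN N0 sub]]] := data.
apply: (subset_measure0 _ mN _ N0); last by move=> z gz; apply: sub.
by apply: measurableC; exact: measurable_good_fiber.
Qed.

Lemma good_part_conull : m (~` good_part b1 s q) = 0%E.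
Proof.
have [[mb1 ms mq] _ _] := data.
have mgC : measurable (~` good_fiber b1 s q).
  by apply: measurableC; exact: measurable_good_fiber.
have -> : ~` good_part b1 s q = (~` good_fiber b1 s q `*` setT) `*` setT.
  by apply/seteqP; split => p //= [[]].
rewrite [LHS](product_measure1E (sigma_finite_product sigma mu) mu)//; last exact: measurableX.
rewrite [X in (X * _)%E](product_measure1E sigma mu)//.
by rewrite [X in (X * _ * _)%E]good_fiber_conull mul0e mul0e.
Qed.

Lemma measurable_canonical_family :
  measurable_fun [set: S * measurableTypeR R] (fun p => x p.2 p.1).
Proof.
have [[mb1 ms mq] [mF1 mF2 mF3] _] := data.
have mK := measurable_kernel kappa mb1 ms mq mF1 mF2 mF3.
pose E : set (S * measurableTypeR R) := good_domain `*` setT.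
have mE : measurable E by apply: measurableX => //; exact: measurable_good_domain.
rewrite (_ : (fun p => _) = (fun p : S * measurableTypeR R =>
    G p.1.1.1 p.1.1.2 (p.2 + p.1.2) - G p.1.1.1 p.1.1.2 p.1.2) \_ E); last first.
  apply/funext => p; rewrite [RHS]patchE; case: ifPn => [/set_mem[gp _]|/negP np].
    exact: canonical_familyE.
  by apply: canonical_family0 => gp; apply: np; rewrite inE.
apply/(measurable_restrictT _ mE).
have mcomp (u : S * measurableTypeR R -> measurableTypeR R) : measurable_fun setT u ->
    measurable_fun E (fun p => G p.1.1.1 p.1.1.2 (u p)).
  move=> mu'; pose g (p : S * measurableTypeR R) : S := (p.1.1, u p).
  have mgp := measurable_good_part mb1 ms mq.
  apply: (measurable_comp mgp (g := g) _ mK); first by move=> _ [p [[_ gp] _] <-].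
  apply: measurable_funTS; apply: measurable_fun_pair => //.
  by apply: (measurableT_comp (f := fst)) => //; apply: measurableT_comp.
have m12 : measurable_fun [set: S * measurableTypeR R] (fun p => p.1.2 : measurableTypeR R).
  by apply: measurableT_comp.
apply: measurable_funB; last exact: mcomp.
by apply: mcomp; apply: measurable_funD.
Qed.

Lemma measurable_canonical_family1 t : measurable_fun setT (x t).
Proof.
exact: (measurableT_comp measurable_canonical_family (pair2_measurable (t : measurableTypeR R))).
Qed.

(** Stationarity of increments: translating [u] by [r] preserves Lebesgue measure, and the good
    domain imposes no condition on [u]. *)
Lemma canonical_family_int_shift alpha r t :
  (\int[m]_p (`|x t p - x r p| `^ alpha)%:E = \int[m]_p (`|x (t - r) p| `^ alpha)%:E)%E.
Proof.
have mx2 t' r' : measurable_fun setT (fun p => (`|x t' p - x r' p| `^ alpha)%:E).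
  apply/measurable_EFinP; apply: measurable_abs_powR.
  by apply: measurable_funB; exact: measurable_canonical_family1.
have mx1 t' : measurable_fun setT (fun p => (`|x t' p| `^ alpha)%:E).
  by apply/measurable_EFinP; apply: measurable_abs_powR; exact: measurable_canonical_family1.
have p0 (y : R) : (0 <= (y `^ alpha)%:E)%E by rewrite lee_fin powR_ge0.
have tonelli (k : S -> \bar R) : measurable_fun setT k -> (forall p, 0 <= k p)%E ->
    (\int[m]_p k p = \int[sigma_finite_product sigma mu]_zv \int[mu]_u k (zv, u))%E.
  exact: fubini_tonelli1.
apply: (etrans (tonelli _ (mx2 t r) (fun=> p0 _))).
apply: (etrans _ (esym (tonelli _ (mx1 (t - r)) (fun=> p0 _)))).
apply: eq_integral => zv _.
pose k (u : measurableTypeR R) := (`|x (t - r) (zv, u)| `^ alpha)%:E.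
have mk : measurable_fun setT k.
  exact: (measurableT_comp (mx1 (t - r)) (pair1_measurable zv)).
have := ge0_integral_affine r (oner_neq0 R) mk (fun u => p0 _).
rewrite normr1 invr1 mul1e => <-; apply: eq_integral => u _; rewrite /k mul1r.
congr ((`|_| `^ alpha)%:E).
have [gp|ngp] := pselect (good_domain (zv, u)).
  have gp' : good_domain (zv, u + r) by case: gp.
  rewrite !canonical_familyE//= addrCA subrK (addrC r u) (addrC t u).
  by rewrite opprB addrA subrK.
have ngp' : ~ good_domain (zv, u + r) by move=> gp; apply: ngp; case: gp.
by rewrite !canonical_family0// subr0.
Qed.

Lemma canonical_family_lcomb alpha N (a t : 'I_N -> R) :
  (forall t, canonical_integrand G t \_ (canonical_domain q) \in
    Lfun (canonical_control sigma) alpha%:E) ->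
  (\int[m]_p (`|\sum_(i < N) a i * x (t i) p| `^ alpha)%:E =
   \int[canonical_control sigma]_p
     (`|\sum_(i < N) a i * (canonical_integrand G (t i) \_ (canonical_domain q)) p| `^ alpha)%:E)%E.
Proof.
move=> Lf.
have mf r : measurable_fun setT (canonical_integrand G r \_ (canonical_domain q) : S -> R).
  by have := Lf r; rewrite inE => /andP[/[!inE]].
apply: ae_eq_integral => //.
- apply/measurable_EFinP; apply: measurable_abs_powR; apply: measurable_sum => i.
  by apply: measurable_funM => //; exact: measurable_canonical_family1.
- apply/measurable_EFinP; apply: measurable_abs_powR; apply: measurable_sum => i.
  by apply: measurable_funM.
exists (~` good_part b1 s q); split.
- have [[mb1 ms mq] _ _] := data.
  by apply: measurableC; exact: measurable_good_part.
- exact: good_part_conull.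
move=> p np gp; apply: np => _ /=; congr ((`|_| `^ alpha)%:E).
apply: eq_bigr => i _; congr (_ * _); rewrite /x !patchE /good_domain in_setI.
by rewrite (mem_set gp) andbT.
Qed.

End canonical_family.

(** * Scaling, grid approximation and full support of a canonical family *)

Section self_similar_family.
Context {R : realType} (alpha H kappa : R) d (Z : measurableType d).
Variables (sigma : {sigma_finite_measure set Z -> \bar R}).
Variables (b1 s q : Z -> R) (F1 F2 : Z -> R -> R) (F3 : Z -> R).
Let G := canonical_kernel kappa b1 s q F1 F2 F3.
Local Notation S := ((Z * measurableTypeR R) * measurableTypeR R)%type.
Local Notation mu := (@lebesgue_measure R).
Let m : {sigma_finite_measure set S -> \bar R} :=
  sigma_finite_product (sigma_finite_product sigma mu) mu.
Let x := canonical_family kappa b1 s q F1 F2 F3.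
Hypothesis alpha1 : 1 <= alpha.
Hypothesis H0 : 0 < H.
Hypothesis data : canonical_data sigma b1 s q F1 F2 F3.
Context dO (Om : measurableType dO) (P : probability Om R) (X : R -> {RV P >-> R}).
Hypothesis rep : stable_representation alpha P X
  (canonical_control sigma) (canonical_domain q) (canonical_integrand G).
Hypothesis ss : self_similar P H X.

Let alpha0 : 0 < alpha. Proof. exact: lt_le_trans alpha1. Qed.
Let C : R := fine (\int[m]_p (`|x 1 p| `^ alpha)%:E)%E.

Let lcomb1 (a t : R) : (\int[m]_p (`|a * x t p| `^ alpha)%:E =
  \int[canonical_control sigma]_p
     (`|\sum_(i < 1) a * (canonical_integrand G t \_ (canonical_domain q)) p| `^ alpha)%:E)%E.
Proof.
rewrite -(canonical_family_lcomb data (fun=> a) (fun=> t) rep.1).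
by apply: eq_integral => p _; rewrite big_ord_recl big_ord0 addr0.
Qed.

Let fin t : (\int[m]_p (`|x t p| `^ alpha)%:E)%E \is a fin_num.
Proof.
rewrite ge0_fin_numE; last by apply: integral_ge0 => p _; rewrite lee_fin powR_ge0.
under eq_integral do rewrite -[x t _]mul1r.
rewrite lcomb1; apply: (Lfun_int_lty alpha1).
exact: (Lfun_sum alpha1 (fun=> 1) (rep.1 0) (fun=> rep.1 t)).
Qed.

Lemma canonical_family_scaling a : 0 < a ->
  (\int[m]_p (`|x a p| `^ alpha)%:E = (C * a `^ (alpha * H))%:E)%E.
Proof.
move=> a0; have := same_norm_of_fdd alpha1 rep rep (ss a0) (fun _ : 'I_1 => 1) (fun=> 1).
under [in RHS]eq_integral do under eq_bigr do rewrite mul1r.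
rewrite mulr1 -!lcomb1; under eq_integral do rewrite mul1r.
move=> ->; under eq_integral do rewrite normrM powRM// EFinM.
rewrite ge0_integralZl//.
- by rewrite ger0_norm ?powR_ge0// -powRrM (mulrC H) (mulrC C) EFinM /C fineK// fin.
- apply/measurable_EFinP; apply: measurable_abs_powR.
  exact: (measurable_canonical_family1 kappa data).
Qed.

Lemma canonical_family_modulus r t : r <= t ->
  (\int[m]_p (`|x t p - x r p| `^ alpha)%:E <= (C * (t - r) `^ (alpha * H))%:E)%E.
Proof.
move=> rt; rewrite canonical_family_int_shift//.
move: rt; rewrite le_eqVlt => /predU1P[->|rt]; last by rewrite canonical_family_scaling// subr_gt0.
rewrite subrr powR0 ?mulr0; last by rewrite gt_eqF// mulr_gt0.
rewrite integral0_eq// => p _; rewrite /canonical_family patchE.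
rewrite /canonical_integrand /increment add0r subrr if_same normr0 powR0//.
by rewrite gt_eqF.
Qed.

Let C0 : 0 <= C.
Proof. by rewrite fine_ge0// integral_ge0// => p _; rewrite lee_fin powR_ge0. Qed.

Let mx := measurable_canonical_family kappa data.
Let beta0 : 0 < alpha * H. Proof. exact: mulr_gt0. Qed.

Lemma canonical_family_grid : exists E, [/\ measurable E, m (~` E) = 0%E &
  forall p, E p -> {ae mu, forall t, x (grid (alpha * H) n t) p @[n --> \oo] --> x t p}].
Proof. exact: (ae_ae_grid_cvg beta0 mx alpha0 C0 canonical_family_modulus). Qed.

(** For each fixed [t], almost every [x t p] is a limit of grid values. Vanishing at all grid times
    thus entails vanishing almost everywhere at each [t], which is the premise of full support. *)
Lemma canonical_family_full_support :
  full_support (canonical_control sigma) (canonical_domain q) (canonical_integrand G) ->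
  m (good_domain b1 s q `&` [set p | forall k, x (grid_time (alpha * H) k) p = 0]) = 0%E.
Proof.
move=> full; apply: full.
- apply: measurableI; first exact: measurable_good_domain data.
  rewrite (_ : [set p | _] = \bigcap_k (x (grid_time (alpha * H) k) @^-1` [set 0])).
    apply: bigcapT_measurable => k; rewrite -[X in measurable X]setTI.
    exact: (measurable_canonical_family1 kappa data).
  by apply/seteqP; split => p px k; [move=> _|]; exact: px.
- by move=> p [[]].
move=> t; have := ae_grid_cvg beta0 mx alpha0 C0 canonical_family_modulus t.
apply: filterS => p ct [gp x0].
rewrite -[LHS](canonical_familyE kappa F1 F2 F3 t gp).
apply: (cvg_unique _ ct) => //.
rewrite (_ : (fun n => _) = fun=> 0); first exact: cvg_cst.
apply/funext => n; have [k ->] := grid_timeP (alpha * H) n t.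
exact: x0.
Qed.

End self_similar_family.

(** * Matching the two canonical families piece by piece *)

Section matching_canonical_families.
Context {R : realType} (alpha H kappa : R).
Hypothesis halpha : 1 < alpha < 2.
Hypothesis H0 : 0 < H.
Local Notation mu := (@lebesgue_measure R).

Context d (Z : measurableType d) (sigma : {sigma_finite_measure set Z -> \bar R}).
Variables (b1 s q : Z -> R) (F1 F2 : Z -> R -> R) (F3 : Z -> R).
Local Notation S := ((Z * measurableTypeR R) * measurableTypeR R)%type.
Let G := canonical_kernel kappa b1 s q F1 F2 F3.
Let m : {sigma_finite_measure set S -> \bar R} :=
  sigma_finite_product (sigma_finite_product sigma mu) mu.
Let x := canonical_family kappa b1 s q F1 F2 F3.
Hypothesis data : canonical_data sigma b1 s q F1 F2 F3.
Context dO (Om : measurableType dO) (P : probability Om R) (X : R -> {RV P >-> R}).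
Hypothesis rep : stable_representation alpha P X
  (canonical_control sigma) (canonical_domain q) (canonical_integrand G).
Hypothesis ss : self_similar P H X.

Context d' (Z' : measurableType d') (sigma' : {sigma_finite_measure set Z' -> \bar R}).
Variables (b1' s' q' : Z' -> R) (F1' F2' : Z' -> R -> R) (F3' : Z' -> R).
Local Notation S' := ((Z' * measurableTypeR R) * measurableTypeR R)%type.
Let G' := canonical_kernel kappa b1' s' q' F1' F2' F3'.
Let m' : {sigma_finite_measure set S' -> \bar R} :=
  sigma_finite_product (sigma_finite_product sigma' mu) mu.
Let x' := canonical_family kappa b1' s' q' F1' F2' F3'.
Hypothesis data' : canonical_data sigma' b1' s' q' F1' F2' F3'.
Context dO' (Om' : measurableType dO') (P' : probability Om' R) (X' : R -> {RV P' >-> R}).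
Hypothesis rep' : stable_representation alpha P' X'
  (canonical_control sigma') (canonical_domain q') (canonical_integrand G').
Hypothesis ss' : self_similar P' H X'.

Hypothesis hZ' : standard_borel R Z'.
Hypothesis full :
  full_support (canonical_control sigma) (canonical_domain q) (canonical_integrand G).
Variable c : R.
Hypothesis XX' : eq_fdd P P' X (fun t w => c * X' t w).

Let alpha1 : 1 <= alpha. Proof. by case/andP: halpha => /ltW. Qed.
Let tau := grid_time (alpha * H).
Let xk k := x (tau k).
Let xk' k p := c * x' (tau k) p.

Let mxk k : measurable_fun setT (xk k).
Proof. exact: (measurable_canonical_family1 kappa data). Qed.

Let mxk' k : measurable_fun setT (xk' k).
Proof. by apply: measurable_funM => //; exact: (measurable_canonical_family1 kappa data'). Qed.

Let norm_xk N (a : nat -> R) :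
  (\int[m]_p (`|lform N a (xk^~ p)| `^ alpha)%:E =
   \int[canonical_control sigma]_p (`|\sum_(i < N) a i *
     (canonical_integrand G (tau i) \_ (canonical_domain q)) p| `^ alpha)%:E)%E.
Proof. exact: (canonical_family_lcomb data (fun i : 'I_N => a i) _ rep.1). Qed.

Let fin_norm N (a : nat -> R) : (\int[m]_p (`|lform N a (xk^~ p)| `^ alpha)%:E < +oo)%E.
Proof.
rewrite norm_xk; apply: (Lfun_int_lty alpha1).
exact: (Lfun_sum alpha1 _ (rep.1 0) (fun=> rep.1 _)).
Qed.

Let same_norm N (a : nat -> R) : (\int[m]_p (`|lform N a (xk^~ p)| `^ alpha)%:E =
  \int[m']_p (`|lform N a (xk'^~ p)| `^ alpha)%:E)%E.
Proof.
rewrite norm_xk.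
have -> := @same_norm_of_fdd R alpha _ _ P X _ _ P' X' _ _ _ _ _ _ _ _ _ _ c id id
  alpha1 rep rep' XX' N (fun i => a i) (fun i => tau i).
have := canonical_family_lcomb data' (fun i : 'I_N => a i * c) (fun i => tau i) rep'.1.
move=> E; apply: (etrans (etrans _ (esym E))); apply: eq_integral => p _;
  congr ((`|_| `^ alpha)%:E); apply: eq_bigr => i _.
- by rewrite mulrA.
- by rewrite -mulrA.
Qed.

Lemma matching_canonical_families :
  exists (A : nat -> set S) (Phi : nat -> S -> S') (h : nat -> S -> R),
  [/\ forall j, [/\ measurable (A j), measurable_fun (A j) (Phi j) & measurable_fun (A j) (h j)],
      m (good_domain b1 s q `\` \bigcup_j A j) = 0%E &
      forall j p, A j p -> [/\ good_domain b1 s q p, good_domain b1' s' q' (Phi j p),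
        h j p != 0 & {ae mu, forall t, x t p = h j p * x' t (Phi j p)}]].
Proof.
have [E [mE E0 Ecvg]] := canonical_family_grid alpha1 H0 data rep ss.
have [E' [mE' E0' Ecvg']] := canonical_family_grid alpha1 H0 data' rep' ss'.
have sbS' : standard_borel R S'.
  by apply: standard_borel_prod standard_borel_R; apply: standard_borel_prod standard_borel_R.
have nE' k : m' (~` E' `&` [set p | xk' k p != 0]) = 0%E.
  apply: (subset_measure0 _ (measurableC mE') _ E0') => [|p []//].
  apply: measurableI; first exact: measurableC.
  rewrite (_ : [set p | _] = xk' k @^-1` (~` [set 0])); last first.
    by apply/seteqP; split => p /= /eqP.
  by rewrite -[X in measurable X]setTI; apply: mxk' => //; exact: measurableC.
have /choice[A /choice[Phi APhi]] := fun k =>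
  matching_up_to_scaling halpha mxk mxk' fin_norm same_norm (k := k) sbS' mE' (nE' k).
(* Pieces are indexed by the coordinate [k] that serves as denominator and by the piece [j] obtained
   for it. Intersecting with [E] keeps the points whose grid values converge for almost every
   time. *)
pose B n : set S := if unpickle n is Some (k, j) then A k j `&` E else set0.
pose Psi n : S -> S' := if unpickle n is Some (k, j) then Phi k j else fun=> point.
pose r n p : R :=
  if unpickle n is Some (k, j) then xk k p / xk' k (Phi k j p) * c else 1.
exists B, Psi, r; split.
- move=> n; rewrite /B /Psi /r; case: (unpickle n) => [[k j]|]; last first.
    by split => //; exact: measurable_cst.
  have [/(_ j)[mA mPhi] _ _] := APhi k.
  have mPhiE : measurable_fun (A k j `&` E) (Phi k j) by apply: measurable_funS mPhi.
  split => //; first exact: measurableI.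
  apply: measurable_funM => //; apply: measurable_funM; first exact: measurable_funTS.
  exact: (measurableT_comp (measurable_inv (mxk' k)) mPhiE).
- have full0 := canonical_family_full_support alpha1 H0 data rep ss full.
  have mxk0 k : measurable [set p | xk k p != 0].
    rewrite (_ : [set p | _] = xk k @^-1` (~` [set 0])); last first.
      by apply/seteqP; split => p /= /eqP.
    by rewrite -[X in measurable X]setTI; apply: mxk => //; exact: measurableC.
  have mgd := measurable_good_domain data.
  have mW k : measurable ([set p | xk k p != 0] `\` \bigcup_j A k j).
    by apply: measurableD => //; apply: bigcup_measurable => j _; have [/(_ j)[]] := APhi k.
  have mB : measurable (good_domain b1 s q `\` \bigcup_j B j).
    apply: measurableD => //; apply: bigcup_measurable => n _; rewrite /B.
    case: (unpickle n) => [[k j]|]//; apply: measurableI => //.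
    by have [/(_ j)[]] := APhi k.
  pose N0 := good_domain b1 s q `&` [set p | forall k, xk k p = 0].
  have mN0 : measurable N0.
    apply: measurableI => //; rewrite (_ : [set p | _] = \bigcap_k (xk k @^-1` [set 0])).
      by apply: bigcapT_measurable => k; rewrite -[X in measurable X]setTI; exact: mxk.
    by apply/seteqP; split => p px k; [move=> _|]; exact: px.
  apply/negligibleP => //.
  apply: (@negligibleS _ _ _ _ ((N0 `|` ~` E) `|`
      \bigcup_k ([set p | xk k p != 0] `\` \bigcup_j A k j))).
    move=> p [gp nB]; have [Ep|nE] := pselect (E p); last by left; right.
    have [x0|/existsNP[k /eqP xp]] := pselect (forall k, xk k p = 0); first by left; left.
    right; exists k => //; split => // -[j _ Ap]; apply: nB.
    by exists (pickle (k, j)) => //; rewrite /B pickleK.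
  apply: negligibleU; first apply: negligibleU.
  - exact/negligibleP.
  - by apply/negligibleP => //; exact: measurableC.
  - by apply: negligible_bigcup => k; apply/negligibleP => //; have [] := APhi k.
- move=> n p; rewrite /B /Psi /r; case: (unpickle n) => [[k j]|]// [Ap Ep].
  have [_ _ /(_ j p Ap)[E'p xp x'p ratio]] := APhi k.
  have gp : good_domain b1 s q p.
    by apply: contrapT => /(canonical_family0 kappa F1 F2 F3 (tau k)) x0;
      move/eqP: xp; apply; exact: x0.
  (* Essential identity allows any real [c]; a nonzero value of [c * x'] at the matched point
     excludes 0. *)
  have c0 : c != 0 by apply: contra x'p => /eqP c0; rewrite /xk' c0 mul0r.
  have x'p0 : x' (tau k) (Phi k j p) != 0.
    by apply: contra x'p => /eqP; rewrite /xk' => ->; rewrite mulr0.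
  have gp' : good_domain b1' s' q' (Phi k j p).
    by apply: contrapT => /(canonical_family0 kappa F1' F2' F3' (tau k)) x0;
      move/eqP: x'p0; apply; exact: x0.
  split => //; first by rewrite !mulf_neq0// invr_eq0.
  have := Ecvg' _ E'p; have := Ecvg _ Ep.
  apply: (@filterS2 _ _ (ae_filter_ringOfSetsType mu)) => t ct ct'.
  apply: (cvg_unique _ ct) => //.
  set rp := _ * c; have cr : (fun=> rp) i @[i --> \oo] --> rp by exact: cvg_cst.
  have := cvgM cr ct' _; rewrite (_ : _ \* _ = fun n => x (grid (alpha * H) n t) p).
    by apply.
  apply/funext => i /=; have [l ->] := grid_timeP (alpha * H) i t.
  by rewrite /rp -mulrA; exact/esym/ratio.
Qed.

End matching_canonical_families.

(** * Gluing the matched pieces *)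

Lemma null_ysection {R : realType} d (T : measurableType d) d' (T' : measurableType d')
    (m : {sigma_finite_measure set T -> \bar R})
    (m' : {sigma_finite_measure set T' -> \bar R}) A :
  measurable A -> (m \x m')%E A = 0%E ->
  exists E, [/\ measurable E, m' (~` E) = 0%E & forall y, E y -> m (ysection A y) = 0%E].
Proof.
move=> mA A0; pose f y := m (ysection A y).
have mf : measurable_fun setT f by exact: measurable_fun_ysection.
have mE : measurable (f @^-1` [set 0%E]).
  by rewrite -[X in measurable X]setTI; apply: mf.
exists (f @^-1` [set 0%E]); split => //.
apply: (weighted_eq0 (measurableC mE) mf).
  by move=> y /eqP fy; rewrite lt_neqAle eq_sym fy /f measure_ge0.
apply/eqP; rewrite eq_le integral_ge0 ?andbT//.
have I0 : (\int[m']_y f y = 0)%E.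
  rewrite -A0 (product_measure_unique (m' := (m \x^ m')%E))//.
  by move=> B C mB mC; exact: product_measure2E.
rewrite -[X in (_ <= X)%E]I0; apply: ge0_subset_integral => //.
exact: measurableC.
Qed.

Lemma conull_interval {R : realType} (E : set R) (a b : R) : a < b ->
  measurable (E : set (measurableTypeR R)) -> @lebesgue_measure R (~` E) = 0%E ->
  exists2 v, E v & a < v < b.
Proof.
move=> ab mE E0; apply: contrapT => nv.
have sub : `]a, b[ `<=` ~` E.
  by move=> v /=; rewrite in_itv/= => vab Ev; apply: nv; exists v.
have := subset_measure0 (mu := @lebesgue_measure R) (measurable_itv _) (measurableC mE) sub E0.
have L : @lebesgue_measure R `]a, b[%classic = (b - a)%:E.
  by have := lebesgue_measure_itv (`]a, b[ : interval R); rewrite /= lte_fin ab -EFinB.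
move=> null; have : (b - a)%:E = 0%E :> \bar R by rewrite -L; exact: null.
by move=> [] /eqP; rewrite subr_eq0 => /eqP ba; move: ab; rewrite ba ltxx.
Qed.

(* The maps are glued along a choice of a piece containing [z]; no measurability of
   this choice is needed, since failures are covered by the null sets of all pieces. *)
Lemma ae_glue {R : realType} d (Z : measurableType d) d' (T : measurableType d')
    (sigma : {sigma_finite_measure set Z -> \bar R})
    (m : {sigma_finite_measure set T -> \bar R}) (Par : Type) (C : Par -> Prop)
    (Q : Z -> Par -> T -> Prop) (W : nat -> set Z) (B : nat -> set (Z * T))
    (par : nat -> Z -> Par) (par0 : Par) :
  (forall i, measurable (W i)) -> sigma (~` \bigcup_i W i) = 0%E ->
  (forall i, measurable (B i)) -> (forall i z, m (xsection (B i) z) = 0%E) ->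
  (forall i z, W i z -> C (par i z)) -> C par0 ->
  (forall i z w, W i z -> ~ B i (z, w) -> Q z (par i z) w) ->
  exists f : Z -> Par, (forall z, C (f z)) /\
    {ae (sigma \x m)%E, forall p, Q p.1 (f p.1) p.2}.
Proof.
move=> mW W0 mB B0 CW C0 QW.
have /choice[f fP] : forall z, exists a, C a /\
    ((\bigcup_i W i) z -> exists i, W i z /\ a = par i z).
  move=> z; have [[i _ Wi]|nW] := pselect ((\bigcup_i W i) z).
    by exists (par i z); split; [exact: CW|move=> _; exists i].
  by exists par0; split.
exists f; split => [z|]; first by have [] := fP z.
have mUW : measurable (\bigcup_i W i) by apply: bigcup_measurable.
apply: (@negligibleS _ _ _ _ ((~` \bigcup_i W i) `*` setT `|` \bigcup_i B i)).
  move=> [z w] /= nQ; have [Wz|] := pselect ((\bigcup_i W i) z); last by left.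
  have [_ /(_ Wz)[i [Wi fE]]] := fP z; right; exists i => //.
  by apply: contrapT => nB; apply: nQ; rewrite fE; exact: QW.
apply: negligibleU.
  apply/negligibleP; first by apply: measurableX => //; exact: measurableC.
  rewrite [LHS](product_measure1E sigma m)//; last exact: measurableC.
  by rewrite [X in (X * _)%E]W0 mul0e.
apply: negligible_bigcup => i; apply/negligibleP => //.
exact: product_null_xsection.
Qed.

Lemma measurable_fun_pair_on d (T : measurableType d) d1 (T1 : measurableType d1)
    d2 (T2 : measurableType d2) (E : set T) (f : T -> T1) (g : T -> T2) :
  measurable E -> measurable_fun E f -> measurable_fun E g ->
  measurable_fun E (fun x => (f x, g x)).
Proof.
move=> mE /(measurable_restrictT _ mE) mf /(measurable_restrictT _ mE) mg.
apply: (@eq_measurable_fun _ _ _ _ _ (fun x => ((f \_ E) x, (g \_ E) x))).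
  by move=> x Ex; rewrite !patchE Ex.
by apply: measurable_funTS; exact: measurable_fun_pair.
Qed.

(** The additive constant of [kernel_scaling] at the point [p]; [dilation] is the corresponding
    factor of [u]. *)
Definition log_shift {R : realType} (kappa : R) (T : Type) (b1 s F3 : T -> R)
    (p : (T * R) * R) : R :=
  (b1 p.1.1 == 1)%:R * (kappa == 0)%:R * (F3 p.1.1 * (p.1.2 / s p.1.1)).

Definition dilation {R : realType} (T : Type) (s : T -> R) (p : (T * R) * R) : R :=
  expR (p.1.2 / s p.1.1).

Section measurable_parts.
Context {R : realType} (kappa : R) d (Z : measurableType d).
Variables (sigma : {sigma_finite_measure set Z -> \bar R}).
Variables (b1 s q : Z -> R) (F1 F2 : Z -> R -> R) (F3 : Z -> R).
Local Notation S := ((Z * measurableTypeR R) * measurableTypeR R)%type.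
Let G := canonical_kernel kappa b1 s q F1 F2 F3.
Hypothesis data : canonical_data sigma b1 s q F1 F2 F3.

Let mz (f : Z -> R) : measurable_fun setT f -> measurable_fun [set: S] (fun p => f p.1.1).
Proof. by move=> mf; apply: (measurableT_comp mf); apply: measurableT_comp. Qed.

Let mquo : measurable_fun [set: S] (fun p => p.1.2 / s p.1.1 : R).
Proof.
have [[mb1 ms mq] _ _] := data; apply: measurable_funM; first by apply: measurableT_comp.
exact: (mz (measurable_inv ms)).
Qed.

Lemma measurable_dilation : measurable_fun [set: S] (dilation s).
Proof. by apply: measurableT_comp mquo; exact: measurable_expR. Qed.

Lemma measurable_log_shift : measurable_fun [set: S] (log_shift kappa b1 s F3).
Proof.
have [[mb1 ms mq] [_ _ mF3] _] := data; apply: measurable_funM.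
  apply: measurable_funM => //; apply: (mz (f := fun z => (b1 z == 1)%:R)).
  rewrite (_ : (fun _ => _) = fun z => \1_([set 1] : set R) (b1 z)).
    exact: (measurableT_comp (@measurable_indic _ _ _ setT _ _)).
  apply/funext => z; rewrite indicE (_ : (b1 z == 1) = (b1 z \in [set 1]))//.
  by apply/eqP/idP => [->|/set_mem//]; exact/mem_set.
by apply: measurable_funM; first exact: mz.
Qed.

Lemma measurable_kernel_comp e (T : measurableType e) (E : set T) (f : T -> S) :
  measurable_fun E f -> (forall t, E t -> good_part b1 s q (f t)) ->
  measurable_fun E (fun t => G (f t).1.1 (f t).1.2 (f t).2).
Proof.
have [[mb1 ms mq] [mF1 mF2 mF3] _] := data; move=> mf gf.
apply: (measurable_comp _ (g := f) _ (measurable_kernel kappa mb1 ms mq mF1 mF2 mF3)) => //.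
  exact: measurable_good_part.
by move=> _ [t Et <-]; exact: gf.
Qed.

End measurable_parts.

(** * From matched points to matched kernels on the slice [v = 0] *)

Section matched_kernels.
Context {R : realType} (kappa : R).
Local Notation mu := (@lebesgue_measure R).

Context d (Z : measurableType d).
Variables (b1 s q : Z -> R) (F1 F2 : Z -> R -> R) (F3 : Z -> R).
Local Notation S := ((Z * measurableTypeR R) * measurableTypeR R)%type.
Let G := canonical_kernel kappa b1 s q F1 F2 F3.
Let x := canonical_family kappa b1 s q F1 F2 F3.

Context d' (Z' : measurableType d').
Variables (b1' s' q' : Z' -> R) (F1' F2' : Z' -> R -> R) (F3' : Z' -> R).
Local Notation S' := ((Z' * measurableTypeR R) * measurableTypeR R)%type.
Let G' := canonical_kernel kappa b1' s' q' F1' F2' F3'.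
Let x' := canonical_family kappa b1' s' q' F1' F2' F3'.

Let c : S -> R := dilation s.
Let c' : S' -> R := dilation s'.
Let J p := log_shift kappa b1 s F3 p + G p.1.1 p.1.2 p.2.
Let J' p := log_shift kappa b1' s' F3' p + G' p.1.1 p.1.2 p.2.

(** Putting [w = c p * (t + p.2)] turns the argument [c' p' * (t + p'.2)] of the second kernel into
    [match_scale * w + match_shift]. Solving the matched increments for [G p.1.1 0 w] then gives
    [match_factor] and [match_const]. *)
Definition match_scale (p : S) (p' : S') : R := c' p' / c p.
Definition match_shift (p : S) (p' : S') : R := c' p' * (p'.2 - p.2).
Definition match_factor (r : R) (p : S) (p' : S') : R :=
  c p `^ kappa * r * (c' p' `^ kappa)^-1.
Definition match_const (r : R) (p : S) (p' : S') : R :=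
  c p `^ kappa * (J p - r * J' p').

Lemma matched_kernels r (p : S) (p' : S') :
  good_domain b1 s q p -> good_domain b1' s' q' p' ->
  {ae mu, forall t, x t p = r * x' t p'} ->
  {ae mu, forall w, G p.1.1 0 w = match_factor r p p' *
    G' p'.1.1 0 (match_scale p p' * w + match_shift p p') + match_const r p p'}.
Proof.
move=> gp gp' [N [mN N0 sub]].
have s0 : s p.1.1 != 0 by case: gp => _ [].
have s0' : s' p'.1.1 != 0 by case: gp' => _ [].
have c0 : c p != 0 by rewrite gt_eqF// expR_gt0.
have ck : c p `^ kappa != 0 by rewrite gt_eqF// powR_gt0// expR_gt0.
have ck' : c' p' `^ kappa != 0 by rewrite gt_eqF// powR_gt0// expR_gt0.
(* Besides the exceptional times of the matching, the two times at which an argument of a kernel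
   vanishes are discarded, as [kernel_scaling] needs [u != 0]. The affine map from [w] to [t] keeps
   the union null. *)
have null : mu.-negligible (N `|` [set - p.2] `|` [set - p'.2]).
  apply: negligibleU; first apply: negligibleU.
  - by exists N; split.
  - by exists [set - p.2]; split => //; exact: lebesgue_measure_set1.
  - by exists [set - p'.2]; split => //; exact: lebesgue_measure_set1.
have ci : (c p)^-1 != 0 by rewrite invr_eq0.
apply: negligibleS (negligible_affine (- p.2) ci null).
move=> w /= nw; apply: contrapT => /not_orP[/not_orP[nN n2] n2']; apply: nw.
set t := _ + _ in nN n2 n2'.
have tp : t + p.2 != 0 by apply/eqP => t0; apply: n2; apply/eqP; rewrite -addr_eq0 t0.
have tp' : t + p'.2 != 0 by apply/eqP => t0; apply: n2'; apply/eqP; rewrite -addr_eq0 t0.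
have wE : w = c p * (t + p.2) by rewrite /t subrK mulrA divff// mul1r.
have w'E : match_scale p p' * w + match_shift p p' = c' p' * (t + p'.2).
  by rewrite wE /match_scale /match_shift mulrA divfK//; ring.
have : x t p = r * x' t p' by apply: contrapT => H; apply: nN; exact: sub.
rewrite /x /x' !canonical_familyE//.
rewrite (kernel_scaling kappa b1 q F1 F2 F3 p.1.2 s0 tp).
rewrite (kernel_scaling kappa b1' q' F1' F2' F3' p'.1.2 s0' tp').
rewrite w'E (_ : G p.1.1 0 w = G p.1.1 0 (c p * (t + p.2))); last by rewrite -wE.
rewrite /match_factor /match_const /J /J' -/G -/G'.
rewrite -/(log_shift kappa b1 s F3 p) -/(log_shift kappa b1' s' F3' p').
rewrite -[expR (p.1.2 / _)]/(c p) -[expR (p'.1.2 / _)]/(c' p').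
move: (G p.1.1 0 _) (G' p'.1.1 0 _) (log_shift kappa b1 s F3 p) (log_shift kappa b1' s' F3' p').
move: (G p.1.1 p.1.2 p.2) (G' p'.1.1 p'.1.2 p'.2).
move: (c p `^ kappa) (c' p' `^ kappa) ck ck' => a a' a0 a'0 K K' X X' L L' E.
have XE : X = a * (r * (a'^-1 * X' - L' - K') + L + K) by rewrite -E; field.
by rewrite XE; ring.
Qed.

Variables (sigma : {sigma_finite_measure set Z -> \bar R}).
Variables (sigma' : {sigma_finite_measure set Z' -> \bar R}).
Hypothesis data : canonical_data sigma b1 s q F1 F2 F3.
Hypothesis data' : canonical_data sigma' b1' s' q' F1' F2' F3'.

(* The fibre over [z] is represented by the single point [((z, v0), u0)]; it suffices
   because [kernel_scaling] recovers the kernel at [v0] from the kernel at [0]. *)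
Lemma matched_piece (A : set S) (Phi : S -> S') (h : S -> R) (v0 u0 : R) :
  measurable A -> measurable_fun A Phi -> measurable_fun A h ->
  (forall p, A p -> [/\ good_domain b1 s q p, good_domain b1' s' q' (Phi p),
        h p != 0 & {ae mu, forall t, x t p = h p * x' t (Phi p)}]) ->
  let p z : S := ((z, v0), u0) in
  measurable (p @^-1` A) /\ exists B : set (Z * measurableTypeR R), [/\ measurable B,
    forall z, mu (xsection B z) = 0%E &
    forall z w, A (p z) -> ~ B (z, w) -> G z 0 w =
      match_factor (h (p z)) (p z) (Phi (p z)) * G' (Phi (p z)).1.1 0
        (match_scale (p z) (Phi (p z)) * w + match_shift (p z) (Phi (p z))) +
      match_const (h (p z)) (p z) (Phi (p z))].
Proof.
move=> mA mPhi mh AP p.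
have mp : measurable_fun [set: Z] p.
  by apply: measurable_fun_pair => //; exact: measurable_fun_pair.
have mW : measurable (p @^-1` A) by rewrite -[X in measurable X]setTI; exact: mp.
split => //; pose V : set (Z * measurableTypeR R) := (p @^-1` A) `*` setT.
have mV : measurable V by exact: measurableX.
have lift e (U : measurableType e) (f : S -> U) : measurable_fun A f ->
    measurable_fun V (fun y => f (p y.1)).
  move=> mf; apply: (measurable_comp mA (g := fun y => p y.1) _ mf).
    by move=> _ [y [Ay _] <-].
  by apply: measurable_funTS; exact: (measurableT_comp mp measurable_fst).
have mc : measurable_fun A c by apply: measurable_funTS; exact: (measurable_dilation data).
have mc' : measurable_fun A (fun p => c' (Phi p)).
  exact: (measurableT_comp (measurable_dilation data') mPhi).
have mpow f : measurable_fun A (f : S -> R) -> measurable_fun A (fun p => f p `^ kappa).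
  by move=> mf; exact: (measurableT_comp (measurable_powR kappa) mf).
have minv f : measurable_fun A (f : S -> R) -> measurable_fun A (fun p => (f p)^-1).
  by move=> mf; apply: (measurableT_comp (measurable_inv (@measurable_id _ R setT)) mf).
have mscale : measurable_fun A (fun p => match_scale p (Phi p)).
  by apply: measurable_funM => //; exact: minv.
have mshift : measurable_fun A (fun p => match_shift p (Phi p)).
  apply: measurable_funM => //; apply: measurable_funB; last exact: measurable_funTS.
  exact: (measurableT_comp measurable_snd mPhi).
have mfactor : measurable_fun A (fun p => match_factor (h p) p (Phi p)).
  apply: measurable_funM; last by apply: minv; exact: mpow.
  by apply: measurable_funM => //; exact: mpow.
have mconst : measurable_fun A (fun p => match_const (h p) p (Phi p)).
  apply: measurable_funM; first exact: mpow.
  apply: measurable_funB; last (apply: measurable_funM => //).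
  - apply: measurable_funD.
      by apply: measurable_funTS; exact: (measurable_log_shift kappa data).
    by apply: (measurable_kernel_comp kappa data) => // y /AP[[]].
  - apply: measurable_funD; first exact: (measurableT_comp (measurable_log_shift kappa data') mPhi).
    by apply: (measurable_kernel_comp kappa data') => // y /AP[_ []].
(* Joint measurability of this defect yields one measurable exceptional set in the product, with
   null sections, as the gluing requires. *)
pose D (y : Z * measurableTypeR R) : R := G y.1 0 y.2 -
  (match_factor (h (p y.1)) (p y.1) (Phi (p y.1)) * G' (Phi (p y.1)).1.1 0
    (match_scale (p y.1) (Phi (p y.1)) * y.2 + match_shift (p y.1) (Phi (p y.1))) +
  match_const (h (p y.1)) (p y.1) (Phi (p y.1))).
have mD : measurable_fun V D.
  have msnd : measurable_fun V (fun y => y.2 : measurableTypeR R).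
    by apply: measurable_funTS; exact: measurable_snd.
  have mfst : measurable_fun V (fun y => y.1).
    by apply: measurable_funTS; exact: measurable_fst.
  apply: measurable_funB.
    apply: (@measurable_kernel_comp _ _ _ _ _ _ _ _ _ _ _ data _ _ V
      (fun y => ((y.1, 0), y.2))).
      by apply: measurable_fun_pair_on => //; exact: measurable_fun_pair_on.
    by move=> y [/AP[[_ gy] _ _ _] _].
  apply: measurable_funD; last exact: lift mconst.
  apply: measurable_funM; first exact: lift mfactor.
  apply: (@measurable_kernel_comp _ _ _ _ _ _ _ _ _ _ _ data' _ _ V (fun y =>
    (((Phi (p y.1)).1.1, 0),
      match_scale (p y.1) (Phi (p y.1)) * y.2 + match_shift (p y.1) (Phi (p y.1))))).
    apply: measurable_fun_pair_on => //.
      apply: measurable_fun_pair_on => //; apply: (lift _ _ (fun p => (Phi p).1.1)).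
      apply: (measurableT_comp measurable_fst); exact: (measurableT_comp measurable_fst mPhi).
    apply: measurable_funD; last exact: lift mshift.
    by apply: measurable_funM => //; exact: lift mscale.
  by move=> y [/AP[_ [_ gy] _ _] _].
exists (V `&` D @^-1` (~` [set 0])); split.
- by apply: mD => //; exact: measurableC.
- move=> z; have [Apz|nA] := pselect (A (p z)); last first.
    rewrite (_ : xsection _ _ = set0) ?measure0//.
    by apply/seteqP; split => // w; rewrite /xsection/= inE => -[[]].
  have [gp gp' _ rel] := AP _ Apz.
  have [N [mN N0 sub]] := matched_kernels gp gp' rel.
  apply: (subset_measure0 _ mN _ N0).
    by apply: measurable_xsection; apply: mD => //; exact: measurableC.
  move=> w; rewrite /xsection/= inE => -[_ Dw]; apply: sub => E; apply: Dw.
  by rewrite /D /= [X in X - _]E subrr.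
- move=> z w Apz nB; apply/eqP; rewrite -subr_eq0; apply/eqP; apply: contrapT => Dw.
  by apply: nB; split.
Qed.

End matched_kernels.

Theorem theorem7p1 (R : realType) (alpha H : R)
    (halpha : 1 < alpha < 2) (hH : 0 < H)
    (d : measure_display) (Om : measurableType d) (P : probability Om R)
    (X : R -> {RV P >-> R})
    (d' : measure_display) (Om' : measurableType d') (P' : probability Om' R)
    (X' : R -> {RV P' >-> R})
    (hX : PFSM alpha H P X \/ CFSM alpha H P X)
    (hX' : PFSM alpha H P' X' \/ CFSM alpha H P' X')
    (dZ : measure_display) (Z : measurableType dZ)
    (sigma : {sigma_finite_measure set Z -> \bar R})
    (b1 s q : Z -> R) (F1 F2 : Z -> R -> R) (F3 : Z -> R)
    (hZ : standard_borel R Z)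
    (hdata : canonical_data sigma b1 s q F1 F2 F3)
    (dZ' : measure_display) (Z' : measurableType dZ')
    (sigma' : {sigma_finite_measure set Z' -> \bar R})
    (b1' s' q' : Z' -> R) (F1' F2' : Z' -> R -> R) (F3' : Z' -> R)
    (hZ' : standard_borel R Z')
    (hdata' : canonical_data sigma' b1' s' q' F1' F2' F3') :
  let kappa := H - alpha^-1 in
  let G := canonical_kernel kappa b1 s q F1 F2 F3 in
  let G' := canonical_kernel kappa b1' s' q' F1' F2' F3' in
  stable_representation alpha P X
    (canonical_control sigma) (canonical_domain q) (canonical_integrand G) ->
  stable_representation alpha P' X'
    (canonical_control sigma') (canonical_domain q') (canonical_integrand G') ->
  full_support
    (canonical_control sigma) (canonical_domain q) (canonical_integrand G) ->
  essentially_identical P P' X X' ->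
  exists (h : Z -> R) (psi : Z -> Z') (k g j : Z -> R),
    [/\ forall z, h z != 0,
        forall z, 0 < k z &
        {ae (sigma \x @lebesgue_measure R)%E, forall p,
           G p.1 0 p.2 =
           h p.1 * G' (psi p.1) 0 (k p.1 * p.2 + g p.1) + j p.1}].
Proof.
move=> kappa G G' rep rep' full [c XX'].
have ss : self_similar P H X by case: hX => -[].
have ss' : self_similar P' H X' by case: hX' => -[].
pose mu := @lebesgue_measure R.
have [A [Phi [r [mAP A0 match_A]]]] :=
  matching_canonical_families halpha hH hdata rep ss hdata' rep' ss' hZ' full XX'.
set N := _ `\` _ in A0.
have mA : measurable (\bigcup_j A j) by apply: bigcup_measurable => j _; have [] := mAP j.
have mN : measurable N by apply: measurableD => //; exact: measurable_good_domain hdata.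
(* Two uses of Tonelli on the unmatched set: first a level [u0] with null section, then a conull set
   of heights [v] at which almost every [z] is matched or lies outside the domain. *)
have [E [mE E0 EN]] := null_ysection (m := sigma_finite_product sigma mu) mN A0.
have [u0 Eu0 _] := conull_interval (@ltr01 R) mE E0.
have mN1 : measurable (ysection N u0) by exact: measurable_ysection.
have [E1 [mE1 E10 E1N]] := null_ysection mN1 (EN _ Eu0).
(* [q] has no positive lower bound, so a sequence of heights tending to 0 is used: each good [z] has
   [v n < q z] for some [n], which puts [((z, v n), u0)] in the domain. *)
have /choice[v vP] : forall n : nat, exists v, E1 v /\ 0 < v < n.+1%:R^-1.
  move=> n; have n0 : 0 < n.+1%:R^-1 :> R by rewrite invr_gt0.
  by have [v Ev v0] := conull_interval n0 mE1 E10; exists v.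
pose p n z : (Z * measurableTypeR R) * measurableTypeR R := ((z, v n), u0).
have mA1 j : measurable (A j) by have [] := mAP j.
have mPhi j : measurable_fun (A j) (Phi j) by have [] := mAP j.
have mr j : measurable_fun (A j) (r j) by have [] := mAP j.
have piece n j := matched_piece hdata hdata' (v n) u0 (mA1 j) (mPhi j) (mr j) (match_A j).
have /choice[B BP] := fun nj : nat * nat => (piece nj.1 nj.2).2.
(* The values of [h], [psi], [k], [g], [j] at one point, in this order. *)
pose Par : Type := R * Z' * R * R * R.
pose Q z (a : Par) w :=
  G z 0 w = a.1.1.1.1 * G' a.1.1.1.2 0 (a.1.1.2 * w + a.1.2) + a.2.
pose W i := if unpickle i is Some (n, j) then p n @^-1` A j else set0.
pose Bi i := if unpickle i is Some nj then B nj else set0.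
pose par i z : Par := if unpickle i is Some (n, j) then
    (match_factor kappa s s' (r j (p n z)) (p n z) (Phi j (p n z)), (Phi j (p n z)).1.1,
     match_scale s s' (p n z) (Phi j (p n z)), match_shift s' (p n z) (Phi j (p n z)),
     match_const kappa b1 s q F1 F2 F3 b1' s' q' F1' F2' F3' (r j (p n z)) (p n z) (Phi j (p n z)))
  else (1, point, 1, 0, 0).
have mW i : measurable (W i).
  by rewrite /W; case: (unpickle i) => [[n j]|]//; exact: (piece n j).1.
have [||||||f [fC fQ]] := ae_glue (sigma := sigma) (m := mu)
  (C := fun a : Par => a.1.1.1.1 != 0 /\ 0 < a.1.1.2) (Q := Q) (W := W) (B := Bi)
  (par := par) (par0 := (1, point, 1, 0, 0)) mW.
- apply/negligibleP; first by apply: measurableC; exact: bigcup_measurable.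
  apply: (@negligibleS _ _ _ _ (~` good_fiber b1 s q `|` \bigcup_n ysection (ysection N u0) (v n))).
    move=> z nW; have [gz|] := pselect (good_fiber b1 s q z); last by left.
    right; have [_ _ qz] := gz.
    have [n nq] : exists n : nat, n.+1%:R^-1 < q z.
      by have [n _ /(_ n (leqnn n))] := near_infty_natSinv_lt (PosNum qz); exists n.
    have [_ /andP[v0 vn]] := vP n.
    exists n => //; rewrite /ysection/= inE/= inE; split.
      by split => //; rewrite /canonical_domain /under_graph /= (ltW v0) (lt_trans vn).
    move=> [j _ Aj]; apply: nW; exists (pickle (n, j)) => //.
    by rewrite /W pickleK.
  apply: negligibleU.
    apply/negligibleP; last exact: good_fiber_conull hdata.
    by apply: measurableC; have [[? ? ?] _ _] := hdata; exact: measurable_good_fiber.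
  apply: negligible_bigcup => n; apply/negligibleP; first exact: measurable_ysection.
  by apply: E1N; have [] := vP n.
- by move=> i; rewrite /Bi; case: (unpickle i) => [nj|]//; have [] := BP nj.
- move=> i z; rewrite /Bi; case: (unpickle i) => [nj|].
    by have [_ null _] := BP nj; exact: null.
  by rewrite xsection0 measure0.
- move=> i z; rewrite /W /par; case: (unpickle i) => [[n j]|]//= /match_A[_ _ r0 _].
  split; first by rewrite !mulf_neq0// ?invr_eq0 gt_eqF// powR_gt0// expR_gt0.
  by rewrite divr_gt0// expR_gt0.
- by split => //=; rewrite oner_neq0.
- move=> i z w; rewrite /W /par /Bi /Q; case: (unpickle i) => [[n j]|]//= Aj nB.
  by have [_ _ rel] := BP (n, j); exact: rel.
exists (fun z => (f z).1.1.1.1), (fun z => (f z).1.1.1.2), (fun z => (f z).1.1.2),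
  (fun z => (f z).1.2), (fun z => (f z).2).
split => [z|z|]; [by have [] := fC z|by have [] := fC z|].
exact: fQ.
Qed.
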